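(* For every positive integer $n$, \begin{align*} \tau_{7,3,\chi_{-3}}(n) & = \frac{1}{30} \sum_{F_3(x_1,\ldots,x_6)=n} \left(15 x_1^4 -12n x_1^2 + n^2\right),\\ 27\, \tau_{9,3,\chi_{-3};1}(n) + \tau_{9,3,\chi_{-3};2}(n) & =\frac{1}{168} \sum_{F_5(x_1,\ldots,x_{10})=n} \left(63 x_1^4 -36n x_1^2 + 2n^2\right),\\ \tau_{11,3,\chi_{-3};1}(n) + 9\, \tau_{11,3,\chi_{-3};2}(n) & =\frac{5}{81} \sum_{F_7(x_1,\ldots,x_{14})=n} \left(54 x_1^4 -24 n x_1^2 + n^2\right), \end{align*} where each sum runs over all integer vectors $(x_1,\ldots,x_{2j})\in\mathbb{Z}^{2j}$ with $F_j(x_1,\ldots,x_{2j})=n$ ($j=3,5,7$ respectively).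
   Context: For a positive integer $k$, let $F_k(x_1,\ldots,x_{2k}) = \sum_{j=1}^k \left(x_{2j-1}^2 + x_{2j-1}x_{2j} + x_{2j}^2\right)$. Let $\chi_{-3} = \left(\frac{-3}{\cdot}\right)$, the primitive quadratic Dirichlet character modulo $3$. Let $q=e^{2\pi i z}$ with $\mathrm{Im}(z)>0$, $\eta(z) = q^{1/24}\prod_{n\ge 1}(1-q^n)$, and $E_4(z) = 1+240\sum_{n\ge1}\sigma_3(n)q^n$, where $\sigma_3(n)=\sum_{d\mid n}d^3$. The numbers $\tau_{\ast}(n)$ are the Fourier coefficients of the following cusp forms of level $3$ and character $\chi_{-3}$: - Weight $7$: $\Delta_{7,3,\chi_{-3}}(z) = \sum_{n\ge1}\tau_{7,3,\chi_{-3}}(n)q^n = \frac{1}{240}\left(E_4(z)-E_4(3z)\right)\eta^9(z)\eta^{-3}(3z)$, the unique normalized newform of weight $7$, level $3$, character $\chi_{-3}$. - Weight $9$: $\sum_{n\ge1}\tau_{9,3,\chi_{-3};1}(n)q^n = \eta^3(z)\eta^{15}(3z)$ and $\sum_{n\ge1}\tau_{9,3,\chi_{-3};2}(n)q^n = \eta^{15}(z)\eta^{3}(3z)$. - Weight $11$: $\sum_{n\ge1}\tau_{11,3,\chi_{-3};1}(n)q^n = E_4(z)\Delta_{7,3,\chi_{-3}}(z)$ and $\sum_{n\ge1}\tau_{11,3,\chi_{-3};2}(n)q^n = E_4(3z)\Delta_{7,3,\chi_{-3}}(z)$. *)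

(* Defs.v *)
From mathcomp Require Import all_boot all_order all_algebra.
From mathcomp Require Import complex.
From mathcomp Require Import all_classical all_reals all_analysis.
Set Implicit Arguments.
Unset Strict Implicit.
Unset Printing Implicit Defensive.
Import Order.TTheory GRing.Theory Num.Theory.
Import numFieldNormedType.Exports.
Local Open Scope classical_set_scope.
Local Open Scope complex_scope.
Local Open Scope ring_scope.

(* Vectors are tuples indexed from 0: the informal x_(2j-1), x_(2j), for
   1 <= j <= k, are x`_(2 * j) and x`_(2 * j).+1, for j < k. *)
Definition F (k : nat) (x : (2 * k).-tuple int) : int :=
  \sum_(j < k) (x`_(2 * j) ^+ 2 + x`_(2 * j) * x`_(2 * j).+1
                + x`_(2 * j).+1 ^+ 2).

(* The set of representations is finite since F is positive definite, so sums
   over it (finitely supported sums, \sum_(_ \in _)) are ordinary sums. *)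
Definition representations (k n : nat) : set ((2 * k).-tuple int) :=
  [set x | F x = n%:Z].

Arguments representations : clear implicits.

Definition sigma3 (n : nat) : nat := (\sum_(d <- divisors n) d ^ 3)%N.

Section QSeries.
Variable R : realType.
Implicit Types z : R[i].

Definition cexp z : R[i] :=
  (expR (complex.Re z) * cos (complex.Im z))
  +i* (expR (complex.Re z) * sin (complex.Im z)).

(* qpow r z is q^r = exp (2 pi i r z), for real r. *)
Definition qpow (r : R) z : R[i] := cexp ((2 * pi * r)%:C * 'i%C * z).

Definition q z : R[i] := qpow 1 z.

(* R[i] gets its usual topology through the alias R[i]^o. *)
Definition eta z : R[i] :=
  qpow 24^-1 z *
  lim ((\prod_(1 <= n < N) (1 - q z ^+ n) : R[i]^o) @[N --> \oo]).

Definition E4 z : R[i] :=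
  1 + 240 *
  lim ((\sum_(1 <= n < N) (sigma3 n)%:R * q z ^+ n : R[i]^o) @[N --> \oo]).

Definition Delta7 z : R[i] :=
  240^-1 * (E4 z - E4 (3 * z)) * eta z ^+ 9 * eta (3 * z) ^- 3.

Definition Delta9_1 z : R[i] := eta z ^+ 3 * eta (3 * z) ^+ 15.
Definition Delta9_2 z : R[i] := eta z ^+ 15 * eta (3 * z) ^+ 3.

Definition Delta11_1 z : R[i] := E4 z * Delta7 z.
Definition Delta11_2 z : R[i] := E4 (3 * z) * Delta7 z.

(* f(z) = \sum_(n >= 1) a(n) q^n on the upper half-plane; this determines a(n)
   for n >= 1, and leaves a(0) unconstrained. *)
Definition fourier_expansion (f : R[i] -> R[i]) (a : nat -> R[i]) : Prop :=
  forall z, 0 < complex.Im z ->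
    (\sum_(1 <= n < N) a n * q z ^+ n : R[i]^o) @[N --> \oo] --> (f z : R[i]^o).

End QSeries.

(* Main.v *)
From HB Require Import structures.
Require Import Defs.
From mathcomp Require Import all_boot all_order all_algebra.
From mathcomp Require Import complex zify ring lra.
From mathcomp Require Import all_classical all_reals all_analysis.
Import Order.TTheory GRing.Theory Num.Theory.
Import numFieldNormedType.Exports.
Local Open Scope classical_set_scope.
Local Open Scope complex_scope.
Local Open Scope ring_scope.
Set Implicit Arguments.
Unset Strict Implicit.
Unset Printing Implicit Defensive.

(** Let a be the sum of q^(x^2 + x y + y^2) over the pairs of integers, the theta
    series of weight one of the hexagonal lattice, and let D be q d/dq. As the
    form in 2 k variables is a sum of k copies of x^2 + x y + y^2, the sum of
    P(x_1) over the representations of n has generating series T a^(k-1), where T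
    is the theta series weighted by P(x). The symmetries of the hexagonal lattice
    give T = 2/3 D a for P = x^2 and T = 2/3 D^2 a for P = x^4, and a factor n is
    an application of D. The three weighted sums therefore are combinations of
    a^(k-1) D^2 a and a^(k-2) (D a)^2, and their coefficients are such that only
    the Rankin-Cohen bracket G = a D^2 a - 2 (D a)^2 remains: the sums are the
    coefficients of 5 a G, 28 a^3 G and 27 a^5 G ([representation_sum3],
    [representation_sum5], [representation_sum7]).

    It remains to write the cusp forms in terms of a and G. Let e and E be Euler's
    product in q and in q^3, let b = e^9 / E^3, which is the cube of one of the
    cubic theta functions, let X and Q be the Eisenstein series of weight 2 and 4,
    and let Y be X in q^3. Everything follows from relations between
    these series, with Q' for Q in q^3:
      2 a^2 = 3 Y - X,   8 b = a (9 Y - X) - 24 D a,   a^3 - b = 27 q E^9 / e^3,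
      Q + 9 Q' = 10 a^4,   9 (Q - Q') = 80 a (a^3 - b),   9 G = 2 b (a^3 - b).
    For instance (Q - Q') b = 40 a G is the weight 7 identity, and the weight 9 one
    is a^3 G = b G + (a^3 - b) G.

    These relations are proved on formal power series, without modular forms. The
    cube of the Jacobi theta function with terms (-1)^i u^(2 i - 1) q^(i (i - 1) / 2)
    is a sum over triples of integers; grouping the triples by their sum writes it
    through a, through the theta series c of the other cosets of the dual
    hexagonal lattice, and through two theta functions of one variable
    ([triple_moment_split]). Taylor coefficients of the two expressions are compared
    at u = 1, where the theta function vanishes with derivative given by Jacobi's
    identity for e^3 ([jacobi]), and at a primitive cube root of unity, where it
    becomes a multiple of E ([moment_omega]); even coefficients are D of lower ones by
    the heat equation. Orders 0, 2 and 4 at the cube root of unity give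
    c e = 3 E^3, 2 a^2 = 3 Y - X and the value of D Y, order 1 at that point and
    orders 1 and 3 at u = 1 give the first derivative and the formula for b. Ramanujan's
    equation 12 D X = X^2 - Q ([D_eis2]) makes the ring of these series
    stable under D, and the rest is elimination, except for the formula
    for a^3 - b, where both sides solve the same first-order differential equation.

    The coefficients tau of the statement are given through convergent expansions of
    functions on the upper half-plane. Only the values on the imaginary axis
    are used, where q is a real number in ]0, 1[: there the cusp forms are the values of
    the formal series above ([eta_product_ipt], [E4_ipt]), and a real power
    series which vanishes on ]0, 1[ is zero ([psum_eq0]). *)

(** * Formal power series *)

Definition fps (K : comNzRingType) := nat -> K.

HB.instance Definition _ (K : comNzRingType) := gen_eqMixin (fps K).
HB.instance Definition _ (K : comNzRingType) := gen_choiceMixin (fps K).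

Section FpsRing.
Variable K : comNzRingType.
Implicit Types f g h : fps K.

Definition fps_zero : fps K := fun=> 0.
Definition fps_one : fps K := fun n => (n == 0)%:R.
Definition fps_opp f : fps K := fun n => - f n.
Definition fps_add f g : fps K := fun n => f n + g n.
Definition fps_mul f g : fps K := fun n => \sum_(i < n.+1) f i * g (n - i)%N.

Fact fps_addA : associative fps_add.
Proof. by move=> f g h; apply/funext => n; rewrite /fps_add addrA. Qed.
Fact fps_addC : commutative fps_add.
Proof. by move=> f g; apply/funext => n; rewrite /fps_add addrC. Qed.
Fact fps_add0 : left_id fps_zero fps_add.
Proof. by move=> f; apply/funext => n; rewrite /fps_add add0r. Qed.
Fact fps_addN : left_inverse fps_zero fps_opp fps_add.
Proof. by move=> f; apply/funext => n; rewrite /fps_add addNr. Qed.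

HB.instance Definition _ :=
  GRing.isZmodule.Build (fps K) fps_addA fps_addC fps_add0 fps_addN.

(** The ring axioms are inherited from polynomials through truncation. *)
Definition trunc N f : {poly K} := \poly_(i < N) f i.

Fact fps_mulE N f g n : (n < N)%N -> fps_mul f g n = (trunc N f * trunc N g)`_n.
Proof.
move=> nN; rewrite coefM; apply: eq_bigr => i _.
have iN : (i < N)%N by apply: leq_ltn_trans nN; rewrite -ltnS.
by rewrite !coef_poly iN (leq_ltn_trans _ nN)// leq_subr.
Qed.

Fact coef_truncM N (p r : {poly K}) f n : (n < N)%N ->
  (forall i, (i < N)%N -> p`_i = f i) -> (p * r)`_n = (trunc N f * r)`_n.
Proof.
move=> nN pf; rewrite !coefM; apply: eq_bigr => i _.
have iN : (i < N)%N by apply: leq_ltn_trans nN; rewrite -ltnS.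
by rewrite pf// coef_poly iN.
Qed.

Fact fps_mulC : commutative fps_mul.
Proof.
by move=> f g; apply/funext => n; rewrite !(@fps_mulE n.+1)// mulrC.
Qed.

Fact fps_mulA : associative fps_mul.
Proof.
move=> f g h; apply/funext => n; rewrite fps_mulC !(@fps_mulE n.+1)//.
rewrite -(@coef_truncM _ (trunc n.+1 g * trunc n.+1 h))//; last first.
  by move=> i iN; rewrite -fps_mulE.
rewrite -(@coef_truncM _ (trunc n.+1 f * trunc n.+1 g))//; last first.
  by move=> i iN; rewrite -fps_mulE.
by rewrite mulrC mulrA.
Qed.

Fact fps_mul1 : left_id fps_one fps_mul.
Proof.
move=> f; apply/funext => n; rewrite /fps_mul big_ord_recl /= mul1r subn0.
by rewrite big1 ?addr0// => i _; rewrite mul0r.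
Qed.

Fact fps_mulD : left_distributive fps_mul fps_add.
Proof.
move=> f g h; apply/funext => n; rewrite /fps_mul /fps_add -big_split.
by apply: eq_bigr => i _; rewrite mulrDl.
Qed.

Fact fps_one_neq0 : fps_one != 0 :> fps K.
Proof. by apply/eqP => /(congr1 (@^~ 0)) /eqP; rewrite oner_eq0. Qed.

HB.instance Definition _ := GRing.Zmodule_isComNzRing.Build (fps K)
  fps_mulA fps_mulC fps_mul1 fps_mulD fps_one_neq0.

Lemma fpsD f g n : (f + g) n = f n + g n. Proof. by []. Qed.
Lemma fpsN f n : (- f) n = - f n. Proof. by []. Qed.
Lemma fps0 n : (0 : fps K) n = 0. Proof. by []. Qed.
Lemma fps1 n : (1 : fps K) n = (n == 0)%:R. Proof. by []. Qed.
Lemma fpsM f g n : (f * g) n = \sum_(i < n.+1) f i * g (n - i)%N.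
Proof. by []. Qed.

Lemma fpsMn f m n : (f *+ m) n = f n *+ m.
Proof. by elim: m => [|m IHm]; rewrite ?mulr0n// !mulrS fpsD IHm. Qed.

Lemma fps_sum I (r : seq I) (P : pred I) (F : I -> fps K) n :
  (\sum_(i <- r | P i) F i) n = \sum_(i <- r | P i) F i n.
Proof. by elim/big_rec2 : _ => // i x y _ <-. Qed.

Definition fpsC (c : K) : fps K := fun n => if n == 0%N then c else 0.

Lemma fpsCM c f n : (fpsC c * f) n = c * f n.
Proof.
rewrite fpsM big_ord_recl subn0 big1 ?addr0// => i _.
by rewrite /fpsC /= mul0r.
Qed.

Fact fpsC_is_additive : zmod_morphism fpsC.
Proof.
move=> x y; apply/funext => n; rewrite fpsD fpsN /fpsC.
by case: eqP; rewrite ?subrr.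
Qed.
Fact fpsC_is_multiplicative : monoid_morphism fpsC.
Proof.
split=> [|x y]; apply/funext => n; first by rewrite fps1 /fpsC; case: eqP.
by rewrite fpsCM /fpsC; case: eqP => //; rewrite mulr0.
Qed.
HB.instance Definition _ :=
  GRing.isZmodMorphism.Build K (fps K) fpsC fpsC_is_additive.
HB.instance Definition _ :=
  GRing.isMonoidMorphism.Build K (fps K) fpsC fpsC_is_multiplicative.

Lemma fps_natM m f n : (m%:R * f) n = m%:R * f n.
Proof. by rewrite mulr_natl fpsMn mulr_natl. Qed.

(** The formal variable q. *)
Definition Xq : fps K := fun n => (n == 1)%:R.

Lemma XqM f n : (Xq * f) n = if n is m.+1 then f m else 0.
Proof.
rewrite fpsM big_ord_recl mul0r add0r; case: n => [|n]; first by rewrite big_ord0.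
rewrite big_ord_recl big1 ?addr0 ?mul1r ?subn0 /bump//= ?subSS ?subn0//.
by move=> i _; rewrite mul0r.
Qed.

Lemma XqnM m f n : (Xq ^+ m * f) n = if (m <= n)%N then f (n - m)%N else 0.
Proof.
elim: m n => [|m IHm] n; first by rewrite mul1r subn0.
by rewrite exprS -mulrA XqM; case: n => [|n]; rewrite ?IHm.
Qed.

Lemma Xqn m n : (Xq ^+ m) n = (n == m)%:R.
Proof.
rewrite -[Xq ^+ m]mulr1 XqnM fps1; case: leqP => [mn|nm].
  by rewrite subn_eq0 [in RHS]eqn_leq mn andbT.
by rewrite ltn_eqF.
Qed.

Lemma Xqn_inj m f g : Xq ^+ m * f = Xq ^+ m * g -> f = g.
Proof.
move=> fg; apply/funext => n; move/(congr1 (fun h : fps K => h (m + n)%N)) : fg.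
by rewrite !XqnM leq_addr addKn.
Qed.

(** Congruence modulo q^N. *)
Definition eqm N f g := forall n, (n < N)%N -> f n = g n.

Lemma eqm_sym N f g : eqm N f g -> eqm N g f.
Proof. by move=> fg n /fg. Qed.
Lemma eqm_trans N f g h : eqm N f g -> eqm N g h -> eqm N f h.
Proof. by move=> fg gh n nN; rewrite fg ?gh. Qed.
Lemma eqm_le M N f g : (M <= N)%N -> eqm N f g -> eqm M f g.
Proof. by move=> MN fg n nM; apply/fg/(leq_trans nM). Qed.
Lemma eqmD N f g f' g' : eqm N f f' -> eqm N g g' -> eqm N (f + g) (f' + g').
Proof. by move=> ff gg n nN; rewrite !fpsD ff ?gg. Qed.
Lemma eqmN N f f' : eqm N f f' -> eqm N (- f) (- f').
Proof. by move=> ff n nN; rewrite !fpsN ff. Qed.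
Lemma eqmM N f g f' g' : eqm N f f' -> eqm N g g' -> eqm N (f * g) (f' * g').
Proof.
move=> ff gg n nN; rewrite !fpsM; apply: eq_bigr => i _.
have iN : (i < N)%N by apply: leq_ltn_trans nN; rewrite -ltnS.
by rewrite ff// gg// (leq_ltn_trans _ nN)// leq_subr.
Qed.
Lemma eqm_XqM N m f : (N <= m)%N -> eqm N (Xq ^+ m * f) 0.
Proof. by move=> Nm n nN; rewrite XqnM leqNgt (leq_trans nN Nm). Qed.
Lemma eqmP f g : (forall N, eqm N f g) -> f = g.
Proof. by move=> fg; apply/funext => n; apply: (fg n.+1). Qed.

(** The derivation q d/dq. *)
Definition D f : fps K := fun n => n%:R * f n.

Lemma DE f n : D f n = n%:R * f n. Proof. by []. Qed.
Lemma D_additive : zmod_morphism D.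
Proof. by move=> f g; apply/funext => n; rewrite /D mulrBr. Qed.
HB.instance Definition _ := GRing.isZmodMorphism.Build (fps K) (fps K) D D_additive.

Lemma DM f g : D (f * g) = D f * g + f * D g.
Proof.
apply/funext => n; rewrite fpsD !fpsM DE mulr_sumr -big_split.
apply: eq_bigr => i _; rewrite !DE mulrA.
have -> : n%:R = i%:R + (n - i)%:R :> K by rewrite -natrD subnKC// -ltnS.
by rewrite /=; ring.
Qed.

Lemma D1 : D 1 = 0.
Proof.
apply/funext => n; rewrite DE fps1 fps0.
by case: eqP => [->|_]; rewrite ?mul0r ?mulr0.
Qed.

Lemma D_natM m f : D (m%:R * f) = m%:R * D f.
Proof. by rewrite !mulr_natl raddfMn. Qed.

Lemma DX f n : D (f ^+ n.+1) = n.+1%:R * D f * f ^+ n.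
Proof.
elim: n => [|n IHn]; first by rewrite mul1r mulr1.
rewrite exprS DM {}IHn [in RHS]mulrS !exprS; ring.
Qed.

Lemma DXq : D Xq = Xq.
Proof.
apply/funext => n; rewrite DE /Xq; case: eqP => [->|_]; by rewrite ?mulr1 ?mulr0.
Qed.

(** Substitution of q^3 for q. *)
Definition sub3 f : fps K := fun n => if (3 %| n)%N then f (n %/ 3)%N else 0.

Lemma sub3_mul3 f n : sub3 f (3 * n)%N = f n.
Proof. by rewrite /sub3 dvdn_mulr// mulKn. Qed.

Lemma sub3_additive : zmod_morphism sub3.
Proof.
move=> f g; apply/funext => n; rewrite fpsD fpsN /sub3.
by case: ifP; rewrite ?subrr.
Qed.

Lemma sub3_multiplicative : monoid_morphism sub3.
Proof.
split=> [|f g]; apply/funext => n.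
  by rewrite /sub3 !fps1; case: dvdnP => [[k ->]|n3]; [rewrite mulnK// muln_eq0 orbF|
     case: eqP => // n0; case: n3; exists 0%N].
rewrite fpsM; case: (boolP (3 %| n)%N) => [/dvdnP[m ->]|n3].
  rewrite mulnC sub3_mul3 fpsM -(big_mkord xpredT (fun i => sub3 f i * sub3 g (3 * m - i)%N)).
  rewrite -(big_mkord xpredT (fun i => f i * g (m - i)%N)).
  suff H k : (k <= m)%N -> \sum_(0 <= i < (3 * k).+1) sub3 f i * sub3 g (3 * m - i)%N
      = \sum_(0 <= i < k.+1) f i * g (m - i)%N.
    by rewrite H.
  elim: k => [|k IHk] km; first by rewrite !big_nat1 !subn0 sub3_mul3.
  rewrite [RHS]big_nat_recr//= -(IHk (ltnW km)).
  rewrite (_ : (3 * k.+1).+1 = (3 * k).+4)%N; last by lia.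
  do 3 rewrite big_nat_recr//=.
  have -> : sub3 f (3 * k).+1 = 0 by rewrite /sub3 ifN//; lia.
  have -> : sub3 f (3 * k).+2 = 0 by rewrite /sub3 ifN//; lia.
  rewrite !mul0r !addr0 -addn3; congr (_ + _ * _).
    by rewrite -(sub3_mul3 f) mulnS addnC.
  by rewrite -(sub3_mul3 g); congr (sub3 g _); lia.
rewrite big1 {1}/sub3 ?(negbTE n3)// => i _; rewrite /sub3.
case: (boolP (3 %| i)%N) => i3; last by rewrite mul0r.
by rewrite ifN ?mulr0//; have := ltn_ord i; lia.
Qed.

HB.instance Definition _ :=
  GRing.isZmodMorphism.Build (fps K) (fps K) sub3 sub3_additive.
HB.instance Definition _ :=
  GRing.isMonoidMorphism.Build (fps K) (fps K) sub3 sub3_multiplicative.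

Lemma D_sub3 f : D (sub3 f) = 3 * sub3 (D f).
Proof.
apply/funext => n; rewrite fps_natM DE /sub3; case: ifP => [/dvdnP[m ->]|_].
  by rewrite mulnK// DE mulnC natrM mulrA.
by rewrite !mulr0.
Qed.

End FpsRing.

Arguments Xq {K}.

Section FpsField.
Variable K : numFieldType.
Implicit Types f g h : fps K.

Lemma fps_mulfI f g h : f 0%N != 0 -> f * g = f * h -> g = h.
Proof.
move=> f0 fgh; apply/funext; elim/ltn_ind => n IHn.
move/(congr1 (@^~ n)) : fgh; rewrite !fpsM !big_ord_recl !subn0.
rewrite (eq_bigr (fun i : 'I_n => f (bump 0 i) * h (n - bump 0 i)%N)).
  by move=> /addIr /(mulfI f0).
by move=> i _; rewrite IHn// /bump; case: (n) i => [[]|m i] //=; rewrite ltnS subSS leq_subr.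
Qed.

(** For clearing the denominators of a relation before it is used in another one. *)
Lemma fps_natI m f g : m.+1%:R * f = m.+1%:R * g -> f = g.
Proof.
move=> fg; apply/funext => n; move/(congr1 (@^~ n)) : fg.
by rewrite !fps_natM; apply/mulfI; rewrite pnatr_eq0.
Qed.

Lemma fpsM0 f g : (f * g) 0%N = f 0%N * g 0%N.
Proof. by rewrite fpsM big_ord_recl big_ord0 addr0. Qed.

Lemma fpsX0 f n : (f ^+ n) 0%N = f 0%N ^+ n.
Proof. by elim: n => // n IHn; rewrite !exprS fpsM0 IHn. Qed.

(** A first-order linear equation D w = u w determines w from the coefficient
    in degree u(0), the only resonant one. *)
Lemma fps_ode0 (u w : fps K) k : u 0%N = k%:R -> w k = 0 -> D w = u * w -> w = 0.
Proof.
move=> u0 wk Dw; apply/funext; elim/ltn_ind => n IHn; rewrite fps0.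
have [->//|nk] := eqVneq n k.
move/(congr1 (@^~ n)) : Dw; rewrite DE fpsM big_ord_recl subn0 big1.
  move=> /eqP; rewrite addr0 u0 -subr_eq0 -mulrBl mulf_eq0 subr_eq0 eqr_nat.
  by rewrite (negbTE nk) => /eqP.
by move=> i _; rewrite IHn ?fps0 ?mulr0// /bump; case: (n) i => [[]|m i] //=; rewrite ltnS subSS leq_subr.
Qed.

End FpsField.

(** * Generating series of weighted counts *)

(** The sums are finitely supported; they are sums over explicit sequences
    when N has [finite_sizes]. *)
Definition gs (K : comNzRingType) (T : choiceType) (N : T -> nat) (w : T -> K) : fps K :=
  fun n => \sum_(x \in [set x | N x == n]) w x.

Definition finite_sizes (T : choiceType) (N : T -> nat) :=
  forall n, exists s : seq T, forall x, (N x <= n)%N -> x \in s.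

Section GenSeries.
Variable K : comNzRingType.
Implicit Types T U : choiceType.

Lemma gs_seq T (N : T -> nat) (w : T -> K) s n : uniq s ->
  (forall x, (N x <= n)%N -> x \in s) ->
  gs N w n = \sum_(x <- s | N x == n) w x.
Proof.
move=> us sP; rewrite /gs (bigfs _ us)// => x /eqP Nx.
by rewrite sP// Nx.
Qed.

Lemma finite_sizes_uniq T (N : T -> nat) n : finite_sizes N ->
  exists2 s : seq T, uniq s & forall x, (N x <= n)%N -> x \in s.
Proof.
move=> /(_ n)[s sP]; exists (undup s); rewrite ?undup_uniq// => x /sP.
by rewrite mem_undup.
Qed.

Lemma finite_sizes_prod T U (N : T -> nat) (M : U -> nat) :
  finite_sizes N -> finite_sizes M ->
  finite_sizes (fun p : T * U => N p.1 + M p.2)%N.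
Proof.
move=> fN fM n; have [s sP] := fN n; have [t tP] := fM n.
exists [seq (x, y) | x <- s, y <- t] => -[x y] /= xyn.
by rewrite allpairs_f ?sP ?tP//; lia.
Qed.

Lemma eq_gs T (N : T -> nat) (w w' : T -> K) : w =1 w' -> gs N w = gs N w'.
Proof. by move=> ww; congr gs; apply/funext. Qed.

Lemma gsD T (N : T -> nat) (w w' : T -> K) : finite_sizes N ->
  gs N (fun x => w x + w' x) = gs N w + gs N w'.
Proof.
move=> fN; apply/funext => n; have [s us sP] := finite_sizes_uniq n fN.
by rewrite fpsD !(gs_seq _ us sP) big_split.
Qed.

Lemma gsZ T (N : T -> nat) c (w : T -> K) : finite_sizes N ->
  gs N (fun x => c * w x) = fpsC c * gs N w.
Proof.
move=> fN; apply/funext => n; have [s us sP] := finite_sizes_uniq n fN.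
by rewrite fpsCM !(gs_seq _ us sP) mulr_sumr.
Qed.

Lemma gsZn T (N : T -> nat) c (w : T -> K) : finite_sizes N ->
  gs N (fun x => c%:R * w x) = c%:R * gs N w.
Proof. by move=> fN; rewrite gsZ// rmorph_nat. Qed.

Lemma gsN T (N : T -> nat) (w : T -> K) : finite_sizes N ->
  gs N (fun x => - w x) = - gs N w.
Proof.
move=> fN; apply/funext => n; have [s us sP] := finite_sizes_uniq n fN.
by rewrite fpsN !(gs_seq _ us sP) sumrN.
Qed.

Lemma gs_mul T U (N : T -> nat) (M : U -> nat) w v :
  finite_sizes N -> finite_sizes M ->
  gs N w * gs M v =
  gs (fun p : T * U => N p.1 + M p.2)%N (fun p => w p.1 * v p.2) :> fps K.
Proof.
move=> fN fM; apply/funext => n.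
have [s us sP] := finite_sizes_uniq n fN; have [t ut tP] := finite_sizes_uniq n fM.
pose st := [seq (x, y) | x <- s, y <- t].
have ust : uniq st by apply: allpairs_uniq => // -[? ?] [? ?].
have stP (p : T * U) : (N p.1 + M p.2 <= n)%N -> p \in st.
  by case: p => x y /= xyn; rewrite allpairs_f ?sP ?tP//; lia.
rewrite (gs_seq _ ust stP) /st fpsM [RHS]big_mkcond [RHS]big_allpairs_dep /=.
transitivity (\sum_(i < n.+1) \sum_(x <- s | N x == i) \sum_(y <- t | (M y == n - i)%N)
    w x * v y).
  apply: eq_bigr => i _; have ilen : (i <= n)%N by rewrite -ltnS.
  rewrite (gs_seq _ us); last by move=> x xi; apply/sP/(leq_trans xi).
  rewrite (gs_seq _ ut); last by move=> y yi; apply/tP/(leq_trans yi)/leq_subr.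
  by rewrite mulr_suml; apply: eq_bigr => x _; rewrite mulr_sumr.
transitivity (\sum_(i < n.+1) \sum_(x <- s) \sum_(y <- t)
    (w x * v y) *+ ((N x == i) && (M y == n - i)%N)).
  apply: eq_bigr => i _; rewrite big_mkcond; apply: eq_bigr => x _ /=.
  case: eqP => _ /=; last by rewrite big1.
  by rewrite big_mkcond; apply: eq_bigr => y _; rewrite mulrb.
rewrite exchange_big /=; apply: eq_bigr => x _.
rewrite exchange_big /=; apply: eq_bigr => y _.
have [xyn|xyn] := eqVneq.
  have xn : (N x < n.+1)%N by lia.
  rewrite (bigD1 (Ordinal xn))//= eqxx -{1}xyn addKn eqxx big1 ?addr0// => i.
  by rewrite -val_eqE /= eq_sym => /negbTE ->.
rewrite big1// => i _; have [Nx|_] //= := eqVneq.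
by have [My|_] //= := eqVneq; have := ltn_ord i; lia.
Qed.

(** The weights are cut out by predicates, for h to be a bijection between their supports
    only. *)
Lemma gs_reindex T U (h : T -> U) (h' : U -> T) (P : pred T) (P' : pred U)
    (N : T -> nat) (N' : U -> nat) (w : U -> K) :
    (forall x, P x -> [/\ P' (h x), h' (h x) = x & N' (h x) = N x]) ->
    (forall y, P' y -> P (h' y) /\ h (h' y) = y) ->
  gs N' (fun y => w y *+ P' y) = gs N (fun x => w (h x) *+ P x).
Proof.
move=> hP hP'; apply/funext => n; rewrite /gs.
rewrite -(@fsbig_widen _ _ _ _ [set y | P' y /\ N' y == n] _ (fun y => w y *+ P' y));
  last 2 first.
- by move=> y [].
- by move=> y [/= yn /not_andP[/negP/negbTE ->|]].
rewrite -(@fsbig_widen _ _ _ _ [set x | P x /\ N x == n] _ (fun x => w (h x) *+ P x));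
  last 2 first.
- by move=> y [].
- by move=> y [/= yn /not_andP[/negP/negbTE ->|]].
rewrite (@reindex_fsbig _ _ _ _ _ h [set x | P x /\ N x == n]).
  by apply: eq_fsbigr => x /set_mem[/= Px _]; rewrite Px; have [-> _ _] := hP x Px.
split.
- by move=> x [Px Nx] /=; have [-> _ ->] := hP x Px.
- move=> x y /set_mem[Px _] /set_mem[Py _] /(congr1 h').
  by have [_ -> _] := hP x Px; have [_ -> _] := hP y Py.
- move=> y [/= P'y Ny]; have [Px hy] := hP' y P'y; exists (h' y) => //=.
  by split => //; have [_ _ <-] := hP _ Px; rewrite hy.
Qed.

Lemma gs_bij T U (h : T -> U) (h' : U -> T) (N : T -> nat) (N' : U -> nat) (w : U -> K) :
    cancel h h' -> cancel h' h -> (forall x, N' (h x) = N x) ->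
  gs N' w = gs N (w \o h).
Proof.
move=> hK h'K hN; have := @gs_reindex _ _ h h' predT predT N N' w.
by rewrite /comp /=; apply.
Qed.

Lemma D_gs T (N : T -> nat) (w : T -> K) : finite_sizes N ->
  D (gs N w) = gs N (fun x => (N x)%:R * w x).
Proof.
move=> fN; apply/funext => n; have [s us sP] := finite_sizes_uniq n fN.
rewrite DE !(gs_seq _ us sP) mulr_sumr.
by apply: eq_bigr => x /eqP ->.
Qed.

Lemma sub3_gs T (N : T -> nat) (w : T -> K) :
  sub3 (gs N w) = gs (fun x => 3 * N x)%N w.
Proof.
apply/funext => n; rewrite /sub3 /gs; case: ifP => [/dvdnP[m ->]|n3].
  by rewrite mulnK// mulnC; apply: eq_fsbigl; apply/seteqP; split=> x /=;
    rewrite eqn_mul2l.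
rewrite fsbig1// => x /= /eqP xn; move: n3; rewrite -xn dvdn_mulr//.
Qed.

End GenSeries.

Section IntBoxes.

Definition zbox m : seq int :=
  [seq i%:Z | i <- iota 0 m.+1] ++ [seq - i%:Z | i <- iota 0 m.+1].

Lemma zboxP m (i : int) : (`|i| <= m)%N -> i \in zbox m.
Proof.
rewrite mem_cat; case: (intP i) => [|k|k] km; apply/orP; [left|left|right].
- by apply/mapP; exists 0%N; rewrite // mem_iota.
- by apply/mapP; exists k.+1; rewrite // mem_iota; lia.
- by apply/mapP; exists k.+1; rewrite // mem_iota; lia.
Qed.

Lemma finite_sizes_int (N : int -> nat) :
  (forall i, `|i| <= 2 * N i + 2)%N -> finite_sizes N.
Proof.
move=> NP n; exists (zbox (2 * n + 2)) => i iN; apply: zboxP.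
by have := NP i; lia.
Qed.

Lemma finite_sizes_int2 (N : int * int -> nat) :
    (forall p, `|p.1| <= 2 * N p + 2)%N -> (forall p, `|p.2| <= 2 * N p + 2)%N ->
  finite_sizes N.
Proof.
move=> N1 N2 n; exists [seq (x, y) | x <- zbox (2 * n + 2), y <- zbox (2 * n + 2)].
move=> p pN; rewrite [p]surjective_pairing allpairs_f//; apply: zboxP.
  by apply: leq_trans (N1 p) _; lia.
by apply: leq_trans (N2 p) _; lia.
Qed.

End IntBoxes.

(** * Euler's product and the pentagonal number theorem *)

Section Shanks.
Variables (A : comNzRingType) (x : A).

Definition qpoch m n : A := \prod_(m <= i < n) (1 - x ^+ i.+1).

Lemma qpoch_recr m n : (m <= n)%N -> qpoch m n.+1 = qpoch m n * (1 - x ^+ n.+1).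
Proof. exact: big_nat_recr. Qed.

Lemma qpoch_recl m n : (m < n)%N -> qpoch m n = (1 - x ^+ m.+1) * qpoch m.+1 n.
Proof. exact: big_ltn. Qed.

Lemma qpochnn n : qpoch n n = 1. Proof. by rewrite /qpoch big_geq. Qed.

Lemma qpoch_cat m n p : (m <= n)%N -> (n <= p)%N ->
  qpoch m p = qpoch m n * qpoch n p.
Proof. by move=> mn np; rewrite /qpoch (big_cat_nat mn np). Qed.

Definition pent_sum n : A :=
  1 + \sum_(0 <= j < n) (-1) ^+ j.+1 *
        (x ^+ (j.+1 ^ 2 + 'C(j.+1, 2)) + x ^+ (j.+1 ^ 2 + 'C(j.+2, 2))).

(** The finite form, due to Shanks, of the pentagonal number theorem.
    Passing from n to n + 1 on the left, the factor 1 - x^(n+1) and the splitting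
    x^s = 1 - (1 - x^s) produce two sums which telescope into one another. *)
Lemma shanks n :
  \sum_(0 <= s < n.+1) (-1) ^+ s * qpoch s n * x ^+ (s * n + 'C(s.+1, 2))
  = pent_sum n.
Proof.
elim: n => [|n IHn].
  by rewrite big_nat1 /pent_sum big_geq// qpochnn mul0n bin_small// !mulr1 addr0.
rewrite /pent_sum [in RHS]big_nat_recr//= addrA -/(pent_sum n) -{}IHn.
rewrite big_nat_recr//= qpochnn mulr1 (_ : n.+1 * n.+1 = n.+1 ^ 2)%N//.
have -> : \sum_(0 <= s < n.+1) (-1) ^+ s * qpoch s n.+1 * x ^+ (s * n.+1 + 'C(s.+1, 2))
    = \sum_(0 <= s < n.+1) ((-1) ^+ s * qpoch s n * x ^+ (s * n.+1 + 'C(s.+1, 2))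
       - (-1) ^+ s * qpoch s n * x ^+ (s.+1 * n.+1 + 'C(s.+1, 2))).
  apply: eq_big_nat => s /andP[_ sn]; rewrite qpoch_recr//.
  rewrite (_ : s.+1 * n.+1 + 'C(s.+1, 2) = n.+1 + (s * n.+1 + 'C(s.+1, 2)))%N; last by lia.
  by rewrite [in RHS](exprD _ n.+1) mulrBr mulr1 mulrBr mulrBl !mulrA -[_ * x ^+ n.+1 * _]mulrA.
have -> : \sum_(0 <= s < n.+1) (-1) ^+ s * qpoch s n * x ^+ (s * n + 'C(s.+1, 2))
    = \sum_(0 <= s < n.+1) (-1) ^+ s * qpoch s n * x ^+ (s * n.+1 + 'C(s.+1, 2))
      - \sum_(0 <= s < n) (-1) ^+ s * qpoch s n * x ^+ (s.+1 * n.+1 + 'C(s.+1, 2)).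
  rewrite big_nat_recl// [in RHS]big_nat_recl//= !mul0n !add0n -addrA -sumrB.
  congr (_ + _); apply: eq_big_nat => s /andP[_ sn].
  rewrite (qpoch_recl sn) (_ : s.+1 * n.+1 + 'C(s.+2, 2) = s.+1 + (s.+1 * n + 'C(s.+2, 2)))%N; last by lia.
  rewrite (_ : s.+1 * n.+1 + 'C(s.+1, 2) = s.+1 * n + 'C(s.+2, 2))%N; last first.
    by rewrite [in RHS]binS bin1; lia.
  rewrite (exprD x s.+1 (s.+1 * n + 'C(s.+2, 2))) exprS.
  by move: (x ^+ (_ + _)) (x ^+ s.+1) ((-1) ^+ s) (qpoch _ _) => u v z t; ring.
rewrite sumrB [X in _ - X + _]big_nat_recr//= qpochnn.
rewrite (_ : n.+1 * n.+1 + 'C(n.+1, 2) = n.+1 ^ 2 + 'C(n.+1, 2))%N; last by lia.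
by rewrite exprS; ring.
Qed.

End Shanks.

Section Euler.
Variable K : comNzRingType.

Notation poch n := (qpoch (Xq : fps K) 0 n).

Lemma poch_eqm m n : (m <= n)%N -> eqm m.+1 (poch n) (poch m).
Proof.
move=> /subnK <-; elim: (n - m)%N => // k IHk; apply: eqm_trans IHk.
rewrite addSn qpoch_recr// mulrBr mulr1 -[X in eqm _ _ X]subr0 mulrC.
by apply: eqmD => //; apply: eqmN; apply: eqm_XqM; lia.
Qed.

(** The formal infinite product of the 1 - q^n, n > 0. *)
Definition euler : fps K := fun n => poch n n.

Lemma euler_eqm n : eqm n.+1 euler (poch n).
Proof.
move=> k kn; rewrite /euler; have /(_ k) -> // : eqm k.+1 (poch n) (poch k).
by apply: poch_eqm; rewrite -ltnS.
Qed.

Lemma euler0 : euler 0 = 1.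
Proof. by rewrite /euler qpochnn. Qed.

(** The list [divisors 0] is not empty, whence the test. *)
Definition sigma k : fps K :=
  fun n => if n == 0 then 0 else \sum_(d <- divisors n) d%:R ^+ k.

Lemma sigmaE k n N : (0 < n <= N)%N ->
  sigma k n = \sum_(0 <= i < N | (i.+1 %| n)%N) i.+1%:R ^+ k.
Proof.
move=> /andP[n0 nN]; rewrite /sigma gtn_eqF// -[in RHS]big_filter.
rewrite -(big_map succn xpredT (fun d => d%:R ^+ k)); apply: perm_big.
apply: uniq_perm; first exact: divisors_uniq.
  by rewrite map_inj_uniq ?filter_uniq ?iota_uniq//; exact: succn_inj.
move=> d; rewrite -dvdn_divisors//; apply/idP/mapP => [dn|[j]].
  have d0 := dvdn_gt0 n0 dn; exists d.-1; rewrite ?prednK//.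
  by rewrite mem_filter prednK// dn mem_index_iota; have := dvdn_leq n0 dn; lia.
by rewrite mem_filter => /andP[jn _] ->.
Qed.

(** The expansion of i q^i / (1 - q^i). *)
Definition lambert1 i : fps K := fun n => if (0 < n)%N && (i %| n)%N then i%:R else 0.

Lemma lambert1E i : (0 < i)%N -> lambert1 i * (1 - Xq ^+ i) = i%:R * Xq ^+ i.
Proof.
move=> i0; apply/funext => n.
rewrite mulrBr mulr1 fpsD fpsN fps_natM [lambert1 i * _]mulrC XqnM Xqn /lambert1.
case: (ltngtP i n) => [i_n|ni|<-].
- rewrite subn_gt0 i_n (leq_trans i0 (ltnW i_n)) mulr0 /=.
  by rewrite dvdn_subl ?(ltnW i_n)// subrr.
- rewrite mulr0 subr0; case: posnP => //= n0.
  by rewrite gtnNdvd.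
- by rewrite i0 subnn dvdnn/= subr0 mulr1.
Qed.

Lemma D_poch n : D (poch n) = - (\sum_(0 <= i < n) lambert1 i.+1) * poch n.
Proof.
elim: n => [|n IHn]; first by rewrite qpochnn D1 big_geq// oppr0 mul0r.
rewrite qpoch_recr// DM {}IHn big_nat_recr//= raddfB /= D1 DX DXq.
have := lambert1E (ltn0Sn n); move: (lambert1 n.+1) => l; rewrite exprS => lE.
set s := \sum_(_ <= _ < _) _.
rewrite [RHS](_ : _ = - s * poch n * (1 - Xq * Xq ^+ n)
   - (l * (1 - Xq * Xq ^+ n)) * poch n); last by ring.
by rewrite lE; ring.
Qed.

(** The logarithmic derivative of the product is a sum of Lambert series. *)
Lemma D_euler : D euler = - sigma 1 * euler.
Proof.
apply: eqmP => N n nN; rewrite DE (euler_eqm (ltnSn n)) -DE D_poch.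
have /(_ n (ltnSn n)) -> // : eqm n.+1 (- (\sum_(0 <= i < n) lambert1 i.+1) * poch n)
    (- sigma 1 * euler).
apply: eqmM; last exact/eqm_sym/euler_eqm.
apply: eqmN => k kn; rewrite fps_sum; have [->|k0] := posnP k.
  by rewrite big1.
rewrite (@sigmaE _ _ n) ?k0// [RHS]big_mkcond; apply: eq_bigr => i _.
by rewrite /lambert1 k0 /=.
Qed.

End Euler.

Lemma double_bin2 n : (2 * 'C(n.+1, 2) = n.+1 * n)%N.
Proof. by elim: n => // n IHn; rewrite binS bin1 mulnDr IHn; nia. Qed.

(** Triangular numbers, i (i - 1) / 2 for every integer i. *)
Definition tri (i : int) : nat :=
  match i with Posz n => 'C(n, 2) | Negz n => 'C(n.+2, 2) end.

Lemma triE i : 2 * (tri i)%:Z = i * (i - 1).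
Proof.
case: i => [[|n]|n] //; have := double_bin2; rewrite /tri.
  by move=> /(_ n); nia.
by move=> /(_ n.+1); rewrite NegzE; nia.
Qed.

(** Generalized pentagonal numbers, t (3 t - 1) / 2 for every integer t. *)
Definition pent (t : int) : nat :=
  match t with
  | Posz n => n ^ 2 + 'C(n, 2)
  | Negz n => n.+1 ^ 2 + 'C(n.+2, 2)
  end.

Lemma pentE t : 2 * (pent t)%:Z = t * (3 * t - 1).
Proof.
case: t => n; have := triE (Posz n); have := triE (Negz n); rewrite /tri /pent.
  by rewrite PoszD; nia.
by rewrite PoszD NegzE; nia.
Qed.

Lemma finite_tri : finite_sizes tri.
Proof. by apply: finite_sizes_int => i; have := triE i; nia. Qed.

Lemma finite_pent : finite_sizes pent.
Proof. by apply: finite_sizes_int => t; have := pentE t; nia. Qed.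

Section Pentagonal.
Variable K : comNzRingType.

(** In [shanks] only the term s = 0, which is the truncated product, has order at
    most n. *)
Lemma euler_pent : euler K = gs pent (fun t => (-1) ^+ `|t|).
Proof.
apply/funext => n; rewrite (euler_eqm K (ltnSn n)).
have -> : qpoch Xq 0 n n = pent_sum (Xq : fps K) n n.
  rewrite -shanks; pose F s := (-1) ^+ s * qpoch (Xq : fps K) s n * Xq ^+ (s * n + 'C(s.+1, 2)).
  suff E : eqm n.+1 (qpoch Xq 0 n) (\sum_(0 <= s < n.+1) F s) by exact: E.
  rewrite (@big_nat_recl _ _ _ n 0%N F)//= -[X in eqm _ X _]addr0.
  apply: eqmD => [|k kn].
    by rewrite /F mul0n bin_small// mul1r mulr1.
  rewrite fps_sum fps0 big1// => s _.
  by rewrite /F mulrC (@eqm_XqM _ n.+1)//; have := double_bin2 s.+1; nia.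
pose s := [seq Posz j | j <- iota 0 n.+1] ++ [seq Negz j | j <- iota 0 n].
have us : uniq s.
  rewrite cat_uniq !map_inj_uniq ?iota_uniq//; try by move=> ? ? [].
  by rewrite andbT -all_predC; apply/allP => _ /mapP[j _ ->]; apply/mapP => -[].
rewrite (gs_seq _ us) => [|[j|j] /= jn]; last 2 first.
- rewrite mem_cat map_f// mem_iota; nia.
- rewrite mem_cat (map_f _ (_ : j \in iota 0 n)) ?orbT// mem_iota; nia.
rewrite big_cat !big_map /= big_cons /= (iotaDl 1) big_map.
rewrite /pent_sum fpsD fps1 fps_sum /index_iota subn0.
rewrite [X in _ = X + _](_ : _ = (n == 0)%:R
    + \sum_(j <- iota 0 n | ((1 + j) ^ 2 + 'C(1 + j, 2) == n)%N) (-1) ^+ (1 + j));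
  last by case: (n) => [|m] //=; rewrite add0r.
rewrite -addrA; congr (_ + _); rewrite [in RHS]big_mkcond [X in _ + X]big_mkcond -big_split.
apply: eq_bigr => j _ /=; rewrite -signr_odd -[in RHS]signr_odd add1n.
have E (b : bool) (f : fps K) : ((-1) ^+ b * f) n = (-1) ^+ b * f n.
  by case: b; rewrite ?expr0 ?expr1 ?mul1r// !mulN1r.
rewrite E fpsD !Xqn [n == _]eq_sym [n == _]eq_sym mulrDr.
by congr (_ + _); case: ifP; rewrite ?mulr0 ?mulr1.
Qed.

End Pentagonal.

(** * Jacobi's identity for the cube of Euler's product *)

Section Gauss.
Variables (A : comNzRingType) (x : A).

(** The recursion makes sense in every ring, where the quotient of q-factorials that
    it computes need not exist. *)
Fixpoint gauss_binomial n k : A :=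
  match n, k with
  | _, 0%N => 1
  | 0%N, _.+1 => 0
  | m.+1, l.+1 => gauss_binomial m l.+1 + x ^+ (m - l) * gauss_binomial m l
  end.

Lemma gauss_n0 n : gauss_binomial n 0 = 1. Proof. by case: n. Qed.

Lemma gauss_small n k : (n < k)%N -> gauss_binomial n k = 0.
Proof.
elim: n k => [|n IHn] [|k] //= nk; rewrite !IHn ?mulr0 ?addr0//; lia.
Qed.

Lemma gauss_qpoch n k : (k <= n)%N ->
  gauss_binomial n k * qpoch x 0 k * qpoch x 0 (n - k) = qpoch x 0 n.
Proof.
elim: n k => [|n IHn] [|k] kn; rewrite ?gauss_n0 ?subn0 ?qpochnn ?mulr1 ?mul1r//=.
have E := IHn k kn; rewrite subSS [qpoch x 0 k.+1]qpoch_recr// [RHS]qpoch_recr//.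
have [kn'|nk] := ltnP k n; last first.
  have kE : k = n by lia.
  subst k; rewrite subnn qpochnn mulr1 in E.
  by rewrite gauss_small// subnn add0r expr0 mul1r qpochnn mulr1 mulrA E.
have E' := IHn k.+1 kn'; rewrite qpoch_recr// in E'.
have nkE : (n - k = (n - k.+1).+1)%N by lia.
have pE : qpoch x 0 (n - k) = qpoch x 0 (n - k.+1) * (1 - x ^+ (n - k)).
  by rewrite nkE qpoch_recr.
rewrite pE in E; rewrite {}pE.
have -> : x ^+ n.+1 = x ^+ (n - k) * x ^+ k.+1 by rewrite -exprD; congr GRing.exp; lia.
move: E' E; move: (x ^+ _) (x ^+ _) (gauss_binomial n k.+1) (gauss_binomial n k).
move: (qpoch x 0 k) (qpoch x 0 (n - k.+1)) (qpoch x 0 n).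
move=> p1 p2 p3 a b g1 g2 E' E.
rewrite [LHS](_ : _ = g1 * (p1 * (1 - b)) * p2 * (1 - a)
  + a * (1 - b) * (g2 * p1 * (p2 * (1 - a)))); last by ring.
by rewrite E' E; ring.
Qed.

(** The q-binomial theorem. *)
Lemma prod_gauss n (y z : {poly A}) :
  \prod_(0 <= i < n) (z + (x ^+ i)%:P * y) =
  \sum_(0 <= k < n.+1) (gauss_binomial n k * x ^+ 'C(k, 2))%:P * y ^+ k * z ^+ (n - k).
Proof.
elim: n => [|n IHn]; first by rewrite big_geq// big_nat1 /= !mulr1.
rewrite big_nat_recr//= {}IHn mulrDr !mulr_suml.
rewrite [RHS]big_nat_recl// [X in X + _]big_nat_recl//= !gauss_n0 !subn0 !expr0.
rewrite -addrA; congr (_ + _); first by rewrite exprSr mulrA.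
have -> : \sum_(0 <= i < n) (gauss_binomial n i.+1 * x ^+ 'C(i.+1, 2))%:P * y ^+ i.+1
      * z ^+ (n - i.+1) * z
    = \sum_(0 <= i < n.+1) (gauss_binomial n i.+1 * x ^+ 'C(i.+1, 2))%:P * y ^+ i.+1
      * z ^+ (n - i).
  rewrite [RHS]big_nat_recr//= gauss_small// mul0r !mul0r addr0.
  apply: eq_big_nat => i /andP[_ i_n]; rewrite -mulrA -exprSr; congr (_ * z ^+ _); lia.
rewrite -big_split; apply: eq_big_nat => i /andP[_ i_n] /=; rewrite subSS.
rewrite mulrDl polyCD !mulrDl; congr (_ + _); rewrite exprS binS bin1.
have -> : x ^+ (n - i) * gauss_binomial n i * x ^+ ('C(i, 2) + i)
   = gauss_binomial n i * x ^+ 'C(i, 2) * x ^+ n.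
  by rewrite (_ : n = (n - i) + i)%N ?addnK; [rewrite !exprD; ring|lia].
rewrite !polyCM; ring.
Qed.

End Gauss.

Arguments gauss_binomial {A} x n k : simpl never.

Section Jacobi.
Variable K : numFieldType.
Local Notation A := (fps K).
Local Notation q := (Xq : A).
Local Notation poch n := (qpoch q 0 n).

(** The derivative at 1 of the product of the q^N - X q^i, i < 2 N + 1, in which
    only the factor i = N vanishes at 1. *)
Lemma jacobi_finite N :
  (-1) ^+ N.+1 * poch N ^+ 2 =
  \sum_(0 <= k < (2 * N).+2) k%:R * (-1) ^+ k
    * gauss_binomial q (2 * N).+1 k * q ^+ tri (k%:Z - N%:Z).
Proof.
(* This power of q comes from the factors i < N, N < i and i = N respectively. *)
apply: (@Xqn_inj _ ('C(N, 2) + N * N + N)%N).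
have := prod_gauss q (2 * N).+1 (- 'X) (q ^+ N)%:P.
move/(congr1 (fun p : {poly A} => p^`().[1])).
rewrite [X in _ = X -> _](_ : _ = \sum_(0 <= k < (2 * N).+2) k%:R * (-1) ^+ k
    * gauss_binomial q (2 * N).+1 k * q ^+ ('C(k, 2) + N * ((2 * N).+1 - k))).
  rewrite [X in X = _ -> _](_ : _ = q ^+ ('C(N, 2) + N * N + N) * ((-1) ^+ N.+1 * poch N ^+ 2)).
    move=> ->; rewrite mulr_sumr; apply: eq_big_nat => k /andP[_ kN].
    rewrite [RHS]mulrCA -exprD; congr (_ * q ^+ _).
    have := triE (k%:Z - N%:Z); have := triE k%:Z; have := triE N%:Z; rewrite /=; nia.
  rewrite (_ : (2 * N).+1 = N.+1 + N)%N; last by lia.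
  rewrite (big_cat_nat (n := N.+1)) ?leq_addr// big_nat_recr//= (_ : q ^+ N = q ^+ N)//.
  rewrite [X in (_ * X * _)^`()](_ : _ = (q ^+ N)%:P * (1 - 'X)); last by ring.
  set L := \prod_(0 <= _ < N) _; set U := \prod_(N.+1 <= _ < _) _.
  rewrite (_ : L * _ * U = (1 - 'X) * ((q ^+ N)%:P * L * U)); last by ring.
  have h1 : (1 - 'X : {poly A}).[1] = 0 by rewrite hornerD hornerN hornerX -polyC1 hornerC subrr.
  have h2 : (1 - 'X)^`() = (-1)%:P :> {poly A} by rewrite derivB derivX -polyC1 derivC sub0r polyCN.
  rewrite derivM hornerD [X in X + _]hornerM [X in _ + X]hornerM h1 mul0r addr0 h2 hornerC.
  rewrite !hornerM hornerC.
  have -> : L.[1] = q ^+ 'C(N, 2) * (-1) ^+ N * poch N.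
    rewrite /L horner_prod (eq_big_nat _ _ (F2 := fun i => q ^+ i * -1 * (1 - q ^+ (N - i)))).
      rewrite !big_split prodr_const_nat subn0 /=; congr (_ * _ * _).
        by rewrite -bin2_sum (big_morph _ (exprD q) (expr0 q)).
      rewrite big_nat_rev; apply: eq_big_nat => i /andP[_ iN]; congr (1 - q ^+ _); lia.
    move=> i /andP[_ iN]; rewrite !hornerE (_ : N = i + (N - i))%N; last by lia.
    by rewrite exprD addKn; ring.
  have -> : U.[1] = q ^+ (N * N) * poch N.
    rewrite /U -{1}[N.+1]add0n big_addn addKn horner_prod exprM.
    rewrite (_ : (q ^+ N) ^+ N = \prod_(0 <= i < N) q ^+ N); last first.
      by rewrite prodr_const_nat subn0.
    rewrite -big_split; apply: eq_big_nat => i _ /=.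
    by rewrite !hornerE addnS addnC -addnS exprD; ring.
  by rewrite exprS !exprD; ring.
rewrite raddf_sum horner_sum; apply: eq_big_nat => k _ /=.
rewrite (exprNn 'X k) -mulrA; set c := (_ * _)%:P.
rewrite [X in X^`()](_ : _ = (gauss_binomial q (2 * N).+1 k * (-1) ^+ k
    * q ^+ ('C(k, 2) + N * ((2 * N).+1 - k)))%:P * 'X^k); last first.
  rewrite /c exprD exprM !polyCM [((-1) ^+ k)%:P]polyC_exp polyCN polyC1.
  rewrite [((q ^+ N) ^+ _)%:P]polyC_exp.
  move: ((-1) ^+ k) ('X^k) ((q ^+ N)%:P ^+ _) => u v w; ring.
rewrite mul_polyC derivZ derivXn hornerZ hornerMn hornerXn expr1n; ring.
Qed.

End Jacobi.

Lemma eqm_mulI (K : comNzRingType) N (f g h : fps K) : f 0 = 1 ->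
  eqm N (f * g) (f * h) -> eqm N g h.
Proof.
move=> f0 fgh n; elim/ltn_ind: n => n IHn nN.
move: (fgh n nN); rewrite !fpsM !big_ord_recl !subn0 f0 !mul1r.
rewrite (eq_bigr (fun i : 'I_n => f (bump 0 i) * h (n - bump 0 i)%N)); first exact: addIr.
move=> i _; have := ltn_ord i; rewrite lift0 /bump leq0n add1n => i_n; rewrite IHn//; lia.
Qed.

Lemma eqm_sum (K : comNzRingType) N I (r : seq I) (P : pred I) (F G : I -> fps K) :
  (forall i, P i -> eqm N (F i) (G i)) ->
  eqm N (\sum_(i <- r | P i) F i) (\sum_(i <- r | P i) G i).
Proof.
move=> FG n nN; rewrite !fps_sum; apply: eq_bigr => i Pi; exact: FG.
Qed.

Section JacobiIdentity.
Variable K : numFieldType.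
Local Notation q := (Xq : fps K).

(** Away from its ends, a row of Gaussian binomials tends to the inverse of Euler's
    product. *)
Lemma euler_gauss m n k : (m <= k.+1)%N -> (m <= (n - k).+1)%N -> (k <= n)%N ->
  eqm m (euler K * gauss_binomial q n k) 1.
Proof.
move=> mk mnk kn; have eE j : (m <= j.+1)%N -> eqm m (qpoch q 0 j) (euler K).
  by move=> mj; apply/eqm_sym/(eqm_le mj)/euler_eqm.
apply: (@eqm_mulI _ _ (euler K)); first exact: euler0.
rewrite mulr1; apply: (@eqm_trans _ _ _ (qpoch q 0 n)); last by apply: eE; lia.
rewrite -(gauss_qpoch q kn) [X in eqm _ _ X](_ : _ = qpoch q 0 k *
  (qpoch q 0 (n - k) * gauss_binomial q n k)); last by ring.
by apply: eqm_sym; apply: eqmM; [exact: eE|apply: eqmM => //; exact: eE].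
Qed.

Lemma sum_rev_double (V : zmodType) n (F : nat -> V) :
  (\sum_(0 <= k < n.+1) F k) *+ 2 = \sum_(0 <= k < n.+1) (F k + F (n - k)%N).
Proof.
rewrite mulr2n big_split /=; congr (_ + _); rewrite big_nat_rev /=.
by apply: eq_big_nat => i; rewrite add0n subSS.
Qed.

(** In the finite form the terms k and 2 N + 1 - k have the same Gaussian
    binomial and the same power of q, and opposite signs; as N grows
    these binomials tend to the inverse of Euler's product. *)
Lemma jacobi :
  gs tri (fun i => (-1) ^+ `|i| * (2 * i - 1)%:~R) = - 2 * euler K ^+ 3.
Proof.
(* N is even to make its sign trivial, and large enough for the binomials of the
   terms of order below m to agree with their limit modulo q^m. *)
apply: eqmP => m; pose N := (2 * m)%N.
have E1 : eqm m (- euler K ^+ 3)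
    (\sum_(0 <= k < (2 * N).+2) k%:R * (-1) ^+ k * q ^+ tri (k%:Z - N%:Z)).
  apply: (@eqm_trans _ _ _ (euler K * ((-1) ^+ N.+1 * qpoch q 0 N ^+ 2))).
    have -> : (-1) ^+ N.+1 = -1 :> fps K by rewrite -signr_odd (_ : odd N.+1) // /N; lia.
    rewrite [X in eqm _ X _](_ : _ = euler K * (-1 * (euler K * euler K))); last by ring.
    apply: eqmM => //; apply: eqmM => //; rewrite expr2.
    by apply: eqmM; apply: (eqm_le (_ : m <= N.+1)%N) => //; rewrite /N; [lia| |lia|];
      exact: euler_eqm.
  rewrite jacobi_finite mulr_sumr big_nat_cond [X in eqm _ _ X]big_nat_cond.
  apply: eqm_sum => k /andP[/andP[_ kN] _].
  rewrite [X in eqm _ X _](_ : _ = k%:R * (-1) ^+ k *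
    (q ^+ tri (k%:Z - N%:Z) * (euler K * gauss_binomial q (2 * N).+1 k))); last by ring.
  apply: eqmM => //; have [mt|tm] := leqP m (tri (k%:Z - N%:Z)).
    apply: (eqm_trans (eqm_XqM _ mt)).
    by rewrite -[X in eqm _ _ X]mulr1; apply/eqm_sym/eqm_XqM.
  rewrite -[X in eqm _ _ X]mulr1; apply: eqmM => //.
  by have T := triE (k%:Z - N%:Z); apply: euler_gauss; rewrite /N in T tm kN *; nia.
have {}E1 : eqm m (- 2 * euler K ^+ 3) (\sum_(0 <= k < (2 * N).+2)
    (-1) ^+ k * (2 * (k%:Z - N%:Z) - 1)%:~R * q ^+ tri (k%:Z - N%:Z)).
  rewrite (_ : \sum_(0 <= k < _) _ =
    (\sum_(0 <= k < (2 * N).+2) k%:R * (-1) ^+ k * q ^+ tri (k%:Z - N%:Z)) *+ 2).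
    rewrite -[X in eqm _ _ X]mulr_natl [X in eqm _ X _](_ : _ = 2 * - euler K ^+ 3); last by ring.
    exact: eqmM.
  rewrite sum_rev_double; apply: eq_big_nat => k /andP[_ kN].
  rewrite (_ : tri (((2 * N).+1 - k)%N%:Z - N%:Z) = tri (k%:Z - N%:Z)); last first.
    have := triE (k%:Z - N%:Z); have := triE (((2 * N).+1 - k)%N%:Z - N%:Z); nia.
  rewrite -mulrDl; congr (_ * _).
  rewrite -[(-1) ^+ (_ - _)]signr_odd (_ : odd _ = ~~ odd k); last by lia.
  rewrite signrN signr_odd natrB// !rmorphB rmorphM /= rmorphB /= -!pmulrn.
  move: ((-1) ^+ k) => u; rewrite -[(2 * N).+1]addn1 natrD natrM !natrD; ring.
move=> n nm; rewrite {}E1// fps_sum.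
pose s : seq int := [seq k%:Z - N%:Z | k <- index_iota 0 (2 * N).+2].
have us : uniq s by rewrite map_inj_uniq ?iota_uniq// => i j; lia.
rewrite (gs_seq _ us) => [|i itn]; last first.
  apply/mapP; exists (absz (i + N%:Z)); last by have := triE i; nia.
  by rewrite mem_index_iota; have := triE i; nia.
rewrite big_map big_mkcond; apply: eq_bigr => k _.
rewrite -[(-1) ^+ `|_|]signr_odd (_ : odd `|_| = odd k); last by rewrite /N; lia.
rewrite signr_odd.
have -> : (-1) ^+ k * (2 * (k%:Z - N%:Z) - 1)%:~R =
  fpsC ((-1) ^+ k * (2 * (k%:Z - N%:Z) - 1)%:~R) :> fps K.
  by rewrite rmorphM rmorph_int rmorphXn rmorphN1.
by rewrite fpsCM Xqn eq_sym; case: eqP; rewrite ?mulr1 ?mulr0.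
Qed.

End JacobiIdentity.

(** * The cubic theta functions and the cube of a Jacobi theta function *)

(** The form x^2 + x y + y^2 and, up to the constant 1/3, its translate by the
    vector (1/3, 1/3) of the dual lattice. *)
Definition qf (p : int * int) : nat := absz (p.1 ^+ 2 + p.1 * p.2 + p.2 ^+ 2)%R.
Definition cf (p : int * int) : nat :=
  absz (p.1 ^+ 2 + p.1 * p.2 + p.2 ^+ 2 - p.1 - p.2)%R.

Lemma qfE p : (qf p)%:Z = p.1 ^+ 2 + p.1 * p.2 + p.2 ^+ 2.
Proof. by rewrite /qf; nia. Qed.

Lemma cfE p : (cf p)%:Z = p.1 ^+ 2 + p.1 * p.2 + p.2 ^+ 2 - p.1 - p.2.
Proof.
case: p => x y; rewrite /cf /=; have sq : 0 <= (2 * x + y - 1) ^+ 2 by exact: sqr_ge0.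
have y0 : -1 <= (y - 1) * (3 * y + 1) by case: (lerP 1 y) => ?; nia.
rewrite gez0_abs//; set c := _ - y.
have : 4 * c = (2 * x + y - 1) ^+ 2 + (y - 1) * (3 * y + 1) by rewrite /c; ring.
by move: c sq y0 => c; lia.
Qed.

(** Completing a square in the other variable bounds four times either binary form below
    by 3 x^2 - 2 |x| - 1. *)
Lemma absz_le_form (x : int) n :
  3 * x ^+ 2 - 2 * `|x| <= 4 * n%:Z + 1 -> (`|x| <= 2 * n + 2)%N.
Proof.
have -> : x ^+ 2 = (absz x)%:Z ^+ 2 by rewrite abszE real_normK ?num_real.
rewrite -abszE; move: (absz x) => m H; rewrite leqNgt; apply/negP => nm.
suff : (4 * n + 1 < 3 * m * m - 2 * m)%N by nia.
have : (m <= m * m)%N by nia.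
nia.
Qed.

Lemma finite_qf : finite_sizes qf.
Proof.
apply: finite_sizes_int2 => -[x y]; apply: absz_le_form; rewrite qfE /=.
- have : 0 <= (2 * y + x) ^+ 2 by exact: sqr_ge0.
  have : 0 <= `|x| by []; nia.
- have : 0 <= (2 * x + y) ^+ 2 by exact: sqr_ge0.
  have : 0 <= `|y| by []; nia.
Qed.

Lemma finite_cf : finite_sizes cf.
Proof.
apply: finite_sizes_int2 => -[x y]; apply: absz_le_form; rewrite cfE /=.
- have : 0 <= (2 * y + x - 1) ^+ 2 by exact: sqr_ge0.
  have : x <= `|x| by exact: ler_norm.
  nia.
- have : 0 <= (2 * x + y - 1) ^+ 2 by exact: sqr_ge0.
  have : y <= `|y| by exact: ler_norm.
  nia.
Qed.

Lemma tri_refl i : tri (1 - i) = tri i.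
Proof. by have := triE i; have := triE (1 - i); nia. Qed.

Section Sign.
Variable K : comNzRingType.

Definition sg (i : int) : K := (-1) ^+ `|i|.

Lemma sgD i j : sg (i + j) = sg i * sg j.
Proof.
rewrite /sg -exprD -signr_odd -[RHS]signr_odd; congr ((-1) ^+ (_ : bool)); lia.
Qed.

Lemma sgN i : sg (- i) = sg i. Proof. by rewrite /sg; congr (_ ^+ _); lia. Qed.
Lemma sg1 : sg 1 = -1. Proof. by []. Qed.
Lemma sg2 : sg 2 = 1. Proof. by rewrite /sg /= expr2 mulrNN mulr1. Qed.
Lemma sg3 t : sg (3 * t) = sg t.
Proof.
rewrite /sg -signr_odd -[RHS]signr_odd; congr ((-1) ^+ (_ : bool)); lia.
Qed.

End Sign.

Section Triple.
Variable K : comNzRingType.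
Implicit Types w : int -> K.

Definition theta_a : fps K := gs qf (fun=> 1).
Definition theta_c : fps K := gs cf (fun=> 1).

Definition tri3 (t : int * (int * int)) : nat := (tri t.1 + (tri t.2.1 + tri t.2.2))%N.
Definition sum3 (t : int * (int * int)) : int := t.1 + t.2.1 + t.2.2.

Lemma finite_tri3 : finite_sizes tri3.
Proof.
exact (finite_sizes_prod finite_tri (finite_sizes_prod finite_tri finite_tri)).
Qed.

Lemma gs_tri3 (f g h : int -> K) :
  gs tri3 (fun t => f t.1 * (g t.2.1 * h t.2.2)) = gs tri f * (gs tri g * gs tri h).
Proof.
rewrite (gs_mul g h finite_tri finite_tri).
by rewrite (gs_mul _ _ finite_tri (finite_sizes_prod finite_tri finite_tri)).
Qed.

(** A triple with sum 3 t + r is a translate of one with sum r: the three cosets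
    of the root lattice A_2 in its dual contribute the series [theta_a], and
    twice [theta_c]. *)
Lemma gs_sum3 w :
  gs tri3 (fun t => w (sum3 t)) =
  theta_a * gs (fun t => 3 * tri t)%N (fun t => w (3 * t))
  + theta_c * gs pent (fun t => w (3 * t + 1))
  + theta_c * gs pent (fun t => w (2 - 3 * t)).
Proof.
have f3 : finite_sizes (fun t => 3 * tri t)%N.
  by apply: finite_sizes_int => i; have := triE i; nia.
have -> : gs tri3 (fun t => w (sum3 t)) = gs tri3 (fun t =>
    w (sum3 t) *+ (sum3 t %% 3 == 0)%Z + w (sum3 t) *+ (sum3 t %% 3 == 1)%Z
    + w (sum3 t) *+ (sum3 t %% 3 == 2)%Z).
  apply: eq_gs => t; have := ltz_pmod (sum3 t) (isT : 0 < 3%:Z).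
  have := modz_ge0 (sum3 t) (isT : 3%:Z != 0); move: (_ %% _)%Z => r.
  by case: r => [[|[|[|r]]]|r] //= _ _; rewrite ?addr0 ?add0r.
rewrite !gsD; try exact: finite_tri3.
rewrite /theta_a /theta_c (gs_mul _ _ finite_qf f3) !(gs_mul _ _ finite_cf finite_pent).
congr (_ + _ + _).
- rewrite (gs_reindex (h := fun p : (int * int) * int =>
      (p.2 + p.1.1, (p.2 + p.1.2, p.2 - p.1.1 - p.1.2)))
    (h' := fun t => let m := (sum3 t %/ 3)%Z in ((t.1 - m, t.2.1 - m), m))
    (P := predT) (N := fun p => (qf p.1 + 3 * tri p.2)%N)).
  + by apply: eq_gs => -[[x y] t] /=; rewrite mul1r /sum3 /=; congr w; ring.
  + move=> [[x y] t] _; rewrite /sum3 /=.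
    rewrite (_ : t + x + (t + y) + (t - x - y) = t * 3); last by ring.
    rewrite modzMl eqxx mulzK//; split=> //; first by congr ((_, _), _); ring.
    have := triE (t + x); have := triE (t + y); have := triE (t - x - y).
    have := triE t; have := qfE (x, y); rewrite /tri3 /=; nia.
  + move=> [i [j k]]; rewrite /sum3 /= => s0; split=> //.
    have := divz_eq (i + j + k) 3; rewrite (eqP s0); move: (_ %/ _)%Z => m E.
    by congr (_, (_, _)); lia.
- rewrite (gs_reindex (h := fun p : (int * int) * int =>
      (p.2 + p.1.1, (p.2 + p.1.2, p.2 + 1 - p.1.1 - p.1.2)))
    (h' := fun t => let m := (sum3 t %/ 3)%Z in ((t.1 - m, t.2.1 - m), m))
    (P := predT) (N := fun p => (cf p.1 + pent p.2)%N)).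
  + by apply: eq_gs => -[[x y] t] /=; rewrite mul1r /sum3 /=; congr w; ring.
  + move=> [[x y] t] _; rewrite /sum3 /=.
    rewrite (_ : t + x + (t + y) + (t + 1 - x - y) = t * 3 + 1); last by ring.
    rewrite modzMDl divzMDl// addr0; split=> //; first by congr ((_, _), _); ring.
    have := triE (t + x); have := triE (t + y); have := triE (t + 1 - x - y).
    have := pentE t; have := cfE (x, y); rewrite /tri3 /=; nia.
  + move=> [i [j k]]; rewrite /sum3 /= => s0; split=> //.
    have := divz_eq (i + j + k) 3; rewrite (eqP s0); move: (_ %/ _)%Z => m E.
    by congr (_, (_, _)); lia.
- rewrite (gs_reindex (h := fun p : (int * int) * int =>
      (1 - p.1.1 - p.2, (1 - p.1.2 - p.2, p.1.1 + p.1.2 - p.2)))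
    (h' := fun t => let m := (sum3 t %/ 3)%Z in ((m + 1 - t.1, m + 1 - t.2.1), - m))
    (P := predT) (N := fun p => (cf p.1 + pent p.2)%N)).
  + by apply: eq_gs => -[[x y] t] /=; rewrite mul1r /sum3 /=; congr w; ring.
  + move=> [[x y] t] _; rewrite /sum3 /=.
    rewrite (_ : 1 - x - t + (1 - y - t) + (x + y - t) = (- t) * 3 + 2); last by ring.
    rewrite modzMDl divzMDl// addr0; split=> //; first by congr ((_, _), _); ring.
    have := triE (1 - x - t); have := triE (1 - y - t); have := triE (x + y - t).
    have := pentE t; have := cfE (x, y); rewrite /tri3 /=; nia.
  + move=> [i [j k]]; rewrite /sum3 /= => s0; split=> //.
    have := divz_eq (i + j + k) 3; rewrite (eqP s0); move: (_ %/ _)%Z => m E.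
    by congr (_, (_, _)); lia.
Qed.

End Triple.

Section Moments.
Variable K : numFieldType.
Local Notation sg := (@sg K).
Implicit Types phi : int -> K.

(** The Taylor coefficients of a Jacobi theta function at the point given by the
    character phi of Z, up to normalization. *)
Definition moment phi p : fps K :=
  gs tri (fun i => sg i * phi i * (2 * i - 1)%:~R ^+ p).

Global Arguments moment phi p%_N.

Definition pent_moment p : fps K := gs pent (fun t => sg t * (6 * t - 1)%:~R ^+ p).

Global Arguments pent_moment p%_N.

(** The heat equation for the theta function. *)
Lemma moment_heat phi p : moment phi p.+2 = 8 * D (moment phi p) + moment phi p.
Proof.
rewrite /moment D_gs; last exact: finite_tri.
rewrite -gsZn; last exact: finite_tri.
rewrite -gsD; last exact: finite_tri.
apply: eq_gs => i; rewrite !exprS.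
have E : (2 * i - 1)%:~R * (2 * i - 1)%:~R = 8 * (tri i)%:R + 1 :> K.
  rewrite -rmorphM /= (_ : _ * _ = 8 * (tri i)%:Z + 1); last by have := triE i; nia.
  by rewrite rmorphD rmorphM /= -!pmulrn.
rewrite mulrA E; ring.
Qed.

Lemma pent_moment_heat p :
  pent_moment p.+2 = 24 * D (pent_moment p) + pent_moment p.
Proof.
rewrite /pent_moment D_gs; last exact: finite_pent.
rewrite -gsZn; last exact: finite_pent.
rewrite -gsD; last exact: finite_pent.
apply: eq_gs => t; rewrite !exprS.
have E : (6 * t - 1)%:~R * (6 * t - 1)%:~R = 24 * (pent t)%:R + 1 :> K.
  rewrite -rmorphM /= (_ : _ * _ = 24 * (pent t)%:Z + 1); last by have := pentE t; nia.
  by rewrite rmorphD rmorphM /= -!pmulrn.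
rewrite mulrA E; ring.
Qed.

Lemma gs_sum (T : choiceType) (N : T -> nat) I (r : seq I) (w : I -> T -> K) :
  finite_sizes N -> gs N (fun x => \sum_(i <- r) w i x) = \sum_(i <- r) gs N (w i).
Proof.
move=> fN; elim: r => [|i r IHr].
  by rewrite big_nil; apply/funext => m; rewrite /gs fsbig1// => x _; rewrite big_nil.
by rewrite big_cons -IHr -gsD//; apply: eq_gs => x; rewrite big_cons.
Qed.

(** Taylor coefficients of the cube of the theta function. *)
Definition triple_moment phi p : fps K :=
  gs tri3 (fun t => sg (sum3 t) * phi (sum3 t) * (2 * sum3 t - 3)%:~R ^+ p).

Global Arguments triple_moment phi p%_N.

(** Leibniz's rule for the cube, [phi] being multiplicative. *)
Lemma triple_momentE phi p : (forall i j, phi (i + j) = phi i * phi j) ->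
  triple_moment phi p = \sum_(a < p.+1) \sum_(b < a.+1) ('C(p, a) * 'C(a, b))%:R *
    (moment phi (p - a) * (moment phi (a - b) * moment phi b)).
Proof.
move=> phiD; rewrite /triple_moment.
have E (t : int * (int * int)) : sg (sum3 t) * phi (sum3 t) * (2 * sum3 t - 3)%:~R ^+ p =
    \sum_(a < p.+1) \sum_(b < a.+1) ('C(p, a) * 'C(a, b))%:R *
    ((sg t.1 * phi t.1 * (2 * t.1 - 1)%:~R ^+ (p - a)) *
     ((sg t.2.1 * phi t.2.1 * (2 * t.2.1 - 1)%:~R ^+ (a - b)) *
      (sg t.2.2 * phi t.2.2 * (2 * t.2.2 - 1)%:~R ^+ b))).
  case: t => i [j k]; rewrite /sum3 /= !sgD !phiD.
  have -> : (2 * (i + j + k) - 3)%:~R = (2 * i - 1)%:~R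
      + ((2 * j - 1)%:~R + (2 * k - 1)%:~R) :> K by rewrite -!rmorphD; congr (_ %:~R); ring.
  rewrite exprDn mulr_sumr; apply: eq_bigr => a _.
  rewrite exprDn mulr_sumr -sumrMnl mulr_sumr; apply: eq_bigr => b _.
  rewrite natrM -[_ *+ 'C(a, b)]mulr_natr -[_ *+ 'C(p, a)]mulr_natr.
  move: (_ ^+ (p - a)) (_ ^+ (a - b)) (_ ^+ b) ('C(a, b)%:R) ('C(p, a)%:R) => u v z c d.
  ring.
rewrite (eq_gs _ E) gs_sum; last exact: finite_tri3.
apply: eq_bigr => a _; rewrite /= gs_sum; last exact: finite_tri3.
apply: eq_bigr => b _; rewrite /= gsZn; last exact: finite_tri3.
by congr (_ * _); exact: gs_tri3.
Qed.

Lemma triple_moment_small phi : (forall i j, phi (i + j) = phi i * phi j) ->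
  let M := moment phi in
  [/\ triple_moment phi 0 = M 0 ^+ 3,
      triple_moment phi 1 = 3 * M 1 * M 0 ^+ 2,
      triple_moment phi 2 = 3 * M 2 * M 0 ^+ 2 + 6 * M 1 ^+ 2 * M 0,
      triple_moment phi 3 = 3 * M 3 * M 0 ^+ 2 + 18 * M 2 * M 1 * M 0 + 6 * M 1 ^+ 3 &
      triple_moment phi 4 = 3 * M 4 * M 0 ^+ 2 + 24 * M 3 * M 1 * M 0
        + 18 * M 2 ^+ 2 * M 0 + 36 * M 2 * M 1 ^+ 2].
Proof.
move=> phiD /=; split; rewrite triple_momentE// !big_ord_recl !big_ord0 /bump /=
  ?add1n ?addn0 ?subn0 ?subSS ?subn0 ?(binS, bin0, bin0n) /=; ring.
Qed.

(** The cube of the theta function through [gs_sum3]. With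
    [triple_moment_small] this gives one relation between theta functions for every p. *)
Lemma triple_moment_split phi p : (forall i j, phi (i + j) = phi i * phi j) ->
    (forall t, phi (3 * t) = 1) ->
  triple_moment phi p = theta_a K * (3 ^+ p * sub3 (moment (fun=> 1) p))
    + fpsC ((-1) ^+ p * phi 2 - phi 1) * (theta_c K * pent_moment p).
Proof.
move=> phiD phi3; rewrite /triple_moment.
rewrite (gs_sum3 (fun s => sg s * phi s * (2 * s - 3)%:~R ^+ p)).
rewrite -addrA; congr (_ + _).
  congr (_ * _); rewrite sub3_gs -natrX -gsZn; last first.
    by apply: finite_sizes_int => i; have := triE i; nia.
  apply: eq_gs => t; rewrite sg3 phi3 natrX.
  rewrite (_ : 2 * (3 * t) - 3 = 3 * (2 * t - 1)); last by ring.
  rewrite rmorphM /= exprMn -pmulrn mulr1; move: ((2 * t - 1)%:~R ^+ p) (3 ^+ p) => u v.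
  exact: mulrCA.
rewrite rmorphB mulrBl addrC; congr (_ + _).
  rewrite mulrCA -gsZ; last exact: finite_pent.
  congr (_ * _); apply: eq_gs => t; rewrite sgD sgN sg3 phiD.
  have := phi3 (- t); rewrite mulrN => ->.
  rewrite (_ : 2 * (2 - 3 * t) - 3 = - (6 * t - 1)); last by ring.
  rewrite rmorphN /= (exprNn (6 * t - 1)%:~R p) sg2 !mul1r mulr1.
  by move: ((6 * t - 1)%:~R ^+ p) ((-1) ^+ p) (sg t) (phi 2) => u v y z; ring.
rewrite -mulNr -rmorphN mulrCA -gsZ; last exact: finite_pent.
congr (_ * _); apply: eq_gs => t; rewrite sgD sg3 phiD phi3 sg1.
rewrite (_ : 2 * (3 * t + 1) - 3 = 6 * t - 1); last by ring.
by move: (_ ^+ p) => u; ring.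
Qed.

(** The pentagonal number theorem. *)
Lemma pent_moment0 : pent_moment 0 = euler K.
Proof. by rewrite euler_pent; apply: eq_gs => t; rewrite mulr1. Qed.

(** At the trivial character the theta function is odd, by the symmetry
    i -> 1 - i. *)
Lemma moment1_even p : ~~ odd p -> moment (fun=> 1) p = 0.
Proof.
move=> p0; apply: (@fps_natI _ 1); rewrite mulr0.
rewrite mulr_natl mulr2n -[X in _ + X]opprK; apply/eqP; rewrite subr_eq0; apply/eqP.
rewrite -gsN; last exact: finite_tri.
rewrite {1}/moment (gs_bij (h := fun i => 1 - i) (h' := fun i => 1 - i) (N := tri)).
- apply: eq_gs => i /=; rewrite sgD sgN sg1.
  rewrite (_ : 2 * (1 - i) - 1 = - (2 * i - 1)); last by ring.
  by rewrite rmorphN /= exprNn -signr_odd (negbTE p0) expr0 !mulr1 mul1r mulN1r mulNr.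
- by move=> i; ring.
- by move=> i; ring.
- exact: tri_refl.
Qed.

Lemma moment1_1 : moment (fun=> 1) 1 = - 2 * euler K ^+ 3.
Proof. by rewrite -jacobi; apply: eq_gs => i; rewrite mulr1. Qed.

(** The class of 2 modulo 3 is stable under i -> 1 - i and cancels out; on the other two
    classes the triangular numbers are three times the pentagonal ones. *)
Lemma moment_omega (w : K) : w ^+ 2 + w + 1 = 0 ->
  moment (fun i => w ^ i) 0 = fpsC (1 - w) * sub3 (euler K).
Proof.
move=> w2.
have w3 : w ^+ 3 = 1.
  by apply/eqP; rewrite -subr_eq0 (_ : _ - 1 = (w - 1) * (w ^+ 2 + w + 1)); [rewrite w2 mulr0|ring].
have w0 : w != 0 by apply/eqP => w0; move: w3 => /eqP; rewrite w0 expr0n /= eq_sym oner_eq0.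
have w3z t : w ^ (3 * t) = 1 by rewrite -exprz_exp -exprnP w3 exp1rz.
rewrite euler_pent sub3_gs -gsZ; last first.
  by apply: finite_sizes_int => i; have := pentE i; nia.
pose c r (i : int) := (i %% 3 == r)%Z.
have -> : moment (fun i => w ^ i) 0 = gs tri (fun i => sg i * w ^ i *+ c 0 i)
   + gs tri (fun i => sg i * w ^ i *+ c 1 i) + gs tri (fun i => sg i * w ^ i *+ c 2 i).
  rewrite -!gsD; try exact: finite_tri.
  apply: eq_gs => i; rewrite expr0 mulr1 /c; have := ltz_pmod i (isT : 0 < 3%:Z).
  have := modz_ge0 i (isT : 3%:Z != 0); move: (_ %% _)%Z => r.
  by case: r => [[|[|[|r]]]|r] //= _ _; rewrite ?addr0 ?add0r.
have -> : gs tri (fun i => sg i * w ^ i *+ c 2 i) = 0.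
  apply: (@fps_natI _ 1); rewrite mulr0.
  rewrite mulr_natl mulr2n -[X in _ + X]opprK; apply/eqP; rewrite subr_eq0; apply/eqP.
  rewrite -gsN; last exact: finite_tri.
  rewrite [LHS](gs_reindex (h := fun i => 1 - i) (h' := fun i => 1 - i) (N := tri) (P := c 2)).
  - apply: eq_gs => i; rewrite -mulNrn; case: (boolP (c 2 i)) => //=; rewrite /c => /eqP i2.
    have [t ->] : exists t, i = 3 * t + 2 by exists (i %/ 3)%Z; have := divz_eq i 3; lia.
    rewrite (_ : 1 - (3 * t + 2) = 3 * (- t - 1) + 2); last by ring.
    rewrite !expfzDr// !w3z [sg (3 * t + _)]sgD [sg (3 * _ + _)]sgD !sg3 sgD !sgN sg1 sg2.
    by move: (sg t) (w ^ 2%Z) => u v; ring.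
  - by move=> i; rewrite /c => i2; split; [lia|ring|exact: tri_refl].
  - by move=> i; rewrite /c => i2; split; [lia|ring].
rewrite addr0.
have -> : gs tri (fun i => sg i * w ^ i *+ c 0 i) = gs (fun t => 3 * pent t)%N (fun t => sg t).
  rewrite [LHS](gs_reindex (h := fun t => 3 * t) (h' := fun i => (i %/ 3)%Z)
    (N := fun t => (3 * pent t)%N) (P := predT)).
  - by apply: eq_gs => t /=; rewrite sg3 w3z mulr1.
  - move=> t _; rewrite /c; split; [lia|lia|].
    by have := triE (3 * t); have := pentE t; nia.
  - by move=> i; rewrite /c => i0; split => //; lia.
have -> : gs tri (fun i => sg i * w ^ i *+ c 1 i) =
    gs (fun t => 3 * pent t)%N (fun t => - w * sg t).
  rewrite [LHS](gs_reindex (h := fun t => 1 - 3 * t) (h' := fun i => ((1 - i) %/ 3)%Z)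
    (N := fun t => (3 * pent t)%N) (P := predT)).
  - apply: eq_gs => t /=; rewrite sgD sgN sg3 sg1 expfzDr// -mulrN w3z; ring.
  - move=> t _; rewrite /c; split; [lia|lia|].
    by have := triE (1 - 3 * t); have := pentE t; nia.
  - by move=> i; rewrite /c => i0; split => //; lia.
rewrite -gsD; last by apply: finite_sizes_int => i; have := pentE i; nia.
by apply: eq_gs => t; rewrite /sg; ring.
Qed.

End Moments.

(** * The differential equation of the Eisenstein series of weight two *)

(** The pair (a, x) stands for the factorization (a + 1) (x + 1). *)
Definition fact_size (p : nat * nat) : nat := (p.1.+1 * p.2.+1)%N.
Definition fact2_size (t : (nat * nat) * (nat * nat)) : nat :=
  (fact_size t.1 + fact_size t.2)%N.

Lemma finite_fact : finite_sizes fact_size.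
Proof.
move=> n; exists [seq (i, j) | i <- iota 0 n, j <- iota 0 n] => -[a x].
rewrite /fact_size /= => axn; rewrite allpairs_f// mem_iota; nia.
Qed.

Lemma finite_fact2 : finite_sizes fact2_size.
Proof. exact: (finite_sizes_prod finite_fact finite_fact). Qed.

Section Convolution.
Variable K : numFieldType.

Lemma sigma_gs k : sigma K k = gs fact_size (fun p => p.1.+1%:R ^+ k).
Proof.
apply/funext => n.
have us : uniq [seq (i, j) | i <- iota 0 n, j <- iota 0 n].
  by apply: allpairs_uniq; rewrite ?iota_uniq// => -[? ?] [? ?].
rewrite (gs_seq _ us) => [|[a x]]; last first.
  by rewrite /fact_size /= => axn; rewrite allpairs_f// mem_iota; nia.
rewrite big_mkcond big_allpairs_dep /=; case: (posnP n) => [->|n0].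
  by rewrite big_nil.
rewrite (@sigmaE _ _ _ n) ?n0 ?leqnn// big_mkcond /index_iota subn0; apply: eq_bigr => i _.
rewrite /fact_size /=; case: ifPn => [/dvdnP[j nE]|nin].
  case: j => [|j] in nE; first by rewrite nE in n0.
  rewrite (big_rem j) /=; last by rewrite mem_iota; nia.
  rewrite mulnC -nE eqxx big_seq big1 ?addr0// => l.
  by rewrite mem_rem_uniq ?iota_uniq// inE => /andP[lj _]; case: eqP => //; nia.
rewrite big1// => j _; case: eqP => // nE; case/negP: nin.
by rewrite -nE dvdn_mulr.
Qed.

Lemma gs_fact_swap (w : nat * nat -> K) :
  gs fact_size w = gs fact_size (fun p => w (p.2, p.1)).
Proof.
rewrite (gs_bij (h := fun p => (p.2, p.1)) (h' := fun p => (p.2, p.1)) (N := fact_size)) //.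
- by case.
- by case.
- by move=> p; rewrite /fact_size mulnC.
Qed.

(** The truncated difference only serves to make the sizes finite. *)
Lemma gs_fact_split (w : nat * nat -> nat -> K) :
  gs (fun t : (nat * nat) * nat => fact_size t.1 + (t.2 - t.1.1))%N
    (fun t => w t.1 t.2 *+ (t.2 < t.1.1)%N) =
  gs fact_size (fun p => \sum_(j < p.1) w p j).
Proof.
apply/funext => n; have [s us sP] := finite_sizes_uniq n finite_fact.
rewrite (gs_seq _ us sP).
have ust : uniq [seq (p, j) | p <- s, j <- iota 0 (2 * n + 1)].
  by apply: allpairs_uniq; rewrite ?iota_uniq// => -[? ?] [? ?].
rewrite (gs_seq _ ust) => [|[[a x] j] /= jn]; last first.
  rewrite allpairs_f//; first by apply: sP; lia.
  by rewrite mem_iota; move: jn; rewrite /fact_size /=; nia.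
rewrite big_mkcond big_allpairs_dep /= [RHS]big_mkcond; apply: eq_bigr => p _.
case: eqP => [pn|pn].
  rewrite (big_ord_widen (2 * n + 1) (w p)); last first.
    by move: pn; rewrite /fact_size; nia.
  rewrite [RHS]big_mkcond -(big_mkord xpredT (fun j => if (j < p.1)%N then w p j else 0)).
  rewrite /index_iota subn0; apply: eq_bigr => j _.
  case: (ltnP j p.1) => jp; last by rewrite mulr0n if_same.
  by rewrite pn (_ : j - p.1 = 0)%N ?addn0 ?eqxx//; lia.
rewrite big1// => j _; case: (ltnP j p.1) => jp; last by rewrite mulr0n if_same.
by rewrite (_ : j - p.1 = 0)%N ?addn0; [case: eqP|lia].
Qed.

Lemma gs_fact2_split (P : pred ((nat * nat) * (nat * nat))) w
    (h : (nat * nat) * nat -> (nat * nat) * (nat * nat)) h' :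
    (forall t, (t.2 < t.1.1)%N -> [/\ P (h t), h' (h t) = t & fact2_size (h t) = fact_size t.1]) ->
    (forall y, P y -> ((h' y).2 < (h' y).1.1)%N /\ h (h' y) = y) ->
  gs fact2_size (fun t => w t *+ P t) =
  gs fact_size (fun p => \sum_(j < p.1) w (h (p, j : nat))) :> fps K.
Proof.
move=> hP hP'; rewrite -(gs_fact_split (fun p j => w (h (p, j)))).
rewrite (gs_reindex (h := h) (h' := h') (P := fun t => (t.2 < t.1.1)%N)
  (N := fun t => fact_size t.1 + (t.2 - t.1.1))%N)//.
- by apply: eq_gs => -[p j].
- move=> t tP; have [? ? ->] := hP t tP; split=> //.
  by rewrite (_ : t.2 - t.1.1 = 0)%N ?addn0//; lia.
Qed.

Local Notation T4 := ((nat * nat) * (nat * nat))%type.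
Local Notation G w := (gs fact2_size (w : T4 -> K)).
Local Notation A t := (t.1.1.+1%:R : K).
Local Notation B t := (t.2.1.+1%:R : K).

Lemma gs_case (w : T4 -> K) (f g : T4 -> nat) :
  G w = G (fun t => w t *+ (f t < g t)%N) + G (fun t => w t *+ (f t == g t)%N)
    + G (fun t => w t *+ (g t < f t)%N).
Proof.
rewrite -!gsD; try exact: finite_fact2.
by apply: eq_gs => t; case: ltngtP; rewrite ?addr0 ?add0r.
Qed.

(** If X < Y then A X + B Y = (A + B) X + B (Y - X): the pairs with X < Y and those with
    Y < X each contribute the sum of A^2 over B < A; X = Y contributes a sum over A + B. *)
Lemma gs_sum_square : G (fun t => (A t + B t) ^+ 2) =
  2 * G (fun t => A t ^+ 2 *+ (t.2.1 < t.1.1)%N) + (sigma K 3 - sigma K 2).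
Proof.
rewrite (gs_case _ (fun t => t.1.2) (fun t => t.2.2)).
have -> : G (fun t => (A t + B t) ^+ 2 *+ (t.2.2 < t.1.2)%N) =
    G (fun t => (A t + B t) ^+ 2 *+ (t.1.2 < t.2.2)%N).
  rewrite [LHS](gs_reindex (h := fun t : T4 => (t.2, t.1)) (h' := fun t : T4 => (t.2, t.1))
    (P := fun t => (t.1.2 < t.2.2)%N) (N := fact2_size)).
  - by apply: eq_gs => t /=; rewrite addrC.
  - by move=> [t1 t2] /= t12; split=> //; rewrite /fact2_size addnC.
  - by case.
have -> : G (fun t => (A t + B t) ^+ 2 *+ (t.1.2 < t.2.2)%N) =
    G (fun t => A t ^+ 2 *+ (t.2.1 < t.1.1)%N).
  rewrite [LHS](gs_reindex
    (h := fun t : T4 => ((t.1.1 - t.2.1.+1, t.1.2), (t.2.1, t.1.2 + t.2.2.+1))%N)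
    (h' := fun t : T4 => ((t.1.1 + t.2.1.+1, t.1.2), (t.2.1, t.2.2 - t.1.2.+1))%N)
    (P := fun t => (t.2.1 < t.1.1)%N) (N := fact2_size)).
  - apply: eq_gs => -[[a x] [b y]] /=; case: ltnP => //= ba.
    by rewrite -natrD; congr (_%:R ^+ _); lia.
  - move=> [[a x] [b y]] /= ba; split; [lia|congr ((_, _), (_, _)); lia|].
    by rewrite /fact2_size /fact_size /=; nia.
  - move=> [[a x] [b y]] /= xy; split; [lia|congr ((_, _), (_, _)); lia].
have -> : G (fun t => (A t + B t) ^+ 2 *+ (t.1.2 == t.2.2)%N) = sigma K 3 - sigma K 2.
  rewrite (gs_fact2_split _
     (h := fun t => ((t.2, t.1.2), (t.1.1 - t.2.+1, t.1.2))%N)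
     (h' := fun t => ((t.1.1 + t.2.1.+1, t.1.2), t.1.1)%N)).
  - rewrite !sigma_gs -gsN; last exact: finite_fact.
    rewrite -gsD; last exact: finite_fact.
    apply: eq_gs => -[a x] /=.
    rewrite (eq_bigr (fun=> a.+1%:R ^+ 2)); last first.
      move=> j _; rewrite -natrD; congr (_%:R ^+ _); have := ltn_ord j; lia.
    by rewrite sumr_const card_ord -[in LHS]mulr_natl -addn1 natrD; ring.
  - move=> [[a x] j] /= ja; split=> //; first by congr ((_, _), _); lia.
    by rewrite /fact2_size /fact_size /=; nia.
  - move=> [[a x] [b y]] /= /eqP <-; split; [lia|congr ((_, _), (_, _)); lia].
ring.
Qed.

(** If B < A then A X + B Y = (A - B) X + B (X + Y), where the new cofactors are in
    increasing order. *)
Lemma gs_diff_square : G (fun t => (A t - B t) ^+ 2) =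
  2 * G (fun t => A t ^+ 2 *+ (t.1.2 < t.2.2)%N).
Proof.
rewrite (gs_case _ (fun t => t.2.1) (fun t => t.1.1)).
have -> : G (fun t => (A t - B t) ^+ 2 *+ (t.1.1 < t.2.1)%N) =
    G (fun t => (A t - B t) ^+ 2 *+ (t.2.1 < t.1.1)%N).
  rewrite [LHS](gs_reindex (h := fun t : T4 => (t.2, t.1)) (h' := fun t : T4 => (t.2, t.1))
    (P := fun t => (t.2.1 < t.1.1)%N) (N := fact2_size)).
  - by apply: eq_gs => t /=; congr (_ *+ _); ring.
  - by move=> [t1 t2] /= t12; split=> //; rewrite /fact2_size addnC.
  - by case.
have -> : G (fun t => (A t - B t) ^+ 2 *+ (t.2.1 == t.1.1)%N) = 0.
  apply/funext => n; rewrite /gs fsbig1// => t _.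
  by case: eqP => // ->; rewrite subrr expr0n.
have -> : G (fun t => (A t - B t) ^+ 2 *+ (t.2.1 < t.1.1)%N) =
    G (fun t => A t ^+ 2 *+ (t.1.2 < t.2.2)%N).
  rewrite [LHS](gs_reindex
    (h := fun t : T4 => ((t.1.1 + t.2.1.+1, t.1.2), (t.2.1, t.2.2 - t.1.2.+1))%N)
    (h' := fun t : T4 => ((t.1.1 - t.2.1.+1, t.1.2), (t.2.1, t.1.2 + t.2.2.+1))%N)
    (P := fun t => (t.1.2 < t.2.2)%N) (N := fact2_size)).
  - apply: eq_gs => -[[a x] [b y]] /=; rewrite -addSn natrD addrK.
    by case: ltnP.
  - move=> [[a x] [b y]] /= xy; split; [lia|congr ((_, _), (_, _)); lia|].
    by rewrite /fact2_size /fact_size /=; nia.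
  - move=> [[a x] [b y]] /= ba; split; [lia|congr ((_, _), (_, _)); lia].
ring.
Qed.

(** For fixed A and B both sides count solutions of A X + B Y = n in a half-strip;
    the translation by (B, - A) matches them up to their boundary lines. *)
Lemma gs_strips :
  G (fun t => A t ^+ 2 *+ (t.2.1 < t.1.1)%N) - G (fun t => A t ^+ 2 *+ (t.1.2 < t.2.2)%N) =
  G (fun t => A t ^+ 2 *+ (t.1.2 == t.2.1)%N) - G (fun t => A t ^+ 2 *+ (t.2.2 == t.1.1)%N).
Proof.
pose h (t : T4) := (t.1, (t.2.2, t.2.1)).
have hS (P P' : pred T4) : (forall t, P (h t) = P' t) ->
    G (fun t => A t ^+ 2 *+ P' t) = G (fun t => A t ^+ 2 *+ P t).
  move=> PP'; rewrite [RHS](gs_reindex (h := h) (h' := h) (P := P') (N := fact2_size))//.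
    move=> [[a x] [b y]] Pt; split=> //; first by rewrite PP'.
    by rewrite /fact2_size /fact_size /=; lia.
  by move=> [[a x] [b y]] Pt; split=> //; rewrite -PP'.
rewrite (hS (fun t => t.2.2 < t.1.1)%N (fun t => t.2.1 < t.1.1)%N)//.
rewrite (hS (fun t => t.1.2 < t.2.1)%N (fun t => t.1.2 < t.2.2)%N)//.
have E1 := gs_case (fun t => A t ^+ 2) (fun t => t.2.2) (fun t => t.1.1).
have E2 := gs_case (fun t => A t ^+ 2) (fun t => t.1.2) (fun t => t.2.1).
have E3 : G (fun t => A t ^+ 2 *+ (t.2.1 < t.1.2)%N) = G (fun t => A t ^+ 2 *+ (t.1.1 < t.2.2)%N).
  rewrite [LHS](gs_reindex
    (h := fun t : T4 => ((t.1.1, t.1.2 + t.2.1.+1), (t.2.1, t.2.2 - t.1.1.+1))%N)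
    (h' := fun t : T4 => ((t.1.1, t.1.2 - t.2.1.+1), (t.2.1, t.2.2 + t.1.1.+1))%N)
    (P := fun t => (t.1.1 < t.2.2)%N) (N := fact2_size))//.
  - move=> [[a x] [b y]] /= ay; split; [lia|congr ((_, _), (_, _)); lia|].
    by rewrite /fact2_size /fact_size /=; nia.
  - move=> [[a x] [b y]] /= bx; split; [lia|congr ((_, _), (_, _)); lia].
have := etrans (esym E1) E2; rewrite E3 => /addIr.
move: (G _) (G _) (G _) (G _) => p q p' q' E.
by rewrite [LHS](_ : _ = q' + p' - q - p'); [rewrite E; ring|ring].
Qed.

Lemma sum_squares (m : nat) : 6 * \sum_(j < m) (j.+1%:R ^+ 2 : K) =
  m%:R * (m%:R + 1) * (2 * m%:R + 1).
Proof.
elim: m => [|m IHm]; first by rewrite big_ord0 mulr0 !mul0r.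
by rewrite big_ord_recr /= mulrDr IHm -addn1 natrD; ring.
Qed.

Lemma gs_diagonal1 : 6 * G (fun t => A t ^+ 2 *+ (t.1.2 == t.2.1)%N) =
  2 * sigma K 3 - 3 * sigma K 2 + sigma K 1.
Proof.
rewrite (gs_fact2_split _
     (h := fun t => ((t.2, t.1.2), (t.1.2, t.1.1 - t.2.+1))%N)
     (h' := fun t => ((t.1.1 + t.2.2.+1, t.1.2), t.1.1)%N)).
- rewrite !sigma_gs -!gsZn; try exact: finite_fact.
  rewrite -gsN; last exact: finite_fact.
  rewrite -!gsD; try exact: finite_fact.
  apply: eq_gs => -[a x] /=; rewrite sum_squares -addn1 natrD; ring.
- move=> [[a x] j] /= ja; split=> //; first by congr ((_, _), _); lia.
  by rewrite /fact2_size /fact_size /=; nia.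
- move=> [[a x] [b y]] /= /eqP <-; split; [lia|congr ((_, _), (_, _)); lia].
Qed.

Lemma gs_diagonal2 : G (fun t => A t ^+ 2 *+ (t.2.2 == t.1.1)%N) = D (sigma K 1) - sigma K 2.
Proof.
rewrite (gs_fact2_split _
     (h := fun t => ((t.1.2, t.2), (t.1.1 - t.2.+1, t.1.2))%N)
     (h' := fun t => ((t.1.2 + t.2.1.+1, t.1.1), t.1.2)%N)).
- (* The sum over j yields the cofactor minus one, hence n sigma_1 - sigma_2. *)
  rewrite gs_fact_swap !sigma_gs D_gs; last exact: finite_fact.
  rewrite -gsN; last exact: finite_fact.
  rewrite -!gsD; try exact: finite_fact.
  apply: eq_gs => -[a x] /=; rewrite sumr_const card_ord /fact_size /= natrM.
  rewrite -[LHS]mulr_natl -[x.+1]addn1 natrD expr1.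
  by move: (a.+1%:R : K) (x%:R : K) => u v; ring.
- move=> [[a x] j] /= ja; split=> //; first by congr ((_, _), _); lia.
  by rewrite /fact2_size /fact_size /=; nia.
- move=> [[a x] [b y]] /= /eqP ->; split; [lia|congr ((_, _), (_, _)); lia].
Qed.

(** 12 A B = 3 (A + B)^2 - 3 (A - B)^2, and both squares reduce to sums of A^2 over
    half-strips. *)
Lemma sigma1_square :
  12 * sigma K 1 ^+ 2 = 5 * sigma K 3 + sigma K 1 - 6 * D (sigma K 1).
Proof.
have -> : 12 * sigma K 1 ^+ 2 =
    3 * (G (fun t => (A t + B t) ^+ 2) - G (fun t => (A t - B t) ^+ 2)).
  rewrite expr2 {1 2}sigma_gs (gs_mul _ _ finite_fact finite_fact).
  rewrite -gsN; last exact: finite_fact2.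
  rewrite -gsD; last exact: finite_fact2.
  rewrite -!gsZn; try exact: finite_fact2.
  by apply: eq_gs => t; ring.
rewrite gs_sum_square gs_diff_square.
have := gs_strips; have := gs_diagonal1; rewrite gs_diagonal2.
move: (G _) (G _) (G _) => u v w E1 E2.
rewrite [LHS](_ : _ = 6 * (v - u) + 3 * (sigma K 3 - sigma K 2)); last by ring.
by rewrite E2 mulrBr E1; ring.
Qed.

End Convolution.

(** * Relations between the theta functions and Eisenstein series *)

Section Eisenstein.
Variable K : numFieldType.
Local Notation e := (euler K).
Local Notation E := (sub3 e).
Local Notation a := (theta_a K).
Local Notation c := (theta_c K).

Definition eis2 : fps K := 1 - 24 * sigma K 1.
Definition eis4 : fps K := 1 + 240 * sigma K 3.
Local Notation X := eis2.
Local Notation Y := (sub3 eis2).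

Lemma D_eulerE : 24 * D e = (X - 1) * e.
Proof. by rewrite D_euler /eis2; ring. Qed.

Lemma D_sub3_eulerE : 8 * D E = (Y - 1) * E.
Proof.
rewrite D_sub3 (_ : 8 * (3 * _) = sub3 (24 * D e)); last by rewrite rmorphM rmorph_nat; ring.
by rewrite D_eulerE rmorphM rmorphB rmorph1.
Qed.

Lemma euler_neq0 : e 0 != 0. Proof. by rewrite euler0 oner_eq0. Qed.

Lemma sub3_euler0 : E 0 = 1. Proof. by rewrite /sub3 dvdn0 div0n euler0. Qed.

Lemma sub3_euler_neq0 : E 0 != 0. Proof. by rewrite sub3_euler0 oner_eq0. Qed.

Lemma fpsX_neq0 (f : fps K) n : f 0 != 0 -> (f ^+ n) 0 != 0.
Proof. by rewrite fpsX0; exact: expf_neq0. Qed.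

(** Ramanujan's differential equation. *)
Lemma D_eis2 : 12 * D X = X ^+ 2 - eis4.
Proof.
rewrite raddfB /= D1 D_natM sub0r; apply: (@fps_natI _ 23).
have := sigma1_square K; rewrite /eis2 /eis4; move: (sigma K 3) (sigma K 1) (D (sigma K 1)) => s3 s1 d H.
rewrite [RHS](_ : _ = 1152 * (12 * s1 ^+ 2) - 1152 * s1 - 5760 * s3); last by ring.
by rewrite H; ring.
Qed.

Lemma D_sub3_eis2 : 4 * D Y = Y ^+ 2 - sub3 eis4.
Proof.
rewrite D_sub3 (_ : 4 * (3 * _) = sub3 (12 * D X)); last by rewrite rmorphM rmorph_nat; ring.
by rewrite D_eis2 rmorphB rmorphXn.
Qed.

End Eisenstein.

(** The theta function vanishes at the trivial character, hence so does the derivative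
    of its cube. *)
Lemma theta_c_pent_moment1 (K : numFieldType) :
  theta_c K * pent_moment K 1 = - 3 * theta_a K * sub3 (euler K) ^+ 3.
Proof.
have one2 (i j : int) : 1 = 1 * 1 :> K by rewrite mulr1.
have := @triple_moment_split K (fun=> 1) 1 one2 (fun=> erefl).
have [_ -> _ _ _] := triple_moment_small one2.
rewrite ![moment (fun=> 1) 0]moment1_even// moment1_1.
rewrite rmorphM rmorphXn !raddfN /= rmorph_nat => H.
have k2 : fpsC ((-1) ^+ 1 * 1 - 1) = - 2 :> fps K.
  rewrite (_ : _ - 1 = - 2%:R); last by ring.
  by rewrite rmorphN rmorph_nat.
apply: (@fps_natI _ 1); move: H; rewrite k2.
move: (theta_c K * _) (sub3 _) (theta_a K) => u v z H.
rewrite [LHS](_ : _ = z * (3 ^+ 1 * (- 2 * v ^+ 3)) - (z * (3 ^+ 1 * (- 2 * v ^+ 3)) + (- 2) * u)); last by ring.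
by rewrite -H; ring.
Qed.

Section CubeRoot.
Variables (K : numFieldType) (w : K).
Hypothesis w2 : w ^+ 2 + w + 1 = 0.
Local Notation e := (euler K).
Local Notation E := (sub3 e).
Local Notation a := (theta_a K).
Local Notation c := (theta_c K).
Local Notation X := (eis2 K).
Local Notation Y := (sub3 X).
Local Notation phi := (fun i : int => w ^ i).
Local Notation M p := (moment phi p).

Let w3 : w ^+ 3 = 1.
Proof.
by apply/eqP; rewrite -subr_eq0 (_ : _ - 1 = (w - 1) * (w ^+ 2 + w + 1));
  [rewrite w2 mulr0|ring].
Qed.

Let w_neq0 : w != 0.
Proof. by apply/eqP => w0; move: w3 => /eqP; rewrite w0 expr0n /= eq_sym oner_eq0. Qed.

Let phiD i j : phi (i + j) = phi i * phi j. Proof. exact: expfzDr. Qed.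

Let phi3 t : phi (3 * t) = 1.
Proof. by rewrite /= -exprz_exp -exprnP w3 exp1rz. Qed.

Let d_neq0 : w ^+ 2 - w != 0.
Proof.
apply/eqP => d0; have w1 : w ^+ 2 = w by apply/eqP; rewrite -subr_eq0 d0.
have : w ^+ 3 = w by rewrite exprS w1 -expr2 w1.
rewrite w3 => w1'; move: w2; rewrite -w1' expr1n => /eqP.
by rewrite (_ : 1 + 1 + 1 = 3%:R) ?pnatr_eq0//; ring.
Qed.

Let fpsC_inj (k : K) f g : k != 0 -> fpsC k * f = fpsC k * g -> f = g.
Proof. by move=> k0; apply: fps_mulfI; rewrite /fpsC. Qed.

(** By [moment_omega] and [M1], the moments at w of even and odd order are multiples of
    1 - w and w^2; the products of three that occur are multiples of w^2 - w, which for
    even p is also the factor on the other side of [triple_moment_split]. *)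
Let prod3 f g h :
  (fpsC (1 - w) * f) * (fpsC (1 - w) * g) * (fpsC (1 - w) * h)
  = fpsC (w ^+ 2 - w) * (3 * (f * g * h)).
Proof.
have E0 : (1 - w) * (1 - w) * (1 - w) = 3 * (w ^+ 2 - w).
  by rewrite [LHS](_ : _ = 1 - w ^+ 3 + 3 * (w ^+ 2 - w)); [rewrite w3 subrr add0r|ring].
have : fpsC (1 - w) * fpsC (1 - w) * fpsC (1 - w) = 3 * fpsC (w ^+ 2 - w).
  by rewrite -!rmorphM E0 rmorphM rmorph_nat.
move: (fpsC _) (fpsC _) => d k H; rewrite [LHS](_ : _ = (k * k * k) * (f * g * h)); last by ring.
by rewrite H; ring.
Qed.

Let prod1 f g h :
  (fpsC (1 - w) * f) * (fpsC (w ^+ 2) * g) * (fpsC (w ^+ 2) * h)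
  = fpsC (w ^+ 2 - w) * - (f * g * h).
Proof.
have E0 : (1 - w) * (w ^+ 2) * (w ^+ 2) = - (w ^+ 2 - w).
  by rewrite [LHS](_ : _ = w ^+ 3 * (w - w ^+ 2)); [rewrite w3; ring|ring].
have : fpsC (1 - w) * fpsC (w ^+ 2) * fpsC (w ^+ 2) = - fpsC (w ^+ 2 - w).
  by rewrite -!rmorphM E0 rmorphN.
move: (fpsC _) (fpsC _) (fpsC _) => d k l H.
rewrite [LHS](_ : _ = (l * k * k) * (f * g * h)); last by ring.
by rewrite H; ring.
Qed.

Let split p : triple_moment phi p = a * (3 ^+ p * sub3 (moment (fun=> 1) p))
  + fpsC ((-1) ^+ p * w ^+ 2 - w) * (c * pent_moment K p).
Proof. by rewrite triple_moment_split// expr1z. Qed.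

Let M0 : M 0 = fpsC (1 - w) * E.
Proof. exact: moment_omega. Qed.

Let smallE := triple_moment_small phiD.

(** Order 0 at the cube root of unity. *)
Lemma theta_c_euler : c * e = 3 * E ^+ 3.
Proof.
have := split 0; rewrite moment1_even// raddf0 !mulr0 add0r pent_moment0.
have [-> _ _ _ _] := smallE; rewrite M0 expr0 mul1r => H.
apply: (fpsC_inj d_neq0); rewrite -H.
rewrite [LHS](_ : _ = fpsC (1 - w) * E * (fpsC (1 - w) * E) * (fpsC (1 - w) * E)).
  by rewrite prod3; ring.
ring.
Qed.

(** Order 1 at the cube root of unity. *)
Let M1 : M 1 = fpsC (w ^+ 2) * (a * E).
Proof.
suff H : fpsC w * M 1 = a * E.
  by rewrite -H mulrA -rmorphM -exprSr w3 rmorph1 mul1r.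
have := split 1; rewrite theta_c_pent_moment1 moment1_1.
rewrite rmorphM rmorphXn !raddfN /= rmorph_nat.
have [_ -> _ _ _] := smallE; rewrite M0 => H.
have k1 : fpsC ((-1) ^+ 1 * w ^+ 2 - w) = 1 :> fps K.
  rewrite (_ : _ - w = 1) ?rmorph1//.
  by rewrite -[RHS]subr0 -w2; ring.
have k2 : fpsC (1 - w) * fpsC (1 - w) = - 3 * fpsC w :> fps K.
  rewrite -rmorphM (_ : _ * _ = - 3%:R * w) ?rmorphM ?rmorphN ?rmorph_nat//.
  by rewrite -[RHS]addr0 -w2; ring.
rewrite k1 mul1r in H.
apply: (@fps_mulfI _ (E ^+ 2)); first exact/fpsX_neq0/sub3_euler_neq0.
apply: (@fps_natI _ 8); move: H; move: (M 1) (E) (a) => m v z H.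
rewrite [RHS](_ : _ = - (z * (3 ^+ 1 * (- 2 * v ^+ 3)) + - 3 * z * v ^+ 3)); last by ring.
rewrite -H; move: k2; move: (fpsC (1 - w)) (fpsC w) => k l k2.
rewrite [RHS](_ : _ = - (k * k) * (3 * v ^+ 2 * m)); last by ring.
by rewrite k2; ring.
Qed.

Let DfpsC k : D (fpsC k) = 0 :> fps K.
Proof.
by apply/funext => n; rewrite DE /fpsC fps0; case: eqP => [->|_]; rewrite ?mul0r ?mulr0.
Qed.

Let M2 : M 2 = fpsC (1 - w) * (Y * E).
Proof.
rewrite moment_heat M0 DM DfpsC mul0r add0r.
rewrite [LHS](_ : _ = fpsC (1 - w) * (8 * D E + E)); last by ring.
by rewrite D_sub3_eulerE; congr (_ * _); ring.
Qed.

Let M3 : M 3 = fpsC (w ^+ 2) * (8 * D (a * E) + a * E).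
Proof. by rewrite moment_heat M1 DM DfpsC mul0r add0r; ring. Qed.

Let M4 : M 4 = fpsC (1 - w) * (8 * D (Y * E) + Y * E).
Proof. by rewrite moment_heat M2 DM DfpsC mul0r add0r; ring. Qed.

Let V2 : pent_moment K 2 = X * e.
Proof. by rewrite pent_moment_heat pent_moment0 D_eulerE; ring. Qed.

Let V4 : pent_moment K 4 = 24 * D (X * e) + X * e.
Proof. by rewrite pent_moment_heat V2. Qed.

Let E3_neq0 : (E ^+ 3) 0 != 0. Proof. exact/fpsX_neq0/sub3_euler_neq0. Qed.

(** Order 2 at the cube root of unity. *)
Lemma theta_a_square : 2 * a ^+ 2 = 3 * Y - X.
Proof.
apply: (fps_mulfI E3_neq0); apply: (@fps_natI _ 2).
have := split 2; rewrite moment1_even// raddf0 !mulr0 add0r V2.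
have [_ _ -> _ _] := smallE; rewrite (_ : (-1) ^+ 2 * _ = w ^+ 2); last by ring.
rewrite [c * _](_ : _ = X * (c * e)); last by ring.
rewrite theta_c_euler [X in X = _ -> _](_ : _ = 3 * (M 0 * M 0 * M 2) + 6 * (M 0 * M 1 * M 1)); last by ring.
rewrite M0 M1 M2 prod3 prod1 => H.
have {H} : - (6 * a ^+ 2 * E ^+ 3) + 9 * Y * E ^+ 3 = 3 * X * E ^+ 3.
  by apply: (fpsC_inj d_neq0); move: H; move: (fpsC _) => d H;
    rewrite [RHS](_ : _ = d * (X * (3 * E ^+ 3))); [rewrite -H; ring|ring].
move: (E ^+ 3) => v H.
by rewrite [RHS](_ : _ = 9 * Y * v - 3 * X * v); [rewrite -H; ring|ring].
Qed.

(** Order 4 at the cube root of unity. *)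
Lemma theta_a_fourth :
  72 * D X + 3 * X ^+ 2 =
  72 * D Y + 63 * Y ^+ 2 - 192 * a * D a - 60 * a ^+ 2 * Y.
Proof.
apply: (fps_mulfI E3_neq0).
have := split 4; rewrite moment1_even// raddf0 !mulr0 add0r V4.
have [_ _ _ _ ->] := smallE; rewrite (_ : (-1) ^+ 4 = 1); last by ring.
rewrite mul1r => H.
have cV4 : c * (24 * D (X * e) + X * e) = E ^+ 3 * (72 * D X + 3 * X ^+ 2).
  rewrite DM [LHS](_ : _ = (24 * D X + X) * (c * e) + X * c * (24 * D e)); last by ring.
  rewrite D_eulerE [LHS](_ : _ = (24 * D X + X ^+ 2) * (c * e)); last by ring.
  by rewrite theta_c_euler; ring.
rewrite -cV4; apply: (fpsC_inj d_neq0); rewrite -H.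
rewrite [LHS](_ : _ = 3 * (M 0 * M 0 * M 4) + 24 * (M 0 * M 1 * M 3)
  + 18 * (M 0 * M 2 * M 2) + 36 * (M 2 * M 1 * M 1)); last by ring.
rewrite M0 M1 M2 M3 M4 !prod3 !prod1 !DM.
have DE' := D_sub3_eulerE K.
rewrite [LHS](_ : _ = fpsC (w ^+ 2 - w) * (9 * E * E * (8 * D Y * E + Y * (8 * D E) + Y * E)
  - 24 * (E * a * E * (8 * D a * E + a * (8 * D E) + a * E))
  + 54 * E * Y * E * Y * E - 36 * Y * E * a * E * a * E)); last by ring.
by rewrite DE'; ring.
Qed.

End CubeRoot.

Section MapFps.
Variables (K L : numFieldType) (f : {rmorphism K -> L}).

(** The identities obtained from a cube root of unity w have rational coefficients: they are
    proved over a field containing w and pulled back. *)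
Definition map_fps (F : fps K) : fps L := fun n => f (F n).

Lemma map_fps_additive : zmod_morphism map_fps.
Proof. by move=> F G; apply/funext => n; rewrite /map_fps fpsD fpsN rmorphB. Qed.

Lemma map_fps_multiplicative : monoid_morphism map_fps.
Proof.
split=> [|F G]; apply/funext => n; first by rewrite /map_fps !fps1 rmorph_nat.
by rewrite /map_fps !fpsM rmorph_sum; apply: eq_bigr => i _; rewrite rmorphM.
Qed.

HB.instance Definition _ :=
  GRing.isZmodMorphism.Build (fps K) (fps L) map_fps map_fps_additive.
HB.instance Definition _ :=
  GRing.isMonoidMorphism.Build (fps K) (fps L) map_fps map_fps_multiplicative.

Lemma map_fps_inj : injective map_fps.
Proof. by move=> F G FG; apply/funext => n; have := congr1 (@^~ n) FG => /fmorph_inj. Qed.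

Lemma map_fps_gs (T : choiceType) (N : T -> nat) (w : T -> K) : finite_sizes N ->
  map_fps (gs N w) = gs N (f \o w).
Proof.
move=> fN; apply/funext => n; have [s us sP] := finite_sizes_uniq n fN.
by rewrite /map_fps !(gs_seq _ us sP) rmorph_sum.
Qed.

Lemma map_fps_D F : map_fps (D F) = D (map_fps F).
Proof. by apply/funext => n; rewrite /map_fps !DE rmorphM rmorph_nat. Qed.

Lemma map_fps_sub3 F : map_fps (sub3 F) = sub3 (map_fps F).
Proof. by apply/funext => n; rewrite /map_fps /sub3; case: ifP; rewrite ?rmorph0. Qed.

Lemma map_euler : map_fps (euler K) = euler L.
Proof.
rewrite !euler_pent map_fps_gs; last exact: finite_pent.
by apply: eq_gs => t; rewrite /= rmorphXn rmorphN1.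
Qed.

Lemma map_theta_a : map_fps (theta_a K) = theta_a L.
Proof.
rewrite map_fps_gs; last exact: finite_qf.
by apply: eq_gs => t; rewrite /= rmorph1.
Qed.

Lemma map_theta_c : map_fps (theta_c K) = theta_c L.
Proof.
rewrite map_fps_gs; last exact: finite_cf.
by apply: eq_gs => t; rewrite /= rmorph1.
Qed.

Lemma map_eis2 : map_fps (eis2 K) = eis2 L.
Proof.
rewrite rmorphB rmorph1 rmorphM rmorph_nat; congr (1 - 24 * _).
apply/funext => n; transitivity (f (sigma K 1 n)); first by [].
rewrite /sigma; case: (n == 0); first by rewrite rmorph0.
by rewrite rmorph_sum; apply: eq_bigr => d _; rewrite rmorphXn rmorph_nat.
Qed.

Definition map_fpsE :=
  (map_euler, map_theta_a, map_theta_c, map_eis2, map_fps_D, map_fps_sub3).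

End MapFps.

Section RealSeries.
Variable R : realType.
Local Notation e := (euler R).
Local Notation E := (sub3 e).
Local Notation a := (theta_a R).
Local Notation c := (theta_c R).
Local Notation X := (eis2 R).
Local Notation Y := (sub3 X).
Local Notation Q := (eis4 R).

Let f : {rmorphism R -> R[i]} := real_complex R.

Let w : R[i] := (- (2^-1)) +i* (Num.sqrt 3 / 2).

Let w2 : w ^+ 2 + w + 1 = 0.
Proof.
rewrite /w expr2; simpc; apply/eqP; rewrite eq_complex /=; apply/andP; split; apply/eqP.
  have s3 : Num.sqrt 3 ^+ 2 = 3 :> R by rewrite sqr_sqrtr.
  by rewrite (_ : Num.sqrt 3 / 2 * (Num.sqrt 3 / 2) = Num.sqrt 3 ^+ 2 / 4 :> R);
    [rewrite s3; field|field].
by field.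
Qed.

Lemma theta_c_eulerR : c * e = 3 * E ^+ 3.
Proof.
apply: (@map_fps_inj _ _ f); rewrite !(rmorphM, rmorphXn, rmorph_nat) /= !map_fpsE.
exact: (theta_c_euler w2).
Qed.

Lemma theta_a_squareR : 2 * a ^+ 2 = 3 * Y - X.
Proof.
apply: (@map_fps_inj _ _ f).
have := map_eis2 f; move: X => x mX.
rewrite !(rmorphB, rmorphM, rmorphXn, rmorph_nat) /= !map_fpsE mX.
exact: (theta_a_square w2).
Qed.

Lemma theta_a_fourthR : 72 * D X + 3 * X ^+ 2 =
  72 * D Y + 63 * Y ^+ 2 - 192 * a * D a - 60 * a ^+ 2 * Y.
Proof.
apply: (@map_fps_inj _ _ f).
have := map_eis2 f; move: X => x mX.
rewrite [LHS]rmorphD [RHS]rmorphB [X in _ = X - _]rmorphB [X in _ = X - _ - _]rmorphD.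
rewrite !(rmorphM, rmorphXn, rmorph_nat) /= !map_fpsE mX.
exact: (theta_a_fourth w2).
Qed.

(** The cube of the third cubic theta function. This expression is what the third
    Taylor coefficient at the trivial character produces. *)
Definition theta_b3 : fps R := fpsC (8^-1) * (a * (9 * Y - X) - 24 * D a).
Local Notation b := theta_b3.

Lemma theta_b3E : 8 * b = a * (9 * Y - X) - 24 * D a.
Proof.
rewrite /theta_b3 mulrA (_ : 8 * fpsC 8^-1 = 1) ?mul1r//.
by rewrite -[8](rmorph_nat (@fpsC R)) -rmorphM mulfV ?pnatr_eq0// rmorph1.
Qed.

(** Order 3 at the trivial character, where the cube of the theta function has a triple
    zero with leading coefficient the cube of [moment1_1]. *)
Lemma theta_b3_euler : b * E ^+ 3 = e ^+ 9.
Proof.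
apply: (@fps_natI _ 7); rewrite mulrA theta_b3E.
have one2 (i j : int) : 1 = 1 * 1 :> R by rewrite mulr1.
have := @triple_moment_split R (fun=> 1) 3 one2 (fun=> erefl).
have [_ _ _ -> _] := triple_moment_small one2.
rewrite [moment _ 0]moment1_even// [moment _ 2]moment1_even//.
rewrite moment_heat pent_moment_heat.
have -> : fpsC ((-1) ^+ 3 * 1 - 1) = - 2 :> fps R.
  by rewrite (_ : _ - 1 = - 2%:R) ?rmorphN ?rmorph_nat//; ring.
have -> : 3 ^+ 3 * sub3 (8 * D (moment (fun=> 1 : R) 1) + moment (fun=> 1 : R) 1) =
    72 * D (sub3 (moment (fun=> 1 : R) 1)) + 27 * sub3 (moment (fun=> 1 : R) 1).
  by rewrite D_sub3 rmorphD rmorphM rmorph_nat; ring.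
rewrite moment1_1 rmorphM rmorphXn raddfN /= rmorph_nat => H.
have DE := D_sub3_eulerE R.
have Dc : 24 * D c = (9 * Y - X - 8) * c.
  apply: (fps_mulfI (euler_neq0 R)).
  have := congr1 (@D R) theta_c_eulerR; rewrite DM D_natM DX => Dce.
  rewrite [LHS](_ : _ = 24 * (D c * e + c * D e) - c * (24 * D e)); last by ring.
  rewrite Dce D_eulerE.
  rewrite [LHS](_ : _ = 27 * (8 * D E) * E ^+ 2 - c * ((X - 1) * e)); last by ring.
  rewrite DE [LHS](_ : _ = 9 * (Y - 1) * (3 * E ^+ 3) - c * ((X - 1) * e)); last by ring.
  by rewrite -theta_c_eulerR; ring.
have cV := theta_c_pent_moment1 R.
have cDV : c * (24 * D (pent_moment R 1)) =
    - 72 * D a * E ^+ 3 - 27 * a * (Y - 1) * E ^+ 3 + 3 * (9 * Y - X - 8) * a * E ^+ 3.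
  have := congr1 (@D R) cV; rewrite DM => H1.
  rewrite [LHS](_ : _ = 24 * (D c * pent_moment R 1 + c * D (pent_moment R 1))
    - (24 * D c) * pent_moment R 1); last by ring.
  rewrite H1 Dc [X in _ - X](_ : _ = (9 * Y - X - 8) * (c * pent_moment R 1)); last by ring.
  rewrite cV (_ : - 3 * a * E ^+ 3 = - (3 * (a * E ^+ 3))); last by ring.
  rewrite raddfN /= D_natM DM DX.
  rewrite [LHS](_ : _ = - 72 * D a * E ^+ 3 - 27 * a * (8 * D E) * E ^+ 2
    + 3 * (9 * Y - X - 8) * a * E ^+ 3); last by ring.
  by rewrite DE; ring.
have DE3 : 72 * D (- 2 * E ^+ 3) = - 54 * (Y - 1) * E ^+ 3.
  rewrite mulNr raddfN /= D_natM DX [LHS](_ : _ = - 54 * (8 * D E) * E ^+ 2); last by ring.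
  by rewrite DE; ring.
rewrite DE3 [c * _]mulrDr cDV cV in H.
apply: (@fps_natI _ 5).
rewrite [LHS](_ : _ = - (a * (- 54 * (Y - 1) * E ^+ 3 + 27 * (- 2 * E ^+ 3))
   + -2 * (-72 * D a * E ^+ 3 - 27 * a * (Y - 1) * E ^+ 3
   + 3 * (9 * Y - X - 8) * a * E ^+ 3 + -3 * a * E ^+ 3))); last by ring.
by rewrite -H; ring.
Qed.

End RealSeries.

(** * The cusp forms in terms of theta functions *)

Section Identities.
Variable R : realType.
Local Notation e := (euler R).
Local Notation E := (sub3 e).
Local Notation a := (theta_a R).
Local Notation b := (theta_b3 R).
Local Notation p := (D a).
Local Notation X := (eis2 R).
Local Notation Y := (sub3 X).
Local Notation Q := (eis4 R).

Let XE : X = 3 * Y - 2 * a ^+ 2.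
Proof. by rewrite theta_a_squareR; ring. Qed.

Let DXE : D X = 3 * D Y - 4 * a * p.
Proof.
have := congr1 (@D R) (theta_a_squareR R); rewrite raddfB /= !D_natM DX => H.
by rewrite [RHS](_ : _ = 3 * D Y - 2 * (2 * p * a ^+ 1)); [rewrite H; ring|ring].
Qed.

Let DYE : 12 * D Y = 8 * a * p + 3 * Y ^+ 2 - 2 * a ^+ 2 * Y - a ^+ 4.
Proof.
apply: (@fps_natI _ 11); have := theta_a_fourthR R; rewrite DXE.
move: XE; move: (a) (X) (Y) (D a) (D Y) => z x y q dy -> H.
rewrite [LHS](_ : _ = (72 * (3 * dy - 4 * z * q) + 3 * (3 * y - 2 * z ^+ 2) ^+ 2)
  - 72 * dy + 288 * z * q - 3 * (3 * y - 2 * z ^+ 2) ^+ 2); last by ring.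
by rewrite H; ring.
Qed.

Let bE : 4 * b = 3 * a * Y + a ^+ 3 - 12 * p.
Proof.
apply: (@fps_natI _ 1); rewrite mulrA [LHS](_ : _ = 8 * b); last by ring.
by rewrite theta_b3E; move: XE; move: (a) (X) (Y) (p) => z x y q ->; ring.
Qed.

(** The equations of Ramanujan in q and q^3 express both Eisenstein series of weight 4
    through X, Y and their derivatives, which are known from [theta_a_squareR] and
    [theta_a_fourthR]. *)
Lemma eis4_sum : Q + 9 * sub3 Q = 10 * a ^+ 4.
Proof.
have := D_eis2 R; have := D_sub3_eis2 R; rewrite DXE; move: DYE XE.
move: (a) (X) (Y) (Q) (sub3 Q) (p) (D Y) => z x y q q3 t dy E1 -> E2 E3.
rewrite [LHS](_ : _ = (3 * y - 2 * z ^+ 2) ^+ 2 + 9 * y ^+ 2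
  - ((3 * y - 2 * z ^+ 2) ^+ 2 - q) - 9 * (y ^+ 2 - q3)); last by ring.
rewrite -E3 -E2 [LHS](_ : _ = (3 * y - 2 * z ^+ 2) ^+ 2 + 9 * y ^+ 2 + 48 * z * t
  - 6 * (12 * dy)); last by ring.
by rewrite E1; ring.
Qed.

Lemma eis4_diff : 9 * (Q - sub3 Q) = 80 * a * (a ^+ 3 - b).
Proof.
have := D_eis2 R; have := D_sub3_eis2 R; rewrite DXE; move: DYE XE bE.
move: (b) (a) (X) (Y) (Q) (sub3 Q) (p) (D Y) => u z x y q q3 t dy E1 -> E4 E2 E3.
rewrite [LHS](_ : _ = 9 * ((3 * y - 2 * z ^+ 2) ^+ 2 - y ^+ 2)
  - 9 * ((3 * y - 2 * z ^+ 2) ^+ 2 - q) + 9 * (y ^+ 2 - q3)); last by ring.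
rewrite -E3 -E2 [LHS](_ : _ = 9 * ((3 * y - 2 * z ^+ 2) ^+ 2 - y ^+ 2)
  + 432 * z * t - 24 * (12 * dy)); last by ring.
rewrite E1 [RHS](_ : _ = 80 * z ^+ 4 - 20 * z * (4 * u)); last by ring.
by rewrite E4; ring.
Qed.

Lemma D_theta_b3 : 8 * D b = 3 * (X - Y) * b.
Proof.
apply: (fps_mulfI (fpsX_neq0 3 (sub3_euler_neq0 R))).
have := congr1 (@D R) (theta_b3_euler R); rewrite DM !DX => H.
have E1 := D_eulerE R; have E2 := D_sub3_eulerE R; have E3 := theta_b3_euler R.
rewrite [LHS](_ : _ = 8 * (D b * E ^+ 3 + b * (3%:R * D E * E ^+ 2))
  - 3 * b * E ^+ 2 * (8 * D E)); last by ring.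
rewrite H E2 [LHS](_ : _ = 3 * e ^+ 8 * (24 * D e) - 3 * (Y - 1) * (b * E ^+ 3)); last by ring.
rewrite E1 [RHS](_ : _ = 3 * (X - Y) * (b * E ^+ 3)); last by ring.
by rewrite E3; ring.
Qed.

(** Differentiating the formula that defines b gives D (D a), since D b is known from its
    product. *)
Lemma rankin_cohen_b3 : 9 * (a * D p - 2 * p ^+ 2) = 2 * b * (a ^+ 3 - b).
Proof.
have H1 : 24 * D p = 24 * p * Y - 8 * a ^+ 2 * p - 3 * a * Y ^+ 2 + 2 * a ^+ 3 * Y + a ^+ 5.
  apply: (@fps_natI _ 1).
  have DZ : D (9 * Y - X) = 9 * D Y - D X by rewrite raddfB /= D_natM.
  have := congr1 (@D R) (theta_b3E R); rewrite raddfB /= !D_natM [D (a * _)]DM DZ DXE.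
  rewrite D_theta_b3; move: DYE XE bE.
  move: (b) (a) (X) (Y) (p) (D p) (D Y) => u z x y t pp dy E1 -> E2 E3.
  rewrite [LHS](_ : _ = 2 * (t * (9 * y - (3 * y - 2 * z ^+ 2)) + z * (9 * dy
     - (3 * dy - 4 * z * t))) - 2 * (t * (9 * y - (3 * y - 2 * z ^+ 2)) + z * (9 * dy
     - (3 * dy - 4 * z * t)) - 24 * pp)); last by ring.
  rewrite -E3 [LHS](_ : _ = 12 * t * y + 4 * t * z ^+ 2 + z * (12 * dy) + 8 * z ^+ 2 * t
    - 3 * (y - z ^+ 2) * (4 * u)); last by ring.
  by rewrite E1 E2; ring.
apply: (@fps_natI _ 7); move: bE H1; move: (b) (a) (Y) (p) (D p) => u z y t pp E2 E1.
rewrite [LHS](_ : _ = 3 * z * (24 * pp) - 144 * t ^+ 2); last by ring.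
rewrite [RHS](_ : _ = (4 * u) * (4 * z ^+ 3 - 4 * u)); last by ring.
by rewrite E1 E2; ring.
Qed.

Lemma fpsM1 (f g : fps R) : (f * g) 1%N = f 0%N * g 1%N + f 1%N * g 0%N.
Proof. by rewrite fpsM !big_ord_recl big_ord0 addr0 /= subn0 subnn. Qed.

Lemma fpsX1 (f : fps R) n : f 0%N = 1 -> (f ^+ n) 1%N = n%:R * f 1%N.
Proof.
move=> f0; elim: n => [|n IHn]; first by rewrite mul0r.
by rewrite exprS fpsM1 fpsX0 f0 expr1n IHn mul1r mulr1 -natr1 mulrDl mul1r.
Qed.

Lemma theta_a0 : a 0%N = 1.
Proof.
rewrite /theta_a /gs (_ : [set x | qf x == 0%N] = [set (0, 0)]) ?fsbig_set1//.
apply/seteqP; split=> -[x y] /= => [/eqP qxy|[-> ->]//].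
have q0 : x ^+ 2 + x * y + y ^+ 2 = 0 by have := qfE (x, y); rewrite qxy /= => <-.
have x0 : 0 <= x ^+ 2 by exact: sqr_ge0.
have y0 : 0 <= y ^+ 2 by exact: sqr_ge0.
have s0 : 0 <= (x + y) ^+ 2 by exact: sqr_ge0.
have xx : x ^+ 2 + y ^+ 2 + (x + y) ^+ 2 = 0 by rewrite [LHS](_ : _ = 2 * (x ^+ 2 + x * y + y ^+ 2)); [rewrite q0 mulr0|ring].
have : x ^+ 2 == 0 by apply/eqP; lia.
have : y ^+ 2 == 0 by apply/eqP; lia.
by rewrite !sqrf_eq0 => /eqP -> /eqP ->.
Qed.

Lemma eis2_0 : X 0%N = 1.
Proof. by rewrite /eis2 fpsD fpsN fpsM0 fps1 [X in _ * X]/sigma /= mulr0 subr0. Qed.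

Lemma eis2_1 : X 1%N = - 24.
Proof.
rewrite /eis2 fpsD fpsN fps_natM fps1 /sigma /= big_cons big_nil; ring.
Qed.

Lemma theta_a1 : a 1%N = 6.
Proof.
have := congr1 (fun f : fps R => f 1%N) (theta_a_squareR R).
rewrite fps_natM fpsX1 ?theta_a0// fpsD fpsN fps_natM eis2_1 /sub3 /= => H.
apply: (@mulfI _ 4); first by rewrite pnatr_eq0.
rewrite [LHS](_ : _ = 2 * (2 * a 1%N)); last by ring.
by rewrite H; ring.
Qed.

Lemma euler1 : e 1%N = - 1.
Proof.
have := congr1 (fun f : fps R => f 1%N) (D_eulerE R).
rewrite fps_natM DE fpsM1 fpsD fpsN fps1 fpsD fpsN fps1 eis2_0 eis2_1 euler0 /= => H.
apply: (@mulfI _ 24); first by rewrite pnatr_eq0.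
by rewrite -[e 1%N]mul1r H; ring.
Qed.

(** Jacobi's identity a^3 = b^3 + c^3 for the cubic theta functions, b^3 being
    [theta_b3] and c^3 being 27 q E^9 / e^3. After
    multiplication by E^3 both sides have, by the relations above, the logarithmic
    derivative (3 Y - 1) / 2, which determines them up to the coefficient of q. *)
Lemma cubic_jacobi : (a ^+ 3 - b) * e ^+ 3 = 27 * Xq * E ^+ 9.
Proof.
apply: (fps_mulfI (fpsX_neq0 3 (sub3_euler_neq0 R))).
apply/eqP; rewrite -subr_eq0; apply/eqP.
rewrite [LHS](_ : _ = a ^+ 3 * e ^+ 3 * E ^+ 3 - (b * E ^+ 3) * e ^+ 3
   - 27 * Xq * E ^+ 12); last by ring.
rewrite theta_b3_euler.
have -> : a ^+ 3 * e ^+ 3 * E ^+ 3 - e ^+ 9 * e ^+ 3 - 27 * Xq * E ^+ 12 =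
  a ^+ 3 * (e ^+ 3 * E ^+ 3) - e ^+ 12 - 27 * (Xq * E ^+ 12) by ring.
have cY : Y 0%N = 1 by rewrite /sub3 /= eis2_0.
have E0 : E 0%N = 1 by exact: sub3_euler0.
apply: (@fps_ode0 _ (fpsC (2^-1) * (3 * Y - 1)) _ 1%N).
- by rewrite fpsCM fpsD fpsN fps_natM fps1 cY /=; field.
- rewrite fpsD fpsN fpsD fpsN fpsM1 !fps_natM !fpsM1 !fpsX1 ?theta_a0 ?euler0 ?E0//.
  rewrite !fpsX0 theta_a0 euler0 E0 !expr1n fpsM0 !fpsX0 euler0 E0 !expr1n.
  by rewrite theta_a1 euler1 /Xq /sub3 /=; ring.
- apply: (@fps_natI _ 7); rewrite [RHS]mulrA.
  have -> : 8%:R * (fpsC 2^-1 * (3 * Y - 1)) = 4 * (3 * Y - 1) :> fps R.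
    rewrite mulrA (_ : 8%:R * fpsC 2^-1 = 4)//.
    rewrite -[8%:R](rmorph_nat (@fpsC R)) -rmorphM (_ : 8%:R * 2^-1 = 4%:R) ?rmorph_nat//.
    by field.
  rewrite [D _](_ : _ = D (a ^+ 3 * (e ^+ 3 * E ^+ 3)) - D (e ^+ 12) - D (27 * (Xq * E ^+ 12)));
    last by rewrite !raddfB.
  rewrite D_natM [D (a ^+ 3 * _)]DM [D (e ^+ 3 * _)]DM [D (Xq * _)]DM !DX DXq.
  have E1 := D_eulerE R; have E2 := D_sub3_eulerE R; have E3 := theta_b3_euler R.
  have E4 := theta_b3E R; have E5 := theta_a_squareR R.
  rewrite [LHS](_ : _ = a ^+ 2 * e ^+ 3 * E ^+ 3 * (24 * p)
    + a ^+ 3 * e ^+ 2 * E ^+ 3 * (24 * D e) + 3 * a ^+ 3 * e ^+ 3 * E ^+ 2 * (8 * D E)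
    - 4 * e ^+ 11 * (24 * D e) - 27 * (8 * Xq * E ^+ 12 + 12 * Xq * E ^+ 11 * (8 * D E)));
    last by ring.
  rewrite E1 E2 (_ : 24 * p = a * (9 * Y - X) - 8 * b); last by rewrite E4; ring.
  rewrite [LHS](_ : _ = a ^+ 3 * e ^+ 3 * E ^+ 3 * (12 * Y - 4)
    - 4 * (2 * a ^+ 2) * e ^+ 3 * (b * E ^+ 3) - 4 * (X - 1) * e ^+ 12
    - 27 * Xq * E ^+ 12 * (12 * Y - 4)); last by ring.
  by rewrite E3 E5; ring.
Qed.

Lemma theta_b3c3 : b * (a ^+ 3 - b) = 27 * Xq * e ^+ 6 * E ^+ 6.
Proof.
apply: (fps_mulfI (fpsX_neq0 3 (euler_neq0 R))).
apply: (fps_mulfI (fpsX_neq0 3 (sub3_euler_neq0 R))).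
rewrite [LHS](_ : _ = (b * E ^+ 3) * ((a ^+ 3 - b) * e ^+ 3)); last by ring.
by rewrite theta_b3_euler cubic_jacobi; ring.
Qed.

(** Half of the second Rankin-Cohen bracket of a, of weight one, with itself. *)
Definition rankin_cohen : fps R := a * D p - 2 * p ^+ 2.
Local Notation G := rankin_cohen.

Lemma delta7_identity : (Q - sub3 Q) * b = 40 * (a * G).
Proof.
apply: (@fps_natI _ 8).
rewrite [LHS](_ : _ = 9 * (Q - sub3 Q) * b); last by ring.
rewrite eis4_diff [LHS](_ : _ = 40 * a * (2 * b * (a ^+ 3 - b))); last by ring.
by rewrite -rankin_cohen_b3 /rankin_cohen; ring.
Qed.

(** With a^3 = b + (a^3 - b), the series a^3 G is a sum of two eta products. *)
Lemma delta9_identity :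
  6 * (27 * (Xq ^+ 2 * e ^+ 3 * E ^+ 15) + Xq * e ^+ 15 * E ^+ 3) = a ^+ 3 * G.
Proof.
apply: (@fps_natI _ 8); rewrite [RHS](_ : _ = a ^+ 3 * (9 * G)); last by ring.
rewrite /rankin_cohen rankin_cohen_b3 [RHS](_ : _ = 2 * (b * (a ^+ 3 - b)) * b
  + 2 * (b * (a ^+ 3 - b)) * (a ^+ 3 - b)); last by ring.
rewrite theta_b3c3 [RHS](_ : _ = 54 * Xq * e ^+ 6 * E ^+ 3 * (b * E ^+ 3)
  + 54 * Xq * e ^+ 3 * E ^+ 6 * ((a ^+ 3 - b) * e ^+ 3)); last by ring.
by rewrite theta_b3_euler cubic_jacobi; ring.
Qed.

Lemma delta11_identity : (Q + 9 * sub3 Q) * ((Q - sub3 Q) * b) = 400 * (a ^+ 5 * G).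
Proof. by rewrite eis4_sum delta7_identity; ring. Qed.

End Identities.

(** * Sums over representations *)

Section PairTuple.
Variable k : nat.

Definition pair_tuple (p : (int * int) * (2 * k).-tuple int) : (2 * k.+1).-tuple int :=
  tcast (esym (mulnS 2 k)) [tuple of p.1.1 :: p.1.2 :: p.2].

Definition tuple_pair (x : (2 * k.+1).-tuple int) : (int * int) * (2 * k).-tuple int :=
  ((x`_0, x`_1), [tuple of behead [tuple of behead (tcast (mulnS 2 k) x)]]).

Lemma pair_tupleK : cancel pair_tuple tuple_pair.
Proof.
case=> -[u v] t; rewrite /tuple_pair /pair_tuple; congr ((_, _), _).
- by rewrite val_tcast.
- by rewrite val_tcast.
- by apply: val_inj; rewrite /= tcastKV.
Qed.

Lemma tuple_pairK : cancel tuple_pair pair_tuple.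
Proof.
move=> x; apply: val_inj; rewrite -[LHS]/(tval _) -[RHS]/(tval _) /pair_tuple val_tcast /= val_tcast.
have : size x = (2 * k).+2 by rewrite size_tuple mulnS.
by case: (tval x) => [|u [|v s]].
Qed.

Lemma F_pair_tuple p : F (pair_tuple p) = (qf p.1)%:Z + F p.2.
Proof.
rewrite /F big_ord_recl qfE; congr (_ + _); first by rewrite /pair_tuple val_tcast.
apply: eq_bigr => i _; rewrite /pair_tuple val_tcast.
by rewrite (_ : 2 * lift ord0 i = (2 * i).+2)%N//= /bump; lia.
Qed.

End PairTuple.

Definition form_size k (x : (2 * k).-tuple int) : nat := absz (F x).

Lemma form_sizeE k (x : (2 * k).-tuple int) : (form_size x)%:Z = F x.
Proof.
suff F0 : 0 <= F x by rewrite /form_size gez0_abs.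
by apply: sumr_ge0 => i _; rewrite -(qfE (x`_(2 * i), x`_(2 * i).+1)).
Qed.

Lemma form_size_pair k p : form_size (pair_tuple p) = (qf p.1 + @form_size k p.2)%N.
Proof. by have := F_pair_tuple p; rewrite -!form_sizeE; lia. Qed.

Lemma form_size0 (x : (2 * 0).-tuple int) : form_size x = 0%N.
Proof. by rewrite /form_size /F big_ord0. Qed.

Lemma finite_form k : finite_sizes (@form_size k).
Proof.
elim: k => [|k IHk].
  by move=> n; exists [:: [tuple]] => x _; rewrite inE; apply/eqP/val_inj; rewrite /= (tuple0 x).
move=> n; have [s sP] := finite_sizes_prod finite_qf IHk n.
exists [seq pair_tuple p | p <- s] => x xn; apply/mapP; exists (tuple_pair x); last first.
  by rewrite tuple_pairK.
by apply: sP; rewrite -form_size_pair tuple_pairK.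
Qed.

Section RepresentationSums.
Variable R : realType.
Local Notation a := (theta_a R).
Local Notation G := (rankin_cohen R).

Lemma gs_form k : gs (@form_size k) (fun=> 1) = a ^+ k.
Proof.
elim: k => [|k IHk].
  apply/funext => n; rewrite (@gs_seq _ _ _ _ [:: [tuple]])// => [|x _]; last first.
    by rewrite inE; apply/eqP/val_inj; rewrite /= (tuple0 x).
  by rewrite expr0 big_cons big_nil form_size0 fps1 eq_sym; case: eqP; rewrite ?addr0.
rewrite exprS -IHk (gs_mul _ _ finite_qf (@finite_form k)).
rewrite (gs_bij _ (@pair_tupleK k) (@tuple_pairK k) (N := fun p => qf p.1 + form_size p.2)%N).
  by apply: eq_gs => p /=; rewrite mulr1.
exact: form_size_pair.
Qed.

(** The form in 2 (k + 1) variables is the sum of the binary form of the first pair and of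
    the form of the others. *)
Lemma gs_form_head k (w : int -> R) :
  gs (@form_size k.+1) (fun x => w x`_0) = gs qf (fun p => w p.1) * a ^+ k.
Proof.
rewrite -gs_form (gs_mul _ _ finite_qf (@finite_form k)).
rewrite (gs_bij _ (@pair_tupleK k) (@tuple_pairK k) (N := fun p => qf p.1 + form_size p.2)%N).
  by apply: eq_gs => p /=; rewrite mulr1 /pair_tuple val_tcast.
exact: form_size_pair.
Qed.

Lemma representation_sum k n (w : int -> int) :
  (\sum_(x \in representations k.+1 n) w x`_0)%:~R =
  (gs qf (fun p => (w p.1)%:~R) * a ^+ k) n :> R.
Proof.
rewrite -(gs_form_head k (fun i => (w i)%:~R)).
have [s us sP] := finite_sizes_uniq n (@finite_form k.+1).
rewrite (gs_seq _ us sP) -(rmorph_sum intr) (bigfs _ us); last first.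
  by move=> x /eqP xn xs; case/negP: xs; apply: sP; rewrite xn.
congr (_%:~R); apply: eq_fsbigl; apply/seteqP; split=> x; rewrite /representations /= -form_sizeE.
  by move=> [xn]; rewrite unfold_in xn.
by rewrite unfold_in => /eqP ->.
Qed.

Definition theta_moment p : fps R := gs qf (fun x => x.1%:~R ^+ p).

(** The maps (x, y) -> (y, x) and (x, y) -> (x + y, - y) preserve the form. This
    averaging is useful since x^2 + y^2 + (x + y)^2 and x^4 + y^4 + (x + y)^4 are twice
    the form and twice its square. *)
Lemma theta_moment_sum p : 3 * theta_moment p =
  gs qf (fun x => x.1%:~R ^+ p + x.2%:~R ^+ p + (x.1 + x.2)%:~R ^+ p).
Proof.
rewrite !gsD; try exact: finite_qf.
have -> : gs qf (fun x => x.2%:~R ^+ p : R) = theta_moment p.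
  rewrite (gs_bij (h := fun x => (x.2, x.1)) (h' := fun x => (x.2, x.1)) (N := qf)) => [|[]|[]|x]//.
  by have := qfE x; have := qfE (x.2, x.1); rewrite /=; nia.
have -> : gs qf (fun x => (x.1 + x.2)%:~R ^+ p : R) = theta_moment p.
  rewrite (gs_bij (h := fun x => (x.1 + x.2, - x.2)) (h' := fun x => (x.1 + x.2, - x.2)) (N := qf)).
  - by apply: eq_gs => x /=; rewrite addrK.
  - by case=> x y /=; congr (_, _); ring.
  - by case=> x y /=; congr (_, _); ring.
  - by move=> x; have := qfE x; have := qfE (x.1 + x.2, - x.2); rewrite /=; nia.
by rewrite -/(theta_moment p); ring.
Qed.

Lemma natr_qf x : (qf x)%:R = x.1%:~R ^+ 2 + x.1%:~R * x.2%:~R + x.2%:~R ^+ 2 :> R.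
Proof. by rewrite pmulrn qfE !rmorphD rmorphM !rmorphXn. Qed.

Lemma theta_moment2 : 3 * theta_moment 2 = 2 * D a.
Proof.
rewrite theta_moment_sum D_gs; last exact: finite_qf.
rewrite -gsZn; last exact: finite_qf.
by apply: eq_gs => x; rewrite natr_qf rmorphD /=; ring.
Qed.

Lemma theta_moment4 : 3 * theta_moment 4 = 2 * D (D a).
Proof.
rewrite theta_moment_sum !D_gs; try exact: finite_qf.
rewrite -gsZn; last exact: finite_qf.
by apply: eq_gs => x; rewrite natr_qf rmorphD /=; ring.
Qed.

Lemma representation_sum_quartic k n (A B C : nat) :
  (\sum_(x \in representations k.+1 n)
     (A%:Z * x`_0 ^+ 4 - B%:Z * n%:Z * x`_0 ^+ 2 + C%:Z * n%:Z ^+ 2))%:~R =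
  (A%:R * (theta_moment 4 * a ^+ k) - B%:R * D (theta_moment 2 * a ^+ k)
     + C%:R * D (D (a ^+ k.+1))) n :> R.
Proof.
rewrite (representation_sum k n (fun i => A%:Z * i ^+ 4 - B%:Z * n%:Z * i ^+ 2 + C%:Z * n%:Z ^+ 2)).
have -> : gs qf (fun p => (A%:Z * p.1 ^+ 4 - B%:Z * n%:Z * p.1 ^+ 2 + C%:Z * n%:Z ^+ 2)%:~R) =
    A%:R * theta_moment 4 - fpsC (B%:R * n%:R) * theta_moment 2 + fpsC (C%:R * n%:R ^+ 2) * a.
  rewrite -gsZn; last exact: finite_qf.
  rewrite -!gsZ; try exact: finite_qf.
  rewrite -gsN; last exact: finite_qf.
  rewrite -!gsD; try exact: finite_qf.
  apply: eq_gs => x; rewrite !(rmorphD, rmorphB, rmorphM, rmorphXn) /= mulr1.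
  by rewrite rmorphN !rmorphM /= -!pmulrn; ring.
rewrite !mulrDl mulNr -!mulrA -exprS !fpsD !fpsN !fpsCM !fps_natM !DE.
ring.
Qed.

(** The bracket appears when the two coefficients on the right are in the ratio
    1 : - 2, which is what the weights A, B, C are chosen for. *)
Lemma quartic_bracket k (A B C : nat) :
  3 * (A%:R * (theta_moment 4 * a ^+ k.+1) - B%:R * D (theta_moment 2 * a ^+ k.+1)
     + C%:R * D (D (a ^+ k.+2))) =
  (2 * A%:R - 2 * B%:R + 3 * C%:R * k.+2%:R) * (D (D a) * a ^+ k.+1)
  + (3 * C%:R * k.+2%:R * k.+1%:R - 2 * B%:R * k.+1%:R) * (D a ^+ 2 * a ^+ k).
Proof.
have E : D (D a * a ^+ k.+1) = D (D a) * a ^+ k.+1 + k.+1%:R * (D a ^+ 2 * a ^+ k).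
  by rewrite DM DX; move: (a ^+ _) (a ^+ _) => u v; ring.
rewrite DX -mulrA D_natM E.
have -> : 3 * (A%:R * (theta_moment 4 * a ^+ k.+1) - B%:R * D (theta_moment 2 * a ^+ k.+1)
    + C%:R * (k.+2%:R * (D (D a) * a ^+ k.+1 + k.+1%:R * (D a ^+ 2 * a ^+ k)))) =
  A%:R * ((3 * theta_moment 4) * a ^+ k.+1) - B%:R * D ((3 * theta_moment 2) * a ^+ k.+1)
  + 3 * (C%:R * (k.+2%:R * (D (D a) * a ^+ k.+1 + k.+1%:R * (D a ^+ 2 * a ^+ k)))).
  rewrite -[3 * theta_moment 2 * _]mulrA D_natM; move: (a ^+ _) (a ^+ _) => u v; ring.
rewrite theta_moment4 theta_moment2 -[2 * D a * _]mulrA D_natM E.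
move: (a ^+ _) (a ^+ _) => u v; ring.
Qed.

Lemma representation_sum3 n : (\sum_(x \in representations 3 n)
    (15 * x`_0 ^+ 4 - 12 * n%:Z * x`_0 ^+ 2 + n%:Z ^+ 2))%:~R = 5 * (a * G) n :> R.
Proof.
have := representation_sum_quartic 2 n 15 12 1.
rewrite (eq_fsbigr (fun x : (2 * 3).-tuple int => 15 * x`_0 ^+ 4 - 12 * n%:Z * x`_0 ^+ 2 + n%:Z ^+ 2));
  last by move=> x _; rewrite mul1r.
move=> ->; rewrite -fps_natM; congr (_ n); apply: (@fps_natI _ 2).
by rewrite quartic_bracket /rankin_cohen; ring.
Qed.

Lemma representation_sum5 n : (\sum_(x \in representations 5 n)
    (63 * x`_0 ^+ 4 - 36 * n%:Z * x`_0 ^+ 2 + 2 * n%:Z ^+ 2))%:~R = 28 * (a ^+ 3 * G) n :> R.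
Proof.
rewrite (representation_sum_quartic 4 n 63 36 2) -fps_natM; congr (_ n); apply: (@fps_natI _ 2).
by rewrite quartic_bracket /rankin_cohen; ring.
Qed.

Lemma representation_sum7 n : (\sum_(x \in representations 7 n)
    (54 * x`_0 ^+ 4 - 24 * n%:Z * x`_0 ^+ 2 + n%:Z ^+ 2))%:~R = 27 * (a ^+ 5 * G) n :> R.
Proof.
have := representation_sum_quartic 6 n 54 24 1.
rewrite (eq_fsbigr (fun x : (2 * 7).-tuple int => 54 * x`_0 ^+ 4 - 24 * n%:Z * x`_0 ^+ 2 + n%:Z ^+ 2));
  last by move=> x _; rewrite mul1r.
move=> ->; rewrite -fps_natM; congr (_ n); apply: (@fps_natI _ 2).
by rewrite quartic_bracket /rankin_cohen; ring.
Qed.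

End RepresentationSums.

(** * Evaluation of power series on the interval ]0, 1[ *)

Section Evaluation.
Variable R : realType.
Implicit Types (f g : fps R) (x : R).

Definition psum f x : R^nat := fun N => \sum_(0 <= n < N) f n * x ^+ n.

Definition fps_abs f : fps R := fun n => `|f n|.

Lemma fps_abs_ge0 f n : 0 <= fps_abs f n.
Proof. exact: normr_ge0. Qed.
Local Hint Resolve fps_abs_ge0 : core.

(** Absolute convergence on the whole of ]0, 1[. *)
Definition summable f :=
  forall x, 0 < x < 1 -> exists C, forall N, psum (fps_abs f) x N <= C.

Definition ev f x : R := limn (psum f x).

Lemma psumS f x N : psum f x N.+1 = psum f x N + f N * x ^+ N.
Proof. by rewrite /psum big_nat_recr. Qed.

Lemma psum_abs_ge0 f x N : 0 <= x -> 0 <= psum (fps_abs f) x N.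
Proof. by move=> x0; apply: sumr_ge0 => i _; rewrite mulr_ge0 ?exprn_ge0. Qed.

Lemma psum_abs_nd f x : 0 <= x -> nondecreasing_seq (psum (fps_abs f) x).
Proof.
move=> x0; apply/nondecreasing_seqP => n; rewrite psumS lerDl.
by rewrite mulr_ge0 ?exprn_ge0.
Qed.

Lemma psum_abs_cvg f x : summable f -> 0 < x < 1 -> cvgn (psum (fps_abs f) x).
Proof.
move=> sf x01; have [C CP] := sf x x01; apply: nondecreasing_is_cvgn.
  by apply: psum_abs_nd; case/andP: x01 => /ltW.
by exists C => _ [n _ <-].
Qed.

Lemma psum_cvg f x : summable f -> 0 < x < 1 -> psum f x @ \oo --> ev f x.
Proof.
move=> sf x01; suff : cvgn (psum f x) by [].
have -> : psum f x = series (fun n => f n * x ^+ n) by [].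
apply: normed_cvg; rewrite (_ : [normed series _] = psum (fps_abs f) x).
  exact: psum_abs_cvg.
apply/funext => N; apply: eq_bigr => n _.
by case/andP: x01 => x0 _; rewrite /= normrM (ger0_norm (exprn_ge0 n (ltW x0))).
Qed.

Lemma evE f x v : psum f x @ \oo --> v -> ev f x = v.
Proof. exact: cvg_lim. Qed.

(** ** Stability of summability *)

Lemma summable_le f g : (forall n, `|f n| <= `|g n|) -> summable g -> summable f.
Proof.
move=> fg sg x x01; have [C CP] := sg x x01; exists C => N; apply: le_trans (CP N).
apply: ler_sum => n _; rewrite ler_wpM2r ?fg//.
by rewrite exprn_ge0//; case/andP: x01 => /ltW.
Qed.

Lemma summableD f g : summable f -> summable g -> summable (f + g).
Proof.
move=> sf sg x x01; have [C CP] := sf x x01; have [B BP] := sg x x01.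
exists (C + B) => N; apply: le_trans (lerD (CP N) (BP N)).
rewrite /psum -big_split; apply: ler_sum => n _ /=; rewrite -mulrDl.
rewrite ler_wpM2r ?ler_normD//.
by rewrite exprn_ge0//; case/andP: x01 => /ltW.
Qed.

Lemma summableN f : summable f -> summable (- f).
Proof. by apply: summable_le => n; rewrite fpsN normrN. Qed.

Lemma summableB f g : summable f -> summable g -> summable (f - g).
Proof. by move=> sf sg; apply: summableD => //; exact: summableN. Qed.

Lemma psum_mul f g x N :
  psum (f * g) x N = \sum_(0 <= i < N) f i * x ^+ i * psum g x (N - i)%N.
Proof.
elim: N => [|N IHN]; first by rewrite /psum !big_geq.
rewrite psumS IHN [RHS]big_nat_recr//= subSnn.
have -> : \sum_(0 <= i < N) f i * x ^+ i * psum g x (N.+1 - i)%N =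
    \sum_(0 <= i < N) (f i * x ^+ i * psum g x (N - i)%N + f i * g (N - i)%N * x ^+ N).
  apply: eq_big_nat => i /andP[_ iN]; rewrite subSn 1?ltnW// psumS.
  have -> : x ^+ N = x ^+ i * x ^+ (N - i) by rewrite -exprD subnKC// ltnW.
  by move: (x ^+ i) (x ^+ (N - i)) => u v; ring.
rewrite big_split /= -addrA; congr (_ + _).
rewrite fpsM -(big_mkord xpredT (fun i => f i * g (N - i)%N)) big_nat_recr//= mulrDl mulr_suml.
congr (_ + _); rewrite subnn /psum big_nat1; ring.
Qed.

(** A square of indices lies between two triangles, here and in the next lemma. *)
Lemma psum_abs_mul f g x N : 0 <= x ->
  psum (fps_abs f * fps_abs g) x N <= psum (fps_abs f) x N * psum (fps_abs g) x N.
Proof.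
move=> x0; rewrite psum_mul [X in _ <= X * _]/psum mulr_suml.
apply: ler_sum_nat => i /andP[_ iN]; rewrite ler_wpM2l ?mulr_ge0 ?exprn_ge0//.
by apply: psum_abs_nd => //; exact: leq_subr.
Qed.

Lemma psum_abs_mul2 f g x N : 0 <= x ->
  psum (fps_abs f) x N * psum (fps_abs g) x N <=
  psum (fps_abs f * fps_abs g) x (N + N)%N.
Proof.
move=> x0; rewrite psum_mul (big_cat_nat (n := N)) ?leq_addr//=.
rewrite -[leLHS]addr0 lerD//; last first.
  apply: sumr_ge0 => i _; rewrite !mulr_ge0 ?exprn_ge0//; exact: psum_abs_ge0.
rewrite [X in X * _ <= _]/psum mulr_suml.
apply: ler_sum_nat => i /andP[_ iN]; rewrite ler_wpM2l ?mulr_ge0 ?exprn_ge0//.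
by apply: psum_abs_nd => //; rewrite -addnBA ?leq_addr// ltnW.
Qed.

Lemma summable_mul_abs f g : summable f -> summable g -> summable (fps_abs f * fps_abs g).
Proof.
move=> sf sg x x01; have [C CP] := sf x x01; have [B BP] := sg x x01.
have x0 : 0 <= x by case/andP: x01 => /ltW.
exists (C * B) => N; rewrite (_ : fps_abs _ = fps_abs f * fps_abs g); last first.
  apply/funext => n; rewrite /fps_abs ger0_norm// fpsM; apply: sumr_ge0 => i _.
  exact: mulr_ge0.
apply: le_trans (psum_abs_mul f g N x0) _.
by rewrite ler_pM ?psum_abs_ge0.
Qed.

Lemma summableM f g : summable f -> summable g -> summable (f * g).
Proof.
move=> sf sg; apply: summable_le (summable_mul_abs sf sg) => n.
rewrite [leRHS]ger0_norm; last by rewrite fpsM; apply: sumr_ge0 => i _; exact: mulr_ge0.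
rewrite !fpsM; apply: le_trans (ler_norm_sum _ _ _) _.
by apply: ler_sum => i _; rewrite normrM.
Qed.

Lemma summable_finite f N : (forall n, (N <= n)%N -> f n = 0) -> summable f.
Proof.
move=> f0 x /andP[/ltW x0 _]; exists (psum (fps_abs f) x N) => M.
have [MN|NM] := leqP M N; first exact: psum_abs_nd.
rewrite /psum (big_cat_nat (n := N)) ?(ltnW NM)//= [X in _ + X]big_nat_cond.
rewrite [X in _ + X]big1 ?addr0// => i /andP[/andP[Ni _] _].
by rewrite /fps_abs f0// normr0 mul0r.
Qed.

Lemma summable1 : summable 1.
Proof. by apply: (@summable_finite _ 1) => n n0; rewrite fps1 gtn_eqF. Qed.

Lemma summableC k : summable (fpsC k).
Proof. by apply: (@summable_finite _ 1) => -[]. Qed.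

Lemma summable_nat m : summable m%:R.
Proof. by rewrite -(rmorph_nat (@fpsC R)); exact: summableC. Qed.

Lemma summable_Xq : summable Xq.
Proof. by apply: (@summable_finite _ 2) => n n2; rewrite /Xq gtn_eqF. Qed.

Lemma summableX f n : summable f -> summable (f ^+ n).
Proof.
move=> sf; elim: n => [|n IHn]; first exact: summable1.
by rewrite exprS; exact: summableM.
Qed.

(** For x < y < 1, Bernoulli's inequality bounds n x^n by a multiple of y^n. *)
Lemma summableDer f : summable f -> summable (D f).
Proof.
move=> sf x /andP[x0 x1]; pose y := (1 + x) / 2.
have xy : x < y by rewrite /y; lra.
have y01 : 0 < y < 1 by rewrite /y; apply/andP; split; lra.
have [C CP] := sf y y01; exists (C / (y / x - 1)) => N.
have d0 : 0 < y / x - 1 by rewrite subr_gt0 ltr_pdivlMr// mul1r.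
rewrite ler_pdivlMr//; apply: le_trans (CP N); rewrite /psum mulr_suml.
apply: ler_sum => n _; rewrite /fps_abs DE normrM normr_nat.
rewrite [leLHS](_ : _ = `|f n| * (n%:R * x ^+ n * (y / x - 1))); last first.
  by move: (x ^+ n) => u; ring.
rewrite ler_wpM2l//.
have B : 1 + (y / x - 1) *+ n <= (1 + (y / x - 1)) ^+ n.
  elim: n => [|n IHn]; first by rewrite mulr0n addr0.
  rewrite exprS; apply: le_trans (ler_wpM2l _ IHn); last by rewrite addr_ge0// ltW.
  rewrite mulrS; have : 0 <= (y / x - 1) * ((y / x - 1) *+ n).
    by rewrite mulr_ge0 ?mulrn_wge0 ?ltW.
  lra.
have yE : (1 + (y / x - 1)) ^+ n * x ^+ n = y ^+ n.
  by rewrite -exprMn (_ : _ * x = y)//; field; rewrite gt_eqF.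
rewrite -yE; apply: le_trans (ler_wpM2r _ B); last by rewrite exprn_ge0// ltW.
by rewrite -[(y / x - 1) *+ n]mulr_natl mulrDl mul1r mulrAC lerDr exprn_ge0// ltW.
Qed.

Lemma summable_poly f k (c : nat) :
  (forall n, `|f n| <= c%:R * n.+1%:R ^+ k) -> summable f.
Proof.
move=> fk; pose g : fps R := fun n => n.+1%:R ^+ k.
suff sg : summable g.
  apply: summable_le (summableM (summable_nat c) sg) => n.
  by rewrite fps_natM normrM normr_nat [`|g n|]ger0_norm ?exprn_ge0.
rewrite {}/g {f c fk}; elim: k => [|k IHk].
  move=> x /andP[x0 x1]; exists (1 - x)^-1 => N.
  rewrite /psum /fps_abs (eq_bigr (fun n => x ^+ n)) => [|n _]; last first.
    by rewrite expr0 normr1 mul1r.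
  rewrite (_ : \sum_(0 <= i < N) x ^+ i = (1 - x ^+ N) / (1 - x)); last first.
    elim: N => [|N IHN]; first by rewrite big_geq// expr0 subrr mul0r.
    rewrite big_nat_recr//= IHN exprS; field; lra.
  by rewrite -[leRHS]mul1r ler_pM2r ?invr_gt0 ?subr_gt0// gerBl exprn_ge0// ltW.
apply: summable_le (summableD (summableDer IHk) IHk) => n.
rewrite fpsD DE -[X in _ + X]mul1r -mulrDl exprS natr1//.
Qed.

(** ** Evaluation is a ring morphism *)

Lemma ev_finite f x N : (forall n, (N <= n)%N -> f n = 0) -> ev f x = psum f x N.
Proof.
move=> f0; apply: evE; rewrite -(cvg_shiftn N); apply: cvg_near_cst.
apply: nearW => n /=; elim: n => // n IHn.
by rewrite addSn psumS IHn f0 ?leq_addl// mul0r addr0.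
Qed.

Lemma evC k x : ev (fpsC k) x = k.
Proof.
rewrite (@ev_finite _ _ 1); last by case.
by rewrite /psum big_nat1 expr0 mulr1.
Qed.

Lemma ev_nat m x : ev m%:R x = m%:R.
Proof. by rewrite -(rmorph_nat (@fpsC R)) evC. Qed.

Lemma ev1 x : ev 1 x = 1. Proof. exact: (ev_nat 1). Qed.

Lemma evXq x : ev Xq x = x.
Proof.
rewrite (@ev_finite _ _ 2); last by move=> n n2; rewrite /Xq gtn_eqF.
by rewrite /psum !big_nat_recr//= big_geq// /Xq /= mul0r !add0r mul1r expr1.
Qed.

Lemma evD f g x : summable f -> summable g -> 0 < x < 1 ->
  ev (f + g) x = ev f x + ev g x.
Proof.
move=> sf sg x01; apply: evE.
rewrite (_ : psum _ x = psum f x \+ psum g x); last first.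
  by apply/funext => N; rewrite /= /psum -big_split; apply: eq_bigr => n _; rewrite fpsD mulrDl.
by apply: cvgD; exact: psum_cvg.
Qed.

Lemma evN f x : summable f -> 0 < x < 1 -> ev (- f) x = - ev f x.
Proof.
move=> sf x01; apply: evE.
rewrite (_ : psum _ x = - psum f x); last first.
  by apply/funext => N; rewrite fctE /psum -sumrN; apply: eq_bigr => n _; rewrite fpsN mulNr.
by apply: cvgN; exact: psum_cvg.
Qed.

Lemma evB f g x : summable f -> summable g -> 0 < x < 1 ->
  ev (f - g) x = ev f x - ev g x.
Proof. by move=> sf sg x01; rewrite evD ?evN//; exact: summableN. Qed.

(** The difference between the product of the partial sums and the partial sum of
    the product is dominated by the same difference for the absolute values,
    which vanishes in the limit by the two inequalities above. *)
Lemma psum_mul_dist f g x N : 0 <= x ->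
  `|psum f x N * psum g x N - psum (f * g) x N| <=
  psum (fps_abs f) x N * psum (fps_abs g) x N - psum (fps_abs f * fps_abs g) x N.
Proof.
move=> x0; rewrite !psum_mul [psum f x N]/psum [psum (fps_abs f) x N]/psum !mulr_suml -!sumrB.
apply: le_trans (ler_norm_sum _ _ _) _; apply: ler_sum => i _.
rewrite -!mulrBr normrM normrM (ger0_norm (exprn_ge0 i x0)) ler_wpM2l ?mulr_ge0 ?exprn_ge0//.
rewrite /psum (big_cat_nat (n := (N - i)%N) (p := N)) ?leq_subr//= addrAC subrr add0r.
rewrite [X in _ <= X - _](big_cat_nat (n := (N - i)%N)) ?leq_subr//= [leRHS]addrAC subrr add0r.
apply: le_trans (ler_norm_sum _ _ _) _; apply: ler_sum => j _.
by rewrite normrM (ger0_norm (exprn_ge0 j x0)).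
Qed.

Lemma evM f g x : summable f -> summable g -> 0 < x < 1 ->
  ev (f * g) x = ev f x * ev g x.
Proof.
move=> sf sg x01; have x0 : 0 <= x by case/andP: x01 => /ltW.
have cA := psum_abs_cvg sf x01; have cB := psum_abs_cvg sg x01.
have sfg := summable_mul_abs sf sg.
have cC : psum (fps_abs f * fps_abs g) x @ \oo --> ev (fps_abs f * fps_abs g) x.
  exact: psum_cvg.
have cAB : (fun N => psum (fps_abs f) x N * psum (fps_abs g) x N) @ \oo -->
    limn (psum (fps_abs f) x) * limn (psum (fps_abs g) x) by exact: cvgM.
have limE : ev (fps_abs f * fps_abs g) x = limn (psum (fps_abs f) x) * limn (psum (fps_abs g) x).
  apply/eqP; rewrite eq_le; apply/andP; split.
    refine (ler_cvg_to cC cAB _); apply: nearW => N; exact: psum_abs_mul.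
  have cC2 : (fun N => psum (fps_abs f * fps_abs g) x (N + N)%N) @ \oo -->
      ev (fps_abs f * fps_abs g) x.
    apply: cvg_comp cC; apply/cvgnyPge => M; near=> n.
    by apply: leq_trans (leq_addr _ _); near: n; exact: nbhs_infty_ge.
  refine (ler_cvg_to cAB cC2 _); apply: nearW => N; exact: psum_abs_mul2.
rewrite -limE in cAB.
have c0 : (fun N => psum (fps_abs f) x N * psum (fps_abs g) x N -
    psum (fps_abs f * fps_abs g) x N) @ \oo --> (0 : R).
  by rewrite -(subrr (ev (fps_abs f * fps_abs g) x)); exact: cvgB.
have d0 : (fun N => psum f x N * psum g x N - psum (f * g) x N) @ \oo --> (0 : R).
  apply/norm_cvg0P; apply: (squeeze_cvgr _ (cvg_cst 0) c0); apply: nearW => N /=.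
  by rewrite normr_ge0 /=; exact: psum_mul_dist.
apply: evE; rewrite -[ev f x * ev g x]subr0.
rewrite (_ : psum (f * g) x = fun N => psum f x N * psum g x N
  - (psum f x N * psum g x N - psum (f * g) x N)).
  by apply: cvgB => //; apply: cvgM; exact: psum_cvg.
by apply/funext => N; rewrite subKr.
Unshelve. all: by end_near. Qed.

Lemma evX f x n : summable f -> 0 < x < 1 -> ev (f ^+ n) x = ev f x ^+ n.
Proof.
move=> sf x01; elim: n => [|n IHn]; first exact: ev1.
by rewrite !exprS evM// ?IHn//; exact: summableX.
Qed.

Lemma psum_sub3 f x N : psum (sub3 f) x (3 * N)%N = psum f (x ^+ 3) N.
Proof.
elim: N => [|N IHN]; first by rewrite muln0 /psum !big_geq.
rewrite mulnS !addSn add0n !psumS IHN sub3_mul3 exprM.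
have -> : sub3 f (3 * N).+1 = 0 by rewrite /sub3 ifN//; lia.
have -> : sub3 f (3 * N).+2 = 0 by rewrite /sub3 ifN//; lia.
by rewrite !mul0r !addr0.
Qed.

Lemma cube01 x : 0 < x < 1 -> 0 < x ^+ 3 < 1.
Proof. by move=> /andP[x0 x1]; rewrite exprn_gt0// exprn_ilt1// ltW. Qed.

Lemma summable_sub3 f : summable f -> summable (sub3 f).
Proof.
move=> sf x x01; have [C CP] := sf _ (cube01 x01); exists C => N.
have x0 : 0 <= x by case/andP: x01 => /ltW.
apply: le_trans (CP N); rewrite -psum_sub3.
have -> : fps_abs (sub3 f) = sub3 (fps_abs f).
  by apply/funext => n; rewrite /fps_abs /sub3; case: ifP; rewrite ?normr0.
rewrite /psum [leRHS](big_cat_nat (n := N)) ?leq_pmull//= lerDl sumr_ge0// => i _.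
by rewrite mulr_ge0 ?exprn_ge0// /sub3; case: ifP => // _; rewrite /fps_abs.
Qed.

Lemma ev_sub3 f x : summable f -> 0 < x < 1 -> ev (sub3 f) x = ev f (x ^+ 3).
Proof.
move=> sf x01; apply/esym/evE.
have -> : psum f (x ^+ 3) = (fun N => psum (sub3 f) x (3 * N)%N).
  by apply/funext => N; rewrite psum_sub3.
by apply: cvg_comp (psum_cvg (summable_sub3 sf) x01); exact: cvg_mulnl.
Qed.

End Evaluation.

Section Convergence.
Variable R : realType.
Implicit Types x : R.

Lemma summable_gs (T : choiceType) (N : T -> nat) (w : T -> R) (s : nat -> seq T) k c :
    (forall t, `|w t| <= 1) -> (forall n t, (N t <= n)%N -> t \in s n) ->
    (forall n, (size (s n) <= c * n.+1 ^ k)%N) ->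
  summable (gs N w).
Proof.
move=> w1 sP ss; apply: (@summable_poly _ _ k c) => n.
rewrite (@gs_seq _ _ _ _ (undup (s n))) ?undup_uniq// => [|t tn]; last first.
  by rewrite mem_undup; exact: sP.
apply: le_trans (ler_norm_sum _ _ _) _.
apply: (@le_trans _ _ (\sum_(t <- undup (s n)) 1)).
  rewrite [leLHS]big_mkcond; apply: ler_sum => t _; case: ifP => // _; exact: w1.
rewrite big_const_seq count_predT iter_addr_0 -natrX -natrM ler_nat.
by apply: leq_trans (ss n); exact: size_undup.
Qed.

Lemma size_zbox m : size (zbox m) = (2 * m.+1)%N.
Proof. by rewrite size_cat !size_map !size_iota; lia. Qed.

Lemma summable_euler : summable (euler R).
Proof.
rewrite euler_pent; apply: (@summable_gs _ _ _ (fun n => zbox (2 * n + 2)) 1 6) => [t|n t tn|n].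
- by rewrite normrX normrN1 expr1n.
- by apply: zboxP; have := pentE t; nia.
- by rewrite size_zbox; lia.
Qed.

Lemma summable_theta_a : summable (theta_a R).
Proof.
apply: (@summable_gs _ _ _ (fun n => [seq (i, j) | i <- zbox (2 * n + 2), j <- zbox (2 * n + 2)])
  2 36) => [t|n [u v] tn|n].
- by rewrite normr1.
- have q := qfE (u, v); rewrite /= in q.
  rewrite allpairs_f//; apply: zboxP.
    apply: (@leq_trans (2 * qf (u, v) + 2)); last by lia.
    apply: absz_le_form; rewrite q; have : 0 <= (2 * v + u) ^+ 2 by exact: sqr_ge0.
    have : 0 <= `|u| by []; nia.
  apply: (@leq_trans (2 * qf (u, v) + 2)); last by lia.
  apply: absz_le_form; rewrite q; have : 0 <= (2 * u + v) ^+ 2 by exact: sqr_ge0.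
  have : 0 <= `|v| by []; nia.
- by rewrite size_allpairs !size_zbox; nia.
Qed.

Lemma summable_sigma k : summable (sigma R k).
Proof.
apply: (@summable_poly _ _ k.+1 1) => n; rewrite mul1r.
have [->|n0] := posnP n; first by rewrite /sigma /= normr0 exprn_ge0.
rewrite (@sigmaE _ _ _ n) ?n0 ?leqnn//; apply: le_trans (ler_norm_sum _ _ _) _.
apply: (@le_trans _ _ (\sum_(0 <= i < n) n.+1%:R ^+ k)).
  rewrite [leLHS]big_mkcond; apply: ler_sum_nat => i /andP[_ i_n]; case: ifP => _.
    by rewrite normrX normr_nat lerXn2r ?nnegrE// ler_nat ltnW// ltnS.
  by rewrite exprn_ge0.
by rewrite sumr_const_nat subn0 -[leLHS]mulr_natl exprS ler_wpM2r ?exprn_ge0// ler_nat.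
Qed.

Lemma summable_eis2 : summable (eis2 R).
Proof.
apply: summableB; first exact: summable1.
by apply: summableM; [exact: summable_nat|exact: summable_sigma].
Qed.

Lemma summable_eis4 : summable (eis4 R).
Proof.
apply: summableD; first exact: summable1.
by apply: summableM; [exact: summable_nat|exact: summable_sigma].
Qed.

Lemma summable_theta_b3 : summable (theta_b3 R).
Proof.
apply: summableM; first exact: summableC.
apply: summableB.
  apply: summableM; first exact: summable_theta_a.
  apply: summableB; last exact: summable_eis2.
  by apply: summableM; [exact: summable_nat|exact/summable_sub3/summable_eis2].
by apply: summableM; [exact: summable_nat|exact/summableDer/summable_theta_a].
Qed.

Lemma summable_rankin_cohen : summable (rankin_cohen R).
Proof.
have sD := summableDer summable_theta_a.
apply: summableB; first by apply: summableM; [exact: summable_theta_a|exact: summableDer].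
by apply: summableM; [exact: summable_nat|exact: summableX].
Qed.

(** ** The infinite product *)

Lemma psum_euler x N : psum (euler R) x (N ^ 2 + 'C(N.+1, 2)).+1 = pent_sum x N.
Proof.
pose s := [seq Posz j | j <- iota 0 N.+1] ++ [seq Negz j | j <- iota 0 N].
have us : uniq s.
  rewrite cat_uniq !map_inj_uniq ?iota_uniq//; try by move=> ? ? [].
  by rewrite andbT -all_predC; apply/allP => _ /mapP[j _ ->]; apply/mapP => -[].
have dC m : (2 * 'C(m.+1, 2) = m.+1 * m)%N by exact: double_bin2.
have dC' m : (2 * 'C(m, 2) = m * m.-1)%N by case: m.
have sP t : (pent t <= N ^ 2 + 'C(N.+1, 2))%N = (t \in s).
  have := dC N; rewrite mem_cat; case: t => [j|j] dN.
    rewrite mem_map; last by move=> ? ? [].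
    have -> : (Posz j \in [seq Negz i | i <- iota 0 N]) = false by apply/mapP => -[].
    by have dj := dC' j; rewrite orbF mem_iota /pent; apply/idP/idP; nia.
  rewrite (mem_map (f := Negz)); last by move=> ? ? [].
  have -> : (Negz j \in [seq Posz i | i <- iota 0 N.+1]) = false by apply/mapP => -[].
  by have dj := dC j.+1; rewrite mem_iota /pent; apply/idP/idP; nia.
set M := (N ^ 2 + 'C(N.+1, 2))%N in sP *.
transitivity (\sum_(t <- s) (-1) ^+ `|t| * x ^+ pent t).
  rewrite /psum euler_pent; transitivity (\sum_(0 <= n < M.+1)
      \sum_(t <- s) (if pent t == n then (-1) ^+ `|t| * x ^+ n else 0)).
    apply: eq_big_nat => n /andP[_ nM]; rewrite (gs_seq _ us) => [|t tn]; last first.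
      by rewrite -sP; apply: leq_trans tn _; rewrite -ltnS.
    by rewrite mulr_suml big_mkcond.
  rewrite exchange_big /= [LHS]big_seq [RHS]big_seq; apply: eq_bigr => t; rewrite -sP => tM.
  rewrite (bigD1_seq (pent t)) ?iota_uniq ?mem_index_iota//= eqxx big1 ?addr0// => n.
  by rewrite eq_sym => /negbTE ->.
rewrite big_cat !big_map /= big_cons (iotaDl 1) big_map /pent_sum /= expr0 mul1r.
rewrite -addrA; congr (_ + _); rewrite /index_iota subn0 -big_split.
apply: eq_bigr => j _ /=; rewrite add1n mulrDr; congr (_ + _).
Qed.

Lemma qpoch01 x m n : 0 < x < 1 -> 0 <= qpoch x m n <= 1.
Proof.
move=> /andP[x0 x1]; rewrite /qpoch.
have h i : 0 <= 1 - x ^+ i.+1 <= 1.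
  rewrite subr_ge0 exprn_ile1 ?(ltW x1) ?(ltW x0)//= gerBl exprn_ge0// ltW//.
elim/big_ind : _ => [|y z /andP[y0 y1] /andP[z0 z1]|i _]; first by rewrite ler01 lexx.
  by rewrite mulr_ge0//= mulr_ile1.
exact: h.
Qed.

(** By [shanks] at a real point, the partial products differ from partial sums of
    the pentagonal series by at most n x^n. *)
Lemma qpoch_cvg x : 0 < x < 1 -> qpoch x 0 n @[n --> \oo] --> ev (euler R) x.
Proof.
move=> x01; have /andP[x0 x1] := x01.
have c1 : pent_sum x n @[n --> \oo] --> ev (euler R) x.
  have -> : pent_sum x = (fun n => psum (euler R) x (n ^ 2 + 'C(n.+1, 2)).+1).
    by apply/funext => n; rewrite psum_euler.
  apply: cvg_comp (psum_cvg summable_euler x01); apply/cvgnyPge => M; near=> n.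
  apply: (@leq_trans n); first by near: n; exact: nbhs_infty_ge.
  by rewrite ltnW// ltnS; nia.
have c2 : (n%:R * x ^+ n) @[n --> \oo] --> (0 : R).
  have sD : summable (D (fun=> 1 : R)).
    by apply: summableDer; apply: (@summable_poly _ _ 0 1) => n; rewrite normr1 mulr1.
  rewrite (_ : (fun n => n%:R * x ^+ n) = (fun n => D (fun=> 1 : R) n * x ^+ n)).
    exact: cvg_series_cvg_0 (cvgP _ (psum_cvg sD x01)).
  by apply/funext => n; rewrite DE mulr1.
have c3 : (qpoch x 0 n - pent_sum x n) @[n --> \oo] --> (0 : R).
  apply/norm_cvg0P; apply: (squeeze_cvgr _ (cvg_cst 0) c2); apply: nearW => n /=.
  rewrite normr_ge0 /= -shanks big_nat_recl//= mul0n bin_small// expr0 mul1r mulr1.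
  rewrite opprD addNKr normrN; apply: le_trans (ler_norm_sum _ _ _) _.
  have -> : n%:R * x ^+ n = \sum_(0 <= s < n) x ^+ n by rewrite sumr_const_nat subn0 mulr_natl.
  apply: ler_sum_nat => s _.
  have /andP[q0 q1] := qpoch01 s.+1 n x01.
  rewrite !normrM normrX normrN1 expr1n mul1r (ger0_norm q0) (ger0_norm (exprn_ge0 _ (ltW x0))).
  apply: (@le_trans _ _ (x ^+ (s.+1 * n + 'C(s.+2, 2)))).
    by rewrite ler_piMl// exprn_ge0// ltW.
  by apply: ler_wiXn2l; rewrite ?ltW//; nia.
rewrite -[ev _ x]add0r (_ : (fun n => qpoch x 0 n) =
  (fun n => (qpoch x 0 n - pent_sum x n) + pent_sum x n)).
  exact: cvgD.
by apply/funext => n; rewrite subrK.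
Unshelve. all: by end_near. Qed.

(** By Weierstrass's inequality the product of the factors beyond a large N is at
    least 1/2. *)
Lemma euler_gt0 x : 0 < x < 1 -> 0 < ev (euler R) x.
Proof.
move=> x01; have /andP[x0 x1] := x01.
have [N NP] : exists N, x ^+ N.+1 / (1 - x) <= 2^-1.
  have : x ^+ n @[n --> \oo] --> (0 : R).
    rewrite (_ : (fun n => x ^+ n) = geometric 1 x).
      by apply: cvg_geometric; rewrite ger0_norm ?ltW.
    by apply/funext => n; rewrite /= mul1r.
  move=> /cvgrPdist_le /(_ ((1 - x) / 2)); rewrite divr_gt0 ?subr_gt0// => /(_ isT) [N _ NP].
  exists N; rewrite ler_pdivrMr ?subr_gt0// mulrC.
  have := NP N.+1 (leqnSn N); rewrite sub0r normrN ger0_norm// exprn_ge0// ltW//.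
have low M : 1 - x ^+ N.+1 / (1 - x) * (1 - x ^+ M) <= qpoch x N (N + M).
  elim: M => [|M IHM]; first by rewrite expr0 subrr mulr0 subr0 addn0 qpochnn.
  rewrite addnS qpoch_recr ?leq_addr//; have /andP[q0 q1] := qpoch01 N (N + M) x01.
  have xp : 0 <= x ^+ (N + M).+1 by rewrite exprn_ge0// ltW.
  apply: (@le_trans _ _ (qpoch x N (N + M) - x ^+ (N + M).+1)).
    have e1 : x ^+ (N + M).+1 = x ^+ N.+1 * x ^+ M by rewrite -addSn exprD.
    rewrite e1 [x ^+ M.+1]exprS; move: IHM {q0 q1 xp e1}.
    move: (x ^+ N.+1) (x ^+ M) (qpoch x N (N + M)) => u v Q IHM.
    have -> : u / (1 - x) * (1 - x * v) = u / (1 - x) * (1 - v) + u * v.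
      by field; rewrite subr_eq0 gt_eqF.
    lra.
  by rewrite mulrBr mulr1 lerD2l lerN2 ler_piMl.
have PN : 0 < qpoch x 0 N.
  rewrite /qpoch; apply: prodr_gt0 => i _; rewrite subr_gt0 exprn_ilt1 ?ltW//.
suff : qpoch x 0 N / 2 <= ev (euler R) x by apply: lt_le_trans; rewrite divr_gt0.
have c := qpoch_cvg x01; rewrite -(cvg_lim _ c)//; apply: limr_ge; first exact: cvgP c.
near=> n; have Nn : (N <= n)%N by near: n; exact: nbhs_infty_ge.
rewrite (qpoch_cat _ (leq0n N) Nn) ler_pM2l// -(subnKC Nn); apply: le_trans (low _).
have : x ^+ N.+1 / (1 - x) * (1 - x ^+ (n - N)) <= 2^-1.
  apply: le_trans NP; rewrite ler_piMr ?divr_ge0 ?exprn_ge0 ?subr_ge0 ?ltW//.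
  by rewrite gtrBl exprn_gt0.
lra.
Unshelve. all: by end_near. Qed.

(** ** Uniqueness of the coefficients *)

(** If n is the least degree with a non-zero coefficient, dividing by x^n bounds this
    coefficient by a multiple of x, for all small x. *)
Lemma psum_eq0 (d : fps R) :
  (forall x, 0 < x < 1 -> psum d x @ \oo --> (0 : R)) -> d = 0.
Proof.
move=> d0; have [M MP] : exists M, forall n, `|d n| <= M * 2 ^+ n.
  have h01 : 0 < (2^-1 : R) < 1 by apply/andP; split; lra.
  have := cvg_series_cvg_0 (cvgP _ (d0 _ h01)) => /cvgP /cvg_seq_bounded [B [_ BP]].
  exists (B + 1) => n; have := BP (B + 1); rewrite ltrDl ltr01 => /(_ isT n I) /=.
  rewrite normrM (ger0_norm (_ : 0 <= 2^-1 ^+ n)) ?exprn_ge0 ?invr_ge0//.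
  by rewrite exprVn ler_pdivrMr ?exprn_gt0.
apply/funext; elim/ltn_ind => n IHn; rewrite fps0.
have M0 : 0 <= M by have := MP 0%N; rewrite expr0 mulr1; exact: le_trans.
have bound x : 0 < x <= 4^-1 -> `|d n| <= M * 2 ^+ n.+2 * x.
  move=> /andP[x0 x4]; have x01 : 0 < x < 1 by apply/andP; split; lra.
  have x20 : 0 <= 2 * x by lra.
  have tail N : `|psum d x (n.+1 + N)%N - d n * x ^+ n| <= M * 2 ^+ n.+2 * x * x ^+ n.
    rewrite /psum (big_cat_nat (n := n.+1)) ?leq_addr//= big_nat_recr//=.
    rewrite big_nat_cond big1 ?add0r => [|i /andP[/andP[_ i_n] _]]; last first.
      by rewrite IHn// fps0 mul0r.
    rewrite addrAC subrr add0r -{1}[n.+1]add0n big_addn addKn.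
    apply: le_trans (ler_norm_sum _ _ _) _.
    apply: (@le_trans _ _ (\sum_(0 <= i < N) M * (2 * x) ^+ n.+1 * 2^-1 ^+ i)).
      apply: ler_sum_nat => i _; rewrite normrM (ger0_norm (exprn_ge0 _ (ltW x0))).
      apply: (@le_trans _ _ (M * 2 ^+ (i + n.+1) * x ^+ (i + n.+1))).
        by rewrite ler_wpM2r ?exprn_ge0// ltW.
      rewrite -!mulrA -exprMn ler_wpM2l// addnC exprD ler_wpM2l ?exprn_ge0//.
      by rewrite lerXn2r ?nnegrE ?invr_ge0//; lra.
    rewrite -mulr_sumr.
    have -> : \sum_(0 <= i < N) 2^-1 ^+ i = 2 - 2 * 2^-1 ^+ N :> R.
      elim: (N) => [|m IHm]; first by rewrite big_geq// expr0; lra.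
      by rewrite big_nat_recr//= IHm exprS; lra.
    have -> : M * 2 ^+ n.+2 * x * x ^+ n = M * (2 * x) ^+ n.+1 * 2.
      by rewrite exprMn !exprS; move: (2 ^+ n) (x ^+ n) => u v; ring.
    have p3 : 0 <= (2^-1 : R) ^+ N by rewrite exprn_ge0// invr_ge0.
    by rewrite ler_wpM2l ?mulr_ge0 ?exprn_ge0//; lra.
  rewrite -(@ler_pM2r _ (x ^+ n)) ?exprn_gt0//.
  have := d0 x x01; rewrite -(cvg_shiftn n.+1) => c.
  have c' : (psum d x (N + n.+1)%N - d n * x ^+ n) @[N --> \oo] --> (0 - d n * x ^+ n).
    by apply: cvgB => //; exact: cvg_cst.
  have c2 : `|psum d x (N + n.+1)%N - d n * x ^+ n| @[N --> \oo] --> `|0 - d n * x ^+ n|.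
    exact: cvg_norm.
  rewrite sub0r normrN normrM (ger0_norm (exprn_ge0 _ (ltW x0))) in c2.
  rewrite -(cvg_lim _ c2)//; apply: limr_le; first exact: cvgP c2.
  by apply: nearW => N; rewrite addnC; exact: tail.
apply/eqP; rewrite -normr_le0; apply/ler_addgt0Pr => eps eps0; rewrite add0r.
pose K := M * 2 ^+ n.+2.
have K0 : 0 <= K by rewrite mulr_ge0 ?exprn_ge0.
have x0 : 0 < Num.min 4^-1 (eps / (K + 1)) by rewrite lt_min divr_gt0 ?andbT//; lra.
apply: le_trans (bound (Num.min 4^-1 (eps / (K + 1))) _) _.
  by rewrite x0 ge_min lexx.
rewrite -/K; apply: (@le_trans _ _ (K * (eps / (K + 1)))).
  by rewrite ler_wpM2l// ge_min lexx orbT.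
by rewrite mulrCA ler_piMr ?(ltW eps0)// ler_pdivrMr; lra.
Qed.

End Convergence.

(** * Evaluation on the imaginary axis *)

Section ImaginaryAxis.
Variable R : realType.
Implicit Types x : R.

Lemma normc_ge_Im (w : R[i]) : `|complex.Im w|%:C <= `|w|.
Proof. by rewrite normc_def lecR -sqrtr_sqr ler_wsqrtr// lerDr sqr_ge0. Qed.

Lemma cvg_real_complex (u : R^nat) (l : R) : u @ \oo --> l ->
  ((u N)%:C : R[i]^o) @[N --> \oo] --> (l%:C : R[i]^o).
Proof.
move=> /cvgrPdist_lt ul; apply/cvgrPdist_lt => eps.
rewrite ltcE /= => /andP[/eqP e0 eps0]; have := ul _ eps0; apply: filterS => n H.
have -> : eps = (complex.Re eps)%:C by case: eps e0 {eps0 H} => a b /= ->.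
by rewrite -rmorphB normc_def /= expr0n addr0 sqrtr_sqr ltcR.
Qed.

Lemma cvg_Re (u : nat -> R[i]) (l : R[i]) : (u N : R[i]^o) @[N --> \oo] --> (l : R[i]^o) ->
  complex.Re (u N) @[N --> \oo] --> complex.Re l.
Proof.
move=> /cvgrPdist_lt ul; apply/cvgrPdist_lt => eps eps0.
have : 0 < eps%:C :> R[i] by rewrite ltcR.
move=> /ul; apply: filterS => n H; rewrite -ltcR; apply: le_lt_trans H.
by rewrite -[_ - _](raddfB (@complex.Re R)) normc_ge_Re.
Qed.

Lemma cvg_Im (u : nat -> R[i]) (l : R[i]) : (u N : R[i]^o) @[N --> \oo] --> (l : R[i]^o) ->
  complex.Im (u N) @[N --> \oo] --> complex.Im l.
Proof.
move=> /cvgrPdist_lt ul; apply/cvgrPdist_lt => eps eps0.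
have : 0 < eps%:C :> R[i] by rewrite ltcR.
move=> /ul; apply: filterS => n H; rewrite -ltcR; apply: le_lt_trans H.
by rewrite -[_ - _](raddfB (@complex.Im R)) normc_ge_Im.
Qed.

Lemma lim_real_complex (u : R^nat) (l : R) : u @ \oo --> l ->
  lim (((u N)%:C : R[i]^o) @[N --> \oo]) = l%:C.
Proof. by move=> ul; apply: cvg_lim; [exact: norm_hausdorff|exact: cvg_real_complex]. Qed.

(** The point of the imaginary axis at which q takes the value x. *)
Definition ipt x : R[i] := 0 +i* (- ln x / (2 * pi)).

Lemma pi_neq0 : pi != 0 :> R. Proof. by rewrite gt_eqF// pi_gt0. Qed.

Lemma qpow_imag s y : qpow s (0 +i* y) = (expR (- (2 * pi * s * y)))%:C :> R[i].
Proof.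
rewrite /qpow (_ : _ * _ = (- (2 * pi * s * y))%:C); last first.
  by simpc; congr (_ +i* _); ring.
by rewrite /cexp /= cos0 sin0 mulr1 mulr0.
Qed.

Lemma ipt_Im x : 0 < x < 1 -> 0 < complex.Im (ipt x).
Proof.
move=> /andP[x0 x1]; rewrite divr_gt0 ?mulr_gt0 ?pi_gt0// oppr_gt0.
by apply: ln_lt0; rewrite x0 x1.
Qed.

Lemma mul3_ipt x : 3 * ipt x = 0 +i* (3 * (- ln x / (2 * pi))).
Proof.
have -> : 3 = (3%:R : R)%:C :> R[i] by rewrite rmorph_nat.
by rewrite /ipt; simpc.
Qed.

Lemma q_ipt x : 0 < x -> q (ipt x) = x%:C.
Proof.
move=> x0; rewrite /q qpow_imag (_ : - _ = ln x) ?lnK ?posrE//.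
by move: pi pi_neq0 => p p0; field.
Qed.

Lemma q_mul3_ipt x : 0 < x -> q (3 * ipt x) = (x ^+ 3)%:C.
Proof.
move=> x0; rewrite mul3_ipt /q qpow_imag (_ : - _ = 3 * ln x).
  by rewrite expRM_natl lnK ?posrE.
by move: pi pi_neq0 => p p0; field.
Qed.

(** The fractional powers of q in eta: r is the positive 24th root of x. *)
Lemma qpow_ipt x : 0 < x ->
  exists r : R, [/\ 0 < r, r ^+ 24 = x, qpow 24^-1 (ipt x) = r%:C &
    qpow 24^-1 (3 * ipt x) = (r ^+ 3)%:C].
Proof.
move=> x0; exists (expR (ln x / 24)); split.
- exact: expR_gt0.
- by rewrite -expRM_natl mulrC divfK ?pnatr_eq0// lnK ?posrE.
- by rewrite qpow_imag; congr (expR _)%:C; move: pi pi_neq0 => p p0; field.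
- by rewrite mul3_ipt qpow_imag -expRM_natl; congr (expR _)%:C; move: pi pi_neq0 => p p0; field.
Qed.

Lemma lim_euler x : 0 < x < 1 ->
  lim ((\prod_(1 <= n < N) (1 - x%:C ^+ n) : R[i]^o) @[N --> \oo]) = (ev (euler R) x)%:C.
Proof.
move=> x01.
have -> : (fun N => \prod_(1 <= n < N) (1 - x%:C ^+ n) : R[i]^o) =
    (fun N => (\prod_(1 <= n < N) (1 - x ^+ n))%:C : R[i]^o).
  apply/funext => N; rewrite rmorph_prod; apply: eq_bigr => n _.
  by rewrite rmorphB rmorph1 rmorphXn.
apply: lim_real_complex; rewrite -cvg_shiftS; apply: cvg_trans (qpoch_cvg x01); apply: near_eq_cvg.
by apply: nearW => N /=; rewrite /qpoch big_add1.
Qed.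

Lemma eta_ipt x r : 0 < x < 1 -> qpow 24^-1 (ipt x) = r%:C ->
  eta (ipt x) = (r * ev (euler R) x)%:C.
Proof.
move=> x01 rE; have x0 : 0 < x by case/andP: x01.
by rewrite /eta rE q_ipt// lim_euler// rmorphM.
Qed.

Lemma eta_mul3_ipt x r : 0 < x < 1 -> qpow 24^-1 (3 * ipt x) = r%:C ->
  eta (3 * ipt x) = (r * ev (sub3 (euler R)) x)%:C.
Proof.
move=> x01 rE; have x0 : 0 < x by case/andP: x01.
rewrite /eta rE q_mul3_ipt// lim_euler ?cube01// ev_sub3//; first by rewrite rmorphM.
exact: summable_euler.
Qed.

Lemma lim_sigma3 x : 0 < x < 1 ->
  lim ((\sum_(1 <= n < N) (sigma3 n)%:R * x%:C ^+ n : R[i]^o) @[N --> \oo])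
  = (ev (sigma R 3) x)%:C.
Proof.
move=> x01.
have -> : (fun N => \sum_(1 <= n < N) (sigma3 n)%:R * x%:C ^+ n : R[i]^o) =
    (fun N => (\sum_(1 <= n < N) (sigma3 n)%:R * x ^+ n)%:C : R[i]^o).
  apply/funext => N; rewrite rmorph_sum; apply: eq_bigr => n _.
  by rewrite rmorphM rmorph_nat rmorphXn.
apply: lim_real_complex; have c := psum_cvg (@summable_sigma R 3) x01.
apply: cvg_trans c; apply: near_eq_cvg.
apply: nearW => -[|N] /=; first by rewrite /psum !big_geq.
rewrite /psum [LHS]big_ltn// {1}/sigma /= mul0r add0r.
apply: eq_big_nat => n /andP[n0 _]; rewrite /sigma gtn_eqF// /sigma3 natr_sum.
by congr (_ * _); apply: eq_bigr => d _; rewrite natrX.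
Qed.

Lemma ev_eis4 x : 0 < x < 1 -> ev (eis4 R) x = 1 + 240 * ev (sigma R 3) x.
Proof.
move=> x01; have s3 := @summable_sigma R 3; have s240 := @summable_nat R 240.
by rewrite evD ?evM ?ev1 ?ev_nat//; [exact: summable1|exact: summableM].
Qed.

Lemma E4_ipt x : 0 < x < 1 -> E4 (ipt x) = (ev (eis4 R) x)%:C.
Proof.
move=> x01; have x0 : 0 < x by case/andP: x01.
by rewrite /E4 q_ipt// lim_sigma3// ev_eis4// rmorphD rmorph1 rmorphM rmorph_nat.
Qed.

Lemma E4_mul3_ipt x : 0 < x < 1 -> E4 (3 * ipt x) = (ev (sub3 (eis4 R)) x)%:C.
Proof.
move=> x01; have x0 : 0 < x by case/andP: x01.
have x31 := cube01 x01; rewrite /E4 q_mul3_ipt// lim_sigma3// ev_sub3//; last exact: summable_eis4.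
by rewrite ev_eis4// rmorphD rmorph1 rmorphM rmorph_nat.
Qed.

(** ** Fourier coefficients from values on the imaginary axis *)

(** Real and imaginary parts of the expansion on the imaginary axis are real power
    series in x = q, to which [psum_eq0] applies. *)
Lemma fourier_coef (f : R[i] -> R[i]) (tau : nat -> R[i]) (g : fps R) :
    fourier_expansion f tau -> summable g ->
    (forall x, 0 < x < 1 -> f (ipt x) = (ev g x)%:C) ->
  forall n, (0 < n)%N -> tau n = (g n)%:C.
Proof.
move=> ftau sg fg n n0.
have ftau' x : 0 < x < 1 ->
    (\sum_(1 <= m < N) tau m * x%:C ^+ m : R[i]^o) @[N --> \oo] --> ((ev g x)%:C : R[i]^o).
  move=> x01; have := ftau (ipt x) (ipt_Im x01).
  by rewrite q_ipt ?fg//; case/andP: x01.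
have reE x N : complex.Re (\sum_(1 <= m < N) tau m * x%:C ^+ m) =
    \sum_(1 <= m < N) complex.Re (tau m) * x ^+ m.
  rewrite (raddf_sum (@complex.Re R)); apply: eq_bigr => m _ /=; rewrite -rmorphXn.
  by case: (tau m) => u v; simpc.
have imE x N : complex.Im (\sum_(1 <= m < N) tau m * x%:C ^+ m) =
    \sum_(1 <= m < N) complex.Im (tau m) * x ^+ m.
  rewrite (raddf_sum (@complex.Im R)); apply: eq_bigr => m _ /=; rewrite -rmorphXn.
  by case: (tau m) => u v; simpc.
(* The expansions start in degree 1: the constant term of g is compared with 0. *)
have re0 : (fun m => if m == 0%N then - g 0%N else complex.Re (tau m) - g m) = 0 :> fps R.
  apply: psum_eq0 => x x01; have c := cvg_Re (ftau' x x01).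
  rewrite -(subrr (ev g x)); apply: cvg_trans (cvgB c (psum_cvg sg x01)).
  apply: near_eq_cvg; exists 1%N => // -[|N] // _.
  rewrite [LHS](_ : _ = complex.Re (\sum_(1 <= m < N.+1) tau m * x%:C ^+ m) - psum g x N.+1)//.
  rewrite reE /psum.
  rewrite [X in _ - X = _]big_ltn// [RHS]big_ltn// /= opprD addrCA mulNr; congr (_ + _).
  rewrite -sumrB; apply: eq_big_nat => m /andP[m0 _]; rewrite gtn_eqF// mulrBl//.
have im0 : (fun m => if m == 0%N then 0 else complex.Im (tau m)) = 0 :> fps R.
  apply: psum_eq0 => x x01; have c := cvg_Im (ftau' x x01).
  apply: cvg_trans c; apply: near_eq_cvg; exists 1%N => // -[|N] // _; rewrite imE /psum.
  rewrite [RHS]big_ltn// mul0r add0r.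
  by apply: eq_big_nat => m /andP[m0 _]; rewrite gtn_eqF.
have := congr1 (fun h : fps R => h n) re0; have := congr1 (fun h : fps R => h n) im0.
rewrite /= gtn_eqF// fps0; case: (tau n) => u v /= -> /eqP.
by rewrite subr_eq0 => /eqP ->.
Qed.

End ImaginaryAxis.

(** * The cusp forms on the imaginary axis *)

Section CuspForms.
Variable R : realType.
Implicit Types x : R.
Local Notation e := (euler R).
Local Notation E := (sub3 e).
Local Notation a := (theta_a R).
Local Notation b := (theta_b3 R).
Local Notation Q := (eis4 R).
Local Notation G := (rankin_cohen R).

(** The normalization is that of [delta7_identity] divided by 240. *)
Definition delta7 : fps R := fpsC 6^-1 * (a * G).

Let sum_e : summable e. Proof. exact: summable_euler. Qed.
Let sum_E : summable E. Proof. exact: summable_sub3. Qed.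
Let sum_Q : summable Q. Proof. exact: summable_eis4. Qed.
Let sum_Q3 : summable (sub3 Q). Proof. exact: summable_sub3. Qed.

Lemma summable_delta7 : summable delta7.
Proof.
apply: summableM; first exact: summableC.
by apply: summableM; [exact: summable_theta_a|exact: summable_rankin_cohen].
Qed.

Lemma ev_delta7 x : 0 < x < 1 ->
  ev delta7 x = 240^-1 * (ev Q x - ev (sub3 Q) x) * ev e x ^+ 9 / ev E x ^+ 3.
Proof.
move=> x01; have sb := @summable_theta_b3 R.
have E0 : ev E x != 0 by rewrite ev_sub3// gt_eqF// euler_gt0// cube01.
have b_eta : ev b x * ev E x ^+ 3 = ev e x ^+ 9.
  rewrite -!evX// -evM//; last exact: summableX.
  by rewrite theta_b3_euler.
have -> : delta7 = fpsC 240^-1 * ((Q - sub3 Q) * b).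
  rewrite delta7_identity /delta7 [RHS]mulrA -(rmorph_nat (@fpsC R)) -rmorphM.
  by congr (fpsC _ * _); field.
rewrite evM//; [|exact: summableC|by apply: summableM => //; exact: summableB].
rewrite evC evM ?evB//; last exact: summableB.
by rewrite -b_eta; move: (ev E x) E0 => u u0; field.
Qed.

Lemma Delta7_ipt x : 0 < x < 1 -> Delta7 (ipt x) = (ev delta7 x)%:C.
Proof.
move=> x01; have x0 : 0 < x by case/andP: x01.
have E0 : ev E x != 0 by rewrite ev_sub3// gt_eqF// euler_gt0// cube01.
have [r [r0 _ r1 r3]] := qpow_ipt x0.
rewrite /Delta7 E4_ipt// E4_mul3_ipt// (eta_ipt x01 r1) (eta_mul3_ipt x01 r3).
have -> : 240 = (240%:R : R)%:C :> R[i] by rewrite rmorph_nat.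
rewrite -fmorphV -rmorphB -!rmorphXn -fmorphV -!rmorphM ev_delta7//; congr _%:C.
move: (ev E x) (ev e x) (ev Q x) (ev _ x) E0 => u v s t u0.
by field; rewrite u0 gt_eqF.
Qed.

Lemma summable_eta_product i j k : summable (Xq ^+ i * e ^+ j * E ^+ k).
Proof.
apply: summableM; last exact: summableX.
by apply: summableM; apply: summableX => //; exact: summable_Xq.
Qed.

(** Up to the leading power of q, the function eta is the product [euler R]; the
    condition on the exponents makes the leading power integral. *)
Lemma eta_product_ipt i j k x : (j + 3 * k = 24 * i)%N -> 0 < x < 1 ->
  eta (ipt x) ^+ j * eta (3 * ipt x) ^+ k = (ev (Xq ^+ i * e ^+ j * E ^+ k) x)%:C.
Proof.
move=> jk x01; have x0 : 0 < x by case/andP: x01.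
have [r [_ rx r1 r3]] := qpow_ipt x0.
rewrite (eta_ipt x01 r1) (eta_mul3_ipt x01 r3) -!(rmorphXn (@real_complex R)) -rmorphM.
have sX i' : summable (Xq ^+ i' : fps R) by apply: summableX; exact: summable_Xq.
rewrite evM ?evX//; [|apply: summableM => //; exact: summableX|exact: summableX].
rewrite evM ?evX//; [|exact: summable_Xq|exact: summableX].
rewrite evXq -rx -exprM -jk exprD exprMn exprMn exprM; congr _%:C.
by rewrite -!mulrA; congr (_ * _); rewrite mulrCA.
Qed.

Lemma Delta11_1_ipt x : 0 < x < 1 -> Delta11_1 (ipt x) = (ev (Q * delta7) x)%:C.
Proof.
move=> x01; rewrite /Delta11_1 E4_ipt// Delta7_ipt// -rmorphM (@evM _ _ delta7)//.
exact: summable_delta7.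
Qed.

Lemma Delta11_2_ipt x : 0 < x < 1 -> Delta11_2 (ipt x) = (ev (sub3 Q * delta7) x)%:C.
Proof.
move=> x01; rewrite /Delta11_2 E4_mul3_ipt// Delta7_ipt// -rmorphM (@evM _ _ delta7)//.
exact: summable_delta7.
Qed.

Section Coefficients.
Variables (tau7 tau9_1 tau9_2 tau11_1 tau11_2 : nat -> R[i]).
Variables (n : nat) (n0 : (0 < n)%N).

Lemma coef_delta7 : fourier_expansion (@Delta7 R) tau7 ->
  tau7 n = (6^-1 * (a * G) n)%:C.
Proof.
move=> h; rewrite (fourier_coef h summable_delta7 Delta7_ipt n0) /delta7.
by rewrite fpsCM.
Qed.

Lemma coef_delta9 : fourier_expansion (@Delta9_1 R) tau9_1 ->
  fourier_expansion (@Delta9_2 R) tau9_2 ->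
  27 * tau9_1 n + tau9_2 n = (6^-1 * (a ^+ 3 * G) n)%:C.
Proof.
move=> h1 h2; have s1 := summable_eta_product 2 3 15; have s2 := summable_eta_product 1 15 3.
rewrite (fourier_coef h1 s1 (fun x => @eta_product_ipt 2 3 15 x erefl) n0).
rewrite (fourier_coef h2 s2 (fun x => @eta_product_ipt 1 15 3 x erefl) n0) expr1.
rewrite -delta9_identity fps_natM fpsD fps_natM -(rmorph_nat (@real_complex R)) -rmorphM -rmorphD.
by congr _%:C; field.
Qed.

Lemma coef_delta11 : fourier_expansion (@Delta11_1 R) tau11_1 ->
  fourier_expansion (@Delta11_2 R) tau11_2 ->
  tau11_1 n + 9 * tau11_2 n = (5 / 3 * (a ^+ 5 * G) n)%:C.
Proof.
move=> h1 h2; have sd := summable_delta7.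
rewrite (fourier_coef h1 (summableM sum_Q sd) Delta11_1_ipt n0).
rewrite (fourier_coef h2 (summableM sum_Q3 sd) Delta11_2_ipt n0).
have -> : 9 = (9%:R : R)%:C :> R[i] by rewrite rmorph_nat.
rewrite -rmorphM -rmorphD; congr _%:C; rewrite -fps_natM -fpsD -fpsCM.
congr (_ n); apply: (@fps_natI _ 239).
have H := delta11_identity R; rewrite delta7_identity in H.
have -> : fpsC (5 / 3) = 10 * fpsC 6^-1 :> fps R.
  by rewrite -(rmorph_nat (@fpsC R)) -rmorphM; congr fpsC; field.
rewrite /delta7; apply: (@fps_natI _ 39).
transitivity (240 * fpsC 6^-1 * ((Q + 9 * sub3 Q) * (40 * (a * G)))); first by ring.
by rewrite H; ring.
Qed.

End Coefficients.
End CuspForms.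

Unset Implicit Arguments.

Theorem corollary2p2 (R : realType)
    (tau7 tau9_1 tau9_2 tau11_1 tau11_2 : nat -> R[i])
    (htau7 : fourier_expansion (@Delta7 R) tau7)
    (htau9_1 : fourier_expansion (@Delta9_1 R) tau9_1)
    (htau9_2 : fourier_expansion (@Delta9_2 R) tau9_2)
    (htau11_1 : fourier_expansion (@Delta11_1 R) tau11_1)
    (htau11_2 : fourier_expansion (@Delta11_2 R) tau11_2)
    (n : nat) (hn : (0 < n)%N) :
  [/\ tau7 n =
        30^-1 * (\sum_(x \in representations 3 n)
          (15 * x`_0 ^+ 4 - 12 * n%:Z * x`_0 ^+ 2 + n%:Z ^+ 2))%:~R,
      27 * tau9_1 n + tau9_2 n =
        168^-1 * (\sum_(x \in representations 5 n)
          (63 * x`_0 ^+ 4 - 36 * n%:Z * x`_0 ^+ 2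
           + 2 * n%:Z ^+ 2))%:~R
    & tau11_1 n + 9 * tau11_2 n =
        (5 / 81) * (\sum_(x \in representations 7 n)
          (54 * x`_0 ^+ 4 - 24 * n%:Z * x`_0 ^+ 2 + n%:Z ^+ 2))%:~R ].
Proof.
have natC m : m%:R = (m%:R : R)%:C :> R[i] by rewrite rmorph_nat.
have intC m : m%:~R = (m%:~R : R)%:C :> R[i] by rewrite rmorph_int.
split.
- rewrite (coef_delta7 hn htau7) intC representation_sum3 natC -fmorphV -rmorphM.
  by congr _%:C; field.
- rewrite (coef_delta9 hn htau9_1 htau9_2) intC representation_sum5 natC -fmorphV -rmorphM.
  by congr _%:C; field.
- rewrite (coef_delta11 hn htau11_1 htau11_2) intC representation_sum7 (natC 5%N) (natC 81%N).
  by rewrite -fmorphV -!rmorphM; congr _%:C; field.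
Qed.
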